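(* Let $x,t$ be nonzero complex numbers and $\nu\in\mathbb{C}$. (1) For $\mathbb{K}=\mathbb{Q}$, \[G_{\mathbb{Q},\nu}(xt)=\cos(\pi\nu)\left\{\frac{2}{\pi}K_{2\nu}(2\sqrt{xt})-Y_{2\nu}(2\sqrt{xt})\right\}-\sin(\pi\nu)J_{2\nu}(2\sqrt{xt}).\] (2) For $\mathbb{K}$ an imaginary quadratic field, \begin{align*} G_{\mathbb{K},\nu}(xt)=\frac{\sqrt{\pi}}{\sin(2\pi\nu)}\Bigg\{&\frac{2^{1-4\nu}}{\Gamma^2(1-2\nu)}\left(\frac{xt}{4}\right)^{-\nu}{}_0F_5\!\left(-;1-\nu,1-\nu,\tfrac12-\nu,\tfrac12-\nu,\tfrac12;-\tfrac{x^2t^2}{16}\right)\\ &-\frac{2^{1+2\nu}\cos(\pi\nu)}{\Gamma(1+2\nu)}\left(\frac{xt}{4}\right)^{\nu}{}_0F_5\!\left(-;1+\nu,\tfrac12+\nu,\tfrac12,\tfrac12,1;-\tfrac{x^2t^2}{16}\right)\\ &-\frac{2^{4+2\nu}\sin(\pi\nu)}{\Gamma(2+2\nu)}\left(\frac{xt}{4}\right)^{1+\nu}{}_0F_5\!\left(-;\tfrac32+\nu,1+\nu,\tfrac32,\tfrac32,1;-\tfrac{x^2t^2}{16}\right)\Bigg\}. \end{align*}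
   Context: For a number field $\mathbb{K}$ of degree $d$ and signature $(r_1,r_2)$ ($d=r_1+2r_2$; so $\mathbb{Q}$ has $(d,r_1,r_2)=(1,1,0)$ and an imaginary quadratic field has $(2,0,1)$), $(v)_\ell$ denotes the $\ell$-tuple with all entries $v$, and for $\nu\in\mathbb{C}$, $x\ne0$, $G_{\mathbb{K},\nu}(x)=G^{d+1,0}_{0,2(d+1)}\left(\begin{smallmatrix}-\\ -\frac{\nu}{2},(\frac{\nu}{2})_{r_1+r_2},(\frac{1+\nu}{2})_{r_2};\ \frac{1-\nu}{2},(\frac{\nu}{2})_{r_2},(\frac{1+\nu}{2})_{r_1+r_2}\end{smallmatrix}\Big|\frac{x^2}{16}\right)$, with the first $d+1$ lower parameters being $b_1,\dots,b_{d+1}$. Here $G^{m,n}_{p,q}\left(\begin{smallmatrix}a_1,\dots,a_p\\ b_1,\dots,b_q\end{smallmatrix}\big| z\right)=\frac{1}{2\pi i}\int_{C}\frac{\prod_{j=1}^m\Gamma(b_j-s)\prod_{j=1}^n\Gamma(1-a_j+s)}{\prod_{j=m+1}^q\Gamma(1-b_j+s)\prod_{j=n+1}^p\Gamma(a_j-s)}z^s\,ds$ is the Meijer $G$-function (contour separating the poles of $\Gamma(b_j-s)$, $j\le m$, from those of $\Gamma(1-a_j+s)$, $j\le n$). $J_\nu,Y_\nu$ are Bessel functions of the first and second kind, $K_\nu$ the modified Bessel function of the second kind (with $Y_n,K_n$ for integer $n$ defined as limits), and ${}_pF_q$ the generalized hypergeometric series.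
   Formalization: In (2) the sign of the third 0F5 term is corrected from minus to plus (the residue at s=(1+ν)/2 is positive); when 2ν is an integer the right side of (2) is read as a limit; G is taken on the branch log(x²t²/16) = 2 log(xt/4). *)

(* Defs.v *)
From mathcomp Require Import all_boot all_algebra all_field.
From mathcomp Require Import finmap boolp classical_sets cardinality Rstruct.
From Stdlib Require Import Reals ZArith ClassicalEpsilon.
From Coquelicot Require Import Coquelicot.

Local Open Scope R_scope.
Local Open Scope C_scope.

(* Complex elementary functions; [Carg], [Clog] and [Cpower] are the principal
   branches, with argument in (-PI, PI], and are meaningful away from 0. *)

Definition Cexp (z : C) : C :=
  (exp (Re z) * cos (Im z), exp (Re z) * sin (Im z))%R.

Definition Carg (z : C) : R :=
  if Rle_dec 0 (Im z) then acos (Re z / Cmod z)%R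
  else (- acos (Re z / Cmod z))%R.

Definition Clog (z : C) : C := (ln (Cmod z), Carg z).

Definition Cpower (z w : C) : C := Cexp (w * Clog z).

Definition Csqrt (z : C) : C := Cpower z (1 / 2).

Definition Ccos (z : C) : C := (Cexp (Ci * z) + Cexp (- (Ci * z))) / 2.

Definition Csin (z : C) : C := (Cexp (Ci * z) - Cexp (- (Ci * z))) / (2 * Ci).

(* The limit of f along F in C; meaningful when the limit exists. *)
Definition Climit {T : Type} (F : (T -> Prop) -> Prop) (f : T -> C) : C :=
  iota (T := C_R_CompleteNormedModule)
       (fun l : C_R_CompleteNormedModule =>
          filterlim (f : T -> C_R_CompleteNormedModule) F (locally l)).

Definition Cseries (a : nat -> C) : C :=
  Climit eventually (fun n => sum_n a n).

Definition Cprod (l : seq C) : C := foldr Cmult 1 l.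

(* (a)_k = a (a + 1) ... (a + k - 1) *)
Definition pochhammer (a : C) (k : nat) : C :=
  Cprod [seq a + INR j | j <- seq.iota 0 k].

(* Gauss's limit n! n^z / (z (z + 1) ... (z + n)).  Since / 0 = 0 in C, at a
   pole this is 0, so that [/ Cgamma z] is the entire function 1 / Gamma at
   every z. *)
Definition Cgamma (z : C) : C :=
  Climit eventually
    (fun n : nat => INR n`! * Cpower (INR n) z / pochhammer z n.+1).

Definition hypergeometric (a b : seq C) (z : C) : C :=
  Cseries (fun k : nat =>
    Cprod [seq pochhammer aj k | aj <- a] /
    Cprod [seq pochhammer bj k | bj <- b] * (z ^ k / INR k`!)).

Definition besselJ (nu z : C) : C :=
  Cpower (z / 2) nu *
  Cseries (fun k : nat =>
    (- (1)) ^ k / (INR k`! * Cgamma (nu + INR k + 1)) * (z / 2) ^ (2 * k)).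

Definition besselI (nu z : C) : C :=
  Cpower (z / 2) nu *
  Cseries (fun k : nat =>
    1 / (INR k`! * Cgamma (nu + INR k + 1)) * (z / 2) ^ (2 * k)).

Definition is_Cint (z : C) : Prop := exists n : Z, z = IZR n.

(* f at nu if nu is not an integer, the limit of f at nu otherwise *)
Definition extend_at_integers (f : C -> C) (nu : C) : C :=
  if excluded_middle_informative (is_Cint nu) then Climit (locally' nu) f
  else f nu.

Definition besselY (nu z : C) : C :=
  extend_at_integers
    (fun mu => (besselJ mu z * Ccos (mu * PI) - besselJ (- mu) z)
               / Csin (mu * PI)) nu.

Definition besselK (nu z : C) : C :=
  extend_at_integers
    (fun mu => PI / 2 * (besselI (- mu) z - besselI mu z) / Csin (mu * PI)) nu.

(* v is the integral of f over the loop that comes in from +oo along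
   Im s = - T, goes up along Re s = sigma and returns to +oo along Im s = T. *)
Definition is_loop_integral (f : C -> C) (sigma T : R) (v : C) : Prop :=
  exists lower left upper : C,
    [/\ is_RInt_gen (V := C_R_NormedModule) (fun u : R => f (u, (- T)%R))
          (at_point sigma) (Rbar_locally p_infty) lower,
        is_RInt (V := C_R_NormedModule) (fun y : R => f (sigma, y))
          (- T)%R T left,
        is_RInt_gen (V := C_R_NormedModule) (fun u : R => f (u, T))
          (at_point sigma) (Rbar_locally p_infty) upper &
        v = - lower + Ci * left + upper].

(* Below, a = (a_1, ..., a_p) and b = (b_1, ..., b_q).
   z^s is exp (s log z): the G-function is multivalued in z, and is taken here
   as a function of the chosen logarithm logz of z. *)
Definition meijer_integrand (m n : nat) (a b : seq C) (logz s : C) : C :=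
  Cprod [seq Cgamma (bj - s) | bj <- take m b] *
  Cprod [seq Cgamma (1 - aj + s) | aj <- take n a] /
  (Cprod [seq Cgamma (1 - bj + s) | bj <- drop m b] *
   Cprod [seq Cgamma (aj - s) | aj <- drop n a]) *
  Cexp (s * logz).

(* The poles bj + k (k : nat) of Gamma (bj - s) lie inside the loop, the poles
   aj - 1 - k of Gamma (1 - aj + s) outside. *)
Definition separating_loop (m n : nat) (a b : seq C) (sigma T : R) : Prop :=
  [/\ (0 < T)%R,
      forall bj : C, List.In bj (take m b) ->
        (sigma < Re bj)%R /\ (Rabs (Im bj) < T)%R &
      forall aj : C, List.In aj (take n a) ->
        (Re aj - 1 < sigma)%R \/ (T < Rabs (Im aj))%R].

(* The common value of the integral over all separating loops.  Loops ending
   at +oo are the contours that converge for every z <> 0 when p < q. *)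
Definition meijerG (m n : nat) (a b : seq C) (logz : C) : C :=
  iota (T := C_R_CompleteNormedModule)
    (fun g : C => forall sigma T : R, separating_loop m n a b sigma T ->
       is_loop_integral
         (fun s => / (2 * PI * Ci) * meijer_integrand m n a b logz s) sigma T g).

(* Number fields are the finite extensions of rat. *)

Definition real_embeddings (K : fieldExtType rat) : set (K -> R) :=
  fun f => exists g : {rmorphism K -> R}, f = g :> (K -> R).

Definition nf_degree (K : fieldExtType rat) : nat := \dim {:K}.

Definition nf_r1 (K : fieldExtType rat) : nat :=
  #|` fset_set (real_embeddings K) |%fset.

(* from d = r1 + 2 r2 *)
Definition nf_r2 (K : fieldExtType rat) : nat := (nf_degree K - nf_r1 K)./2.

Definition imaginary_quadratic (K : fieldExtType rat) : Prop :=
  nf_degree K = 2%N /\ real_embeddings K = set0.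

(* The G-function of argument x^2 / 16, its logarithm being 2 log (x / 4).
   The principal logarithm of x^2 / 16 would differ from it by 2 i PI when
   Re x < 0, and G would then jump across the imaginary axis. *)
Definition GK (K : fieldExtType rat) (nu x : C) : C :=
  let d := nf_degree K in
  let r1 := nf_r1 K in
  let r2 := nf_r2 K in
  meijerG d.+1 0 [::]
    ([:: - nu / 2] ++ nseq (r1 + r2) (nu / 2) ++ nseq r2 ((1 + nu) / 2) ++
     [:: (1 - nu) / 2] ++ nseq r2 (nu / 2) ++ nseq (r1 + r2) ((1 + nu) / 2))
    (2 * Clog (x / 4)).

(* Main.v *)
Require Import Defs.
From HB Require Import structures.
From mathcomp Require Import all_boot all_algebra all_field.
From mathcomp Require Import zify Rstruct.
From Stdlib Require Import Reals ZArith Lra.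
From Coquelicot Require Import Coquelicot.

Local Open Scope R_scope.
Local Open Scope C_scope.

(* The Gamma function and its reciprocal enter through Gauss's limit, which
   converges uniformly on bounded sets away from the poles.  Holomorphy is
   replaced by uniform approximability by polynomials ([Apx]): Cauchy's formula
   on a rectangle is elementary for polynomials and passes to uniform limits.

   By the reflection formula, a product of two or three factors
   [Gamma (b_i - s)] whose parameters are distinct modulo 1 is a sum of terms
   containing a single such factor, and the loop integral of each term is the
   sum of the residues at the simple poles [b_i + k].  This is (2) for
   non-integral [2 nu].  The loop integral is continuous in [nu], so (2) at the
   other [nu] follows by passing to the limit.

   For (1), reflection and duplication turn the integrand at [s] into a
   combination of [Gamma (nu - s') Gamma (- nu - s') exp (s' w)] with [s' = 2 s]
   and [w = log (x t)] or [w = log (x t) + i PI] or [w = log (x t) - i PI], and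
   the functions K, Y and J of order [2 nu] are combinations of the loop
   integrals of the same three functions. *)

(** The loop opens to the right because Gamma decays faster than every exponential as the real part
    tends to minus infinity away from the poles: the integrals converge absolutely for every
    imaginary part of the logarithm. The integrals at [w], [w + i PI] and [w - i PI] thus exist on
    one loop whatever the argument of [x t]; on a vertical line convergence would restrict the
    imaginary part of [w]. Double poles are never expanded. At exceptional orders the residues would
    involve derivatives of Gamma, but K and Y are limits there by definition and the loop integrals
    are continuous in the order, so the generic case suffices. Approximability by polynomials
    depends on the set: [1 / (p - s)] is approximable on a bounded set that a line keeps at a
    positive distance from [p], but not on a closed curve around [p]. Contours are therefore cut
    into straight segments, each on one side of such a line. The G-function is the common value over
    all separating loops, so every evaluation is made on an arbitrary loop and must give an
    expression free of the loop. *)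

(** * Complex arithmetic with a total inverse *)

Lemma Cinv_0 : / (0 : C) = 0.
Proof. rewrite /Cinv /=; apply: injective_projections => /=; lra. Qed.

(** Since [/ 0 = 0], inversion is multiplicative and involutive without side conditions. Relations
    for [rgamma] can thus be inverted into relations for [Cgamma] at the poles as well. *)
Lemma Cinv_mul (x y : C) : / (x * y) = / x * / y.
Proof.
case: (Ceq_dec x 0) => [->|hx]; first by rewrite Cmult_0_l Cinv_0 Cmult_0_l.
case: (Ceq_dec y 0) => [->|hy]; first by rewrite Cmult_0_r Cinv_0 Cmult_0_r.
by field.
Qed.

Lemma Cinv_inv (x : C) : / / x = x.
Proof.
case: (Ceq_dec x 0) => [->|hx]; first by rewrite !Cinv_0.
by field.
Qed.

Lemma Cinv_neq0 (x : C) : x <> 0 -> / x <> 0.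
Proof. by move=> hx h; apply: hx; rewrite -(Cinv_inv x) h Cinv_0. Qed.

Lemma Cmod_inv_tot (x : C) : Cmod (/ x) = (/ Cmod x)%R.
Proof.
case: (Ceq_dec x 0) => [->|hx]; last by apply: Cmod_inv.
by rewrite Cinv_0 Cmod_0 Rinv_0.
Qed.

Lemma Im_le_Cmod (z : C) : (Rabs (Im z) <= Cmod z)%R.
Proof. by have := Rmax_Cmod z; have := Rmax_r (Rabs z.1) (Rabs z.2); rewrite /Im; lra. Qed.

Lemma Re_le_Cmod (z : C) : (Rabs (Re z) <= Cmod z)%R.
Proof. exact: re_le_Cmod. Qed.

Lemma Re_bnd (z : C) : (- Cmod z <= Re z <= Cmod z)%R.
Proof. by have := Re_le_Cmod z; move/Rabs_le_between. Qed.

Lemma Im_bnd (z : C) : (- Cmod z <= Im z <= Cmod z)%R.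
Proof. by have := Im_le_Cmod z; move/Rabs_le_between. Qed.

Lemma Cmod_le_ReIm (z : C) : (Cmod z <= Rabs (Re z) + Rabs (Im z))%R.
Proof.
case: z => x y; rewrite /Re /Im /=.
have -> : (x, y) = RtoC x + Ci * RtoC y by apply: injective_projections => /=; ring.
apply: Rle_trans (Cmod_triangle _ _) _.
by rewrite Cmod_mult !Cmod_R Cmod_Ci; lra.
Qed.

Lemma Cmod_sub_sym (x y : C) : Cmod (x - y) = Cmod (y - x).
Proof. by rewrite -Cmod_opp; congr Cmod; ring. Qed.

Lemma Cmod_rev (x y : C) : (Cmod x - Cmod y <= Cmod (x - y))%R.
Proof. have := Cmod_triangle (x - y) y; have -> : x - y + y = x by ring. lra. Qed.

Lemma Cmod_rev_plus (x y : C) : (Cmod x - Cmod y <= Cmod (x + y))%R.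
Proof. have := Cmod_rev x (- y); rewrite Cmod_opp. by have -> : x - - y = x + y by ring. Qed.

Lemma Cmod_tri_sub (x y : C) : (Cmod (x - y) <= Cmod x + Cmod y)%R.
Proof. by have := Cmod_triangle x (- y); rewrite Cmod_opp. Qed.

Lemma Cmod_INR (n : nat) : Cmod (INR n) = INR n.
Proof. by rewrite Cmod_R Rabs_pos_eq //; apply: pos_INR. Qed.

Lemma Cmult_integral_l (x y : C) : x <> 0 -> x * y = 0 -> y = 0.
Proof.
move=> hx h; have -> : y = / x * (x * y) by field.
by rewrite h Cmult_0_r.
Qed.

Lemma ReD x y : Re (x + y) = (Re x + Re y)%R. Proof. by []. Qed.
Lemma ImD x y : Im (x + y) = (Im x + Im y)%R. Proof. by []. Qed.
Lemma ReB x y : Re (x - y) = (Re x - Re y)%R. Proof. by []. Qed.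
Lemma ImB x y : Im (x - y) = (Im x - Im y)%R. Proof. by []. Qed.
Lemma ReN x : Re (- x) = (- Re x)%R. Proof. by []. Qed.
Lemma ImN x : Im (- x) = (- Im x)%R. Proof. by []. Qed.
Lemma ReM x y : Re (x * y) = (Re x * Re y - Im x * Im y)%R. Proof. by []. Qed.
Lemma ImM x y : Im (x * y) = (Re x * Im y + Im x * Re y)%R. Proof. by []. Qed.
Lemma ReR (x : R) : Re x = x. Proof. by []. Qed.
Lemma ImR (x : R) : Im x = 0%R. Proof. by []. Qed.
Lemma ReP (x y : R) : Re (x, y) = x. Proof. by []. Qed.
Lemma ImP (x y : R) : Im (x, y) = y. Proof. by []. Qed.
Lemma ReCi : Re Ci = 0%R. Proof. by []. Qed.
Lemma ImCi : Im Ci = 1%R. Proof. by []. Qed.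
Definition ReImE := (ReD, ImD, ReB, ImB, ReN, ImN, ReM, ImM, ReR, ImR, ReP, ImP, ReCi, ImCi).

Lemma C_eq (x y : C) : Re x = Re y -> Im x = Im y -> x = y.
Proof. exact: injective_projections. Qed.

(** * Limits of complex sequences *)

Definition Clim (u : nat -> C) (l : C) : Prop :=
  forall e : R, (0 < e)%R -> exists N : nat, forall n, (N <= n)%nat -> (Cmod (u n - l) < e)%R.

Lemma Clim_locally (u : nat -> C) (l : C) :
  Clim u l <-> filterlim (u : nat -> C_UniformSpace) eventually (locally (l : C_UniformSpace)).
Proof.
split=> [h|h].
  apply/filterlim_locally => e.
  have [N hN] := h e (cond_pos e); exists N => n hn.
  apply: (C_NormedModule_mixin_compat1 l (u n) e); apply: hN; lia.
move=> e he.
have he2 : (0 < e / 2)%R by lra.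
have /filterlim_locally h2 := h.
have [N hN] := h2 (mkposreal _ he2); exists N => n hn.
have {hN}: ball (l : C_UniformSpace) (e / 2)%R (u n) by apply: hN; lia.
move=> /(C_NormedModule_mixin_compat2 l (u n) (mkposreal _ he2)) /= hb.
apply: Rlt_le_trans hb _.
(* Balls of the product structure are squares, so membership bounds the modulus only up to the
   factor [sqrt 2]; the radius was halved to absorb it. *)
suff : (sqrt 2 <= 2)%R by nra.
by rewrite -{2}(sqrt_square 2); [apply: sqrt_le_1_alt; lra|lra].
Qed.

Lemma Clim_ext (u v : nat -> C) (l : C) (N : nat) :
  (forall n, (N <= n)%nat -> u n = v n) -> Clim u l -> Clim v l.
Proof.
move=> huv hu e /hu [M hM]; exists (maxn N M) => n hn.
by rewrite -huv; [apply: hM; lia|lia].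
Qed.

Lemma Clim_unique (u : nat -> C) (l m : C) : Clim u l -> Clim u m -> l = m.
Proof.
move=> hl hm; case: (Ceq_dec l m) => // hne.
have hlm : (0 < Cmod (l - m))%R.
  by apply/Cmod_gt_0 => h; apply: hne; rewrite -(Cplus_0_l m) -h; ring.
have [N hN] := hl (Cmod (l - m) / 2)%R ltac:(lra).
have [M hM] := hm (Cmod (l - m) / 2)%R ltac:(lra).
have := hN (maxn N M) ltac:(lia); have := hM (maxn N M) ltac:(lia).
move: (u _) => z h1 h2.
have := Cmod_triangle (l - z) (z - m); rewrite (Cmod_sub_sym l z).
have -> : l - z + (z - m) = l - m by ring.
lra.
Qed.

Lemma Clim_const (l : C) : Clim (fun=> l) l.
Proof. move=> e he; exists O => n _; have -> : l - l = 0 by ring. by rewrite Cmod_0. Qed.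

Lemma Clim_plus (u v : nat -> C) (l m : C) :
  Clim u l -> Clim v m -> Clim (fun n => u n + v n) (l + m).
Proof.
move=> hu hv e he.
have [N hN] := hu (e / 2)%R ltac:(lra); have [M hM] := hv (e / 2)%R ltac:(lra).
exists (maxn N M) => n hn.
have -> : u n + v n - (l + m) = (u n - l) + (v n - m) by ring.
apply: Rle_lt_trans (Cmod_triangle _ _) _.
have := hN n ltac:(lia); have := hM n ltac:(lia); lra.
Qed.

Lemma Clim_minus (u v : nat -> C) (l m : C) :
  Clim u l -> Clim v m -> Clim (fun n => u n - v n) (l - m).
Proof.
move=> hu hv; apply: Clim_plus => // e /hv [N hN]; exists N => n hn.
have -> : - v n - - m = - (v n - m) by ring.
by rewrite Cmod_opp; apply: hN.
Qed.

Lemma Clim_bounded (u : nat -> C) (l : C) :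
  Clim u l -> exists N, forall n, (N <= n)%nat -> (Cmod (u n) <= Cmod l + 1)%R.
Proof.
move=> hu; have [N hN] := hu 1%R Rlt_0_1; exists N => n hn.
have := Cmod_rev (u n) l; have := hN n hn; lra.
Qed.

Lemma Clim_mult (u v : nat -> C) (l m : C) :
  Clim u l -> Clim v m -> Clim (fun n => u n * v n) (l * m).
Proof.
move=> hu hv e he.
have [K hK] := Clim_bounded _ _ hu.
have hm := Cmod_ge_0 m; have hl := Cmod_ge_0 l.
have [N hN] := hu (e / (2 * (Cmod m + 1)))%R ltac:(apply: Rdiv_lt_0_compat; lra).
have [M hM] := hv (e / (2 * (Cmod l + 1)))%R ltac:(apply: Rdiv_lt_0_compat; lra).
exists (maxn K (maxn N M)) => n hn.
have -> : u n * v n - l * m = u n * (v n - m) + (u n - l) * m by ring.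
apply: Rle_lt_trans (Cmod_triangle _ _) _; rewrite !Cmod_mult.
have h1 := hN n ltac:(lia); have h2 := hM n ltac:(lia); have h3 := hK n ltac:(lia).
have h4 := Cmod_ge_0 (u n - l); have h5 := Cmod_ge_0 (v n - m).
have h6 : (Cmod (u n) * Cmod (v n - m) <= (Cmod l + 1) * Cmod (v n - m))%R by apply: Rmult_le_compat_r.
have h7 : ((Cmod l + 1) * Cmod (v n - m) < (Cmod l + 1) * (e / (2 * (Cmod l + 1))))%R by apply: Rmult_lt_compat_l; lra.
have h8 : ((Cmod l + 1) * (e / (2 * (Cmod l + 1))) = e / 2)%R by field; lra.
have h9 : (Cmod (u n - l) * Cmod m <= Cmod (u n - l) * (Cmod m + 1))%R by apply: Rmult_le_compat_l; lra.
have h10 : (Cmod (u n - l) * (Cmod m + 1) < (e / (2 * (Cmod m + 1))) * (Cmod m + 1))%R by apply: Rmult_lt_compat_r; lra.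
have h11 : ((e / (2 * (Cmod m + 1))) * (Cmod m + 1) = e / 2)%R by field; lra.
lra.
Qed.

Lemma Clim_inv (u : nat -> C) (l : C) : l <> 0 -> Clim u l -> Clim (fun n => / u n) (/ l).
Proof.
move=> hl hu e he.
have hl0 : (0 < Cmod l)%R by apply/Cmod_gt_0.
have [N hN] := hu (Cmod l / 2)%R ltac:(lra).
have [M hM] := hu (e * (Cmod l * Cmod l / 2))%R ltac:(apply: Rmult_lt_0_compat; nra).
exists (maxn N M) => n hn.
have h1 := hN n ltac:(lia); have h2 := hM n ltac:(lia).
have h3 : (Cmod l / 2 < Cmod (u n))%R by have := Cmod_rev l (u n); rewrite Cmod_sub_sym; lra.
have hun : u n <> 0 by apply/Cmod_gt_0; lra.
have -> : / u n - / l = (l - u n) * (/ u n * / l) by field.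
rewrite !Cmod_mult !Cmod_inv // Cmod_sub_sym.
have h4 : (Cmod (u n - l) * (/ Cmod (u n) * / Cmod l) < e * (Cmod l * Cmod l / 2) * (/ Cmod (u n) * / Cmod l))%R.
  apply: Rmult_lt_compat_r => //; apply: Rmult_lt_0_compat; apply: Rinv_0_lt_compat; lra.
apply: Rlt_le_trans h4 _.
have -> : (e * (Cmod l * Cmod l / 2) * (/ Cmod (u n) * / Cmod l) = e * ((Cmod l / 2) / Cmod (u n)))%R by field; lra.
rewrite -[X in (_ <= X)%R]Rmult_1_r; apply: Rmult_le_compat_l; first lra.
by apply/Rle_div_l; lra.
Qed.

Lemma Clim_subseq (u : nat -> C) (l : C) (phi : nat -> nat) :
  (forall n, (n <= phi n)%nat) -> Clim u l -> Clim (fun n => u (phi n)) l.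
Proof. by move=> hphi hu e /hu [N hN]; exists N => n hn; apply: hN; have := hphi n; lia. Qed.

Lemma Clim_le (u : nat -> C) (l : C) (B : R) (N : nat) :
  (forall n, (N <= n)%nat -> (Cmod (u n) <= B)%R) -> Clim u l -> (Cmod l <= B)%R.
Proof.
move=> hB hu; apply: Rnot_lt_le => hlt.
have [M hM] := hu (Cmod l - B)%R ltac:(lra).
have := hM (maxn N M) ltac:(lia); have := hB (maxn N M) ltac:(lia).
have := Cmod_rev l (u (maxn N M)); rewrite Cmod_sub_sym; lra.
Qed.

Lemma Clim_0_le (u : nat -> C) (l : C) (v : nat -> R) :
  (forall n, (Cmod (u n - l) <= v n)%R) -> is_lim_seq v 0 -> Clim u l.
Proof.
move=> huv /is_lim_seq_spec hv e he.
have [N hN] := hv (mkposreal e he); exists N => n hn.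
have := hN n ltac:(lia) => /= h.
have := huv n; have := Rle_abs (v n - 0); lra.
Qed.

Lemma Ccauchy (u : nat -> C) :
  (forall e, (0 < e)%R -> exists N, forall n m, (N <= n)%nat -> (N <= m)%nat -> (Cmod (u n - u m) < e)%R) ->
  exists l, Clim u l.
Proof.
move=> hc.
have hre : Cauchy_crit (fun n => Re (u n)).
  move=> e he; have [N hN] := hc e he; exists N => n m hn hm.
  rewrite /Rdist -ReB; apply: Rle_lt_trans (Re_le_Cmod _) _; apply: hN; lia.
have him : Cauchy_crit (fun n => Im (u n)).
  move=> e he; have [N hN] := hc e he; exists N => n m hn hm.
  rewrite /Rdist -ImB; apply: Rle_lt_trans (Im_le_Cmod _) _; apply: hN; lia.
have [a ha] := Rcomplete.R_complete _ hre; have [b hb] := Rcomplete.R_complete _ him.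
exists (a, b) => e he.
have [N hN] := ha (e / 2)%R ltac:(lra); have [M hM] := hb (e / 2)%R ltac:(lra).
exists (maxn N M) => n hn; apply: Rle_lt_trans (Cmod_le_ReIm _) _.
rewrite !ReImE; have := hN n ltac:(lia); have := hM n ltac:(lia); rewrite /Rdist; lra.
Qed.

Lemma Climit_eventually (u : nat -> C) (l : C) : Clim u l -> Climit eventually u = l.
Proof.
move=> /Clim_locally hu; rewrite /Climit.
exact: (@iota_filterlim_locally R_AbsRing C_R_CompleteNormedModule nat eventually _ u l hu).
Qed.

(** * The complex exponential *)

Lemma Cexp_plus (z w : C) : Cexp (z + w) = Cexp z * Cexp w.
Proof.
by apply: C_eq; rewrite /Cexp !ReImE exp_plus ?cos_plus ?sin_plus; ring.
Qed.

Lemma Cexp_0 : Cexp 0 = 1.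
Proof. by apply: C_eq; rewrite /Cexp !ReImE exp_0 ?cos_0 ?sin_0; ring. Qed.

Lemma Cexp_inv (z : C) : Cexp (- z) * Cexp z = 1.
Proof. rewrite -Cexp_plus -Cexp_0; congr Cexp; ring. Qed.

Lemma Cexp_neq0 (z : C) : Cexp z <> 0.
Proof. by move=> h; have := Cexp_inv z; rewrite h Cmult_0_r => h1; apply: C1_nz. Qed.

Lemma Cexp_opp (z : C) : Cexp (- z) = / Cexp z.
Proof.
have h := Cexp_neq0 z; have := Cexp_inv z => h1.
by rewrite -(Cmult_1_l (/ Cexp z)) -h1; field.
Qed.

Lemma Cmod_Cexp (z : C) : Cmod (Cexp z) = exp (Re z).
Proof.
rewrite /Cmod /Cexp /=.
have -> : (exp (Re z) * cos (Im z) * (exp (Re z) * cos (Im z) * 1) +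
    exp (Re z) * sin (Im z) * (exp (Re z) * sin (Im z) * 1) = exp (Re z) * exp (Re z) * ((sin (Im z))² + (cos (Im z))²))%R.
  by rewrite /Rsqr; ring.
by rewrite sin2_cos2 Rmult_1_r sqrt_square //; apply/Rlt_le/exp_pos.
Qed.

Lemma exp_le (x y : R) : (x <= y -> exp x <= exp y)%R.
Proof. by case=> [h|->]; [apply/Rlt_le/exp_increasing|lra]. Qed.

Lemma Cmod_Cexp_le (z : C) : (Cmod (Cexp z) <= exp (Cmod z))%R.
Proof. by rewrite Cmod_Cexp; apply: exp_le; have := Re_bnd z; lra. Qed.

Lemma Cexp_R (x : R) : Cexp x = exp x.
Proof. by apply: C_eq; rewrite /Cexp !ReImE ?cos_0 ?sin_0; ring. Qed.

Lemma Cexp_nat (z : C) (n : nat) : Cexp (INR n * z) = Cexp z ^ n.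
Proof.
elim: n => [|n IH]; first by rewrite Cmult_0_l Cexp_0.
by rewrite S_INR RtoC_plus Cmult_plus_distr_r Cexp_plus IH Cmult_1_l /= Cmult_comm.
Qed.

Lemma Cexp_iPI : Cexp (Ci * PI) = - (1).
Proof.
apply: C_eq; rewrite /Cexp !ReImE.
  have -> : (0 * 0 + 1 * PI = PI)%R by ring.
  have -> : (0 * PI - 1 * 0 = 0)%R by ring.
  by rewrite exp_0 cos_PI; ring.
have -> : (0 * 0 + 1 * PI = PI)%R by ring.
by rewrite sin_PI; ring.
Qed.

(** Both bounds come from [1 + x <= exp x], used at [x] and at [- x]: the latter gives
    [exp x * (1 - x) <= 1]. *)
Lemma exp_quadratic (x : R) : (Rabs x <= 1 / 2 -> Rabs (exp x - 1 - x) <= 2 * x ^ 2)%R.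
Proof.
move=> /Rabs_le_between hx.
have h1 := exp_ineq1_le x; have h2 := exp_ineq1_le (- x).
have h3 : (exp x * exp (- x) = 1)%R by rewrite -exp_plus Rplus_opp_r exp_0.
have h4 := exp_pos x.
have h5 : (exp x * (1 - x) <= 1)%R by nra.
by rewrite Rabs_pos_eq; [nra|lra].
Qed.

Lemma Rabs_sin_le (x : R) : (Rabs (sin x) <= Rabs x)%R.
Proof.
wlog : x / (0 <= x)%R.
  move=> H; case: (Rle_dec 0 x) => hx; first exact: H.
  by have := H (- x)%R ltac:(lra); rewrite sin_neg !Rabs_Ropp.
move=> hx; rewrite (Rabs_pos_eq x) //; apply/Rabs_le_between.
have h1 := SIN_bound x.
case: (Req_dec x 0) => [->|h0]; first by rewrite sin_0; lra.
have h2 : (sin x < x)%R by apply: sin_lt_x; lra.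
split; last lra.
case: (Rle_dec x PI) => hp; first by have := sin_ge_0 x ltac:(lra) hp; lra.
by have := PI2_1; lra.
Qed.

Lemma cos_quadratic (x : R) : (Rabs (cos x - 1) <= x ^ 2 / 2)%R.
Proof.
have -> : (cos x = 1 - 2 * sin (x / 2) * sin (x / 2))%R by rewrite -cos_2a_sin; congr cos; field.
have := Rabs_sin_le (x / 2); move: (sin _) => s hs.
have : (s * s <= (x / 2) * (x / 2))%R by have := Rsqr_le_abs_1 _ _ hs; rewrite /Rsqr.
by move=> h; rewrite Rabs_left1; nra.
Qed.

Lemma sin_quadratic (x : R) : (Rabs x <= 1 / 2 -> Rabs (sin x - x) <= x ^ 2)%R.
Proof.
wlog : x / (0 <= x)%R.
  move=> H hx; case: (Rle_dec 0 x) => h0; first exact: H.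
  have -> : (sin x - x = - (sin (- x) - - x))%R by rewrite sin_neg; ring.
  have := H (- x)%R ltac:(lra); rewrite !Rabs_Ropp => h; have := h hx; nra.
move=> h0; rewrite Rabs_pos_eq // => hx.
case: (Req_dec x 0) => [->|hn0]; first by rewrite sin_0 Rminus_0_r Rabs_R0; lra.
have h2 : (sin x < x)%R by apply: sin_lt_x; lra.
rewrite Rabs_left1; last lra.
suff : (x - x ^ 2 <= sin x)%R by lra.
have := @pre_sin_bound x 0 ltac:(lra) ltac:(lra).
by rewrite /sin_approx /sin_term /= => [] [h _]; nra.
Qed.

(** This second-order estimate stands in for the exponential series: the ratio of Gauss's
    approximants, the behaviour of the sine at 0 and the limit of [(1 + w / n) ^ n] all rest on it.
    The constant 8 is crude. *)
Lemma Cexp_quadratic (w : C) : (Cmod w <= 1 / 2 -> Cmod (Cexp w - 1 - w) <= 8 * Cmod w ^ 2)%R.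
Proof.
move=> hw; have hx := Re_le_Cmod w; have hy := Im_le_Cmod w.
case: w hw hx hy => x y; rewrite !ReImE => hw hx hy.
set m := Cmod (x, y) in hw hx hy *.
have h1 := exp_quadratic x ltac:(lra); have h2 := cos_quadratic y; have h3 := sin_quadratic y ltac:(lra).
have h4 := Rabs_sin_le y.
have hx2 : (x ^ 2 <= m ^ 2)%R by rewrite -(pow2_abs x); apply: pow_incr; split => //; apply: Rabs_pos.
have hy2 : (y ^ 2 <= m ^ 2)%R by rewrite -(pow2_abs y); apply: pow_incr; split => //; apply: Rabs_pos.
have he : (exp x <= 2)%R.
  have hm : (m ^ 2 <= 1 / 4)%R by have : (0 <= m)%R := Cmod_ge_0 _; nra.
  move/Rabs_le_between: h1 => h1; move/Rabs_le_between: hx => hx; lra.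
have hepos := exp_pos x.
have he1 : (Rabs (exp x - 1) <= 2 * m)%R.
  have -> : (exp x - 1 = (exp x - 1 - x) + x)%R by ring.
  have hm : (m ^ 2 <= m / 2)%R by have : (0 <= m)%R := Cmod_ge_0 _; nra.
  by apply: Rle_trans (Rabs_triang _ _) _; lra.
apply: Rle_trans (Cmod_le_ReIm _) _; rewrite /Cexp !ReImE.
have -> : (exp x * cos y - 1 - x = (exp x - 1 - x) + exp x * (cos y - 1))%R by ring.
have -> : (exp x * sin y - 0 - y = (exp x - 1) * sin y + (sin y - y))%R by ring.
have t1 := Rabs_triang (exp x - 1 - x) (exp x * (cos y - 1)).
have t2 := Rabs_triang ((exp x - 1) * sin y) (sin y - y).
rewrite !Rabs_mult (Rabs_pos_eq (exp x)) in t1 t2; last lra.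
have t3 : (exp x * Rabs (cos y - 1) <= 2 * (m ^ 2 / 2))%R.
  by apply: Rmult_le_compat; try lra; apply: Rabs_pos.
have t4 : (Rabs (exp x - 1) * Rabs (sin y) <= (2 * m) * m)%R.
  by apply: Rmult_le_compat; try lra; apply: Rabs_pos.
nra.
Qed.

(** * Gauss's limit for the Gamma function *)

Lemma Clog_pos (x : R) : (0 < x)%R -> Clog x = ln x.
Proof.
move=> hx; rewrite /Clog Cmod_R Rabs_pos_eq; last lra.
apply: C_eq; rewrite !ReImE // /Carg !ReImE.
have -> : (x / Cmod x = 1)%R by rewrite Cmod_R Rabs_pos_eq; [field|]; lra.
rewrite acos_1; case: Rle_dec => h /=; lra.
Qed.

Lemma Cpower_pos (x : R) (z : C) : (0 < x)%R -> Cpower x z = Cexp (z * ln x).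
Proof. by move=> hx; rewrite /Cpower Clog_pos. Qed.

Lemma Cprod_cat (s t : seq C) : Cprod (s ++ t) = Cprod s * Cprod t.
Proof. by elim: s => [|a s IH] /=; [rewrite Cmult_1_l|rewrite IH Cmult_assoc]. Qed.

Lemma pochhammer_0 (a : C) : pochhammer a 0 = 1.
Proof. by []. Qed.

Lemma pochhammer_S (a : C) (k : nat) : pochhammer a k.+1 = pochhammer a k * (a + INR k).
Proof.
rewrite /pochhammer -addn1 iotaD map_cat Cprod_cat add0n.
by have -> : Cprod [seq a + INR j | j <- seq.iota k 1] = a + INR k by rewrite /Cprod /= Cmult_1_r.
Qed.

Lemma pochhammer_Sl (a : C) (k : nat) : pochhammer a k.+1 = a * pochhammer (a + 1) k.
Proof.
elim: k => [|k IH]; first by rewrite pochhammer_S !pochhammer_0 /=; ring.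
by rewrite pochhammer_S IH pochhammer_S S_INR RtoC_plus; ring.
Qed.

Lemma pochhammer_neq0 (a : C) (k : nat) :
  (forall j, (j < k)%nat -> a + INR j <> 0) -> pochhammer a k <> 0.
Proof.
elim: k => [|k IH] h; first exact: C1_nz.
rewrite pochhammer_S; apply: Cmult_neq_0; last by apply: h.
by apply: IH => j hj; apply: h; lia.
Qed.

Lemma pochhammer_eq0 (a : C) (j k : nat) : (j < k)%nat -> a + INR j = 0 -> pochhammer a k = 0.
Proof.
elim: k => [//|k IH] hj h; rewrite pochhammer_S.
case: (eqVneq j k) => [e|ne]; first by rewrite -e h Cmult_0_r.
by rewrite IH ?Cmult_0_l //; lia.
Qed.

(** Kept beside its inverse [gauss] because it is a polynomial times an exponential, hence entire,
    and converges to the entire function 1 / Gamma. *)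
Definition rgauss (n : nat) (z : C) : C := pochhammer z n.+1 / (INR n`! * Cpower (INR n) z).
Definition gauss (n : nat) (z : C) : C := INR n`! * Cpower (INR n) z / pochhammer z n.+1.

Lemma INR_fact_neq0 (n : nat) : RtoC (INR n`!) <> 0.
Proof.
move/RtoC_inj => h; have : (0 < INR n`!)%R by apply: lt_0_INR; have := fact_gt0 n; lia.
lra.
Qed.

Lemma INR_pos (n : nat) : (0 < n)%nat -> (0 < INR n)%R.
Proof. by move=> h; apply: lt_0_INR; lia. Qed.

Lemma INR_neq0 (n : nat) : (0 < n)%nat -> RtoC (INR n) <> 0.
Proof. by move=> /INR_pos h /RtoC_inj; lra. Qed.

Lemma gauss_inv (n : nat) (z : C) : gauss n z = / rgauss n z.
Proof. by rewrite /gauss /rgauss /Cdiv Cinv_mul Cinv_inv Cmult_comm. Qed.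

Definition ln_step (n : nat) : R := (ln (INR n.+1) - ln (INR n))%R.

Lemma ln_le_sub1 (x : R) : (0 < x -> ln x <= x - 1)%R.
Proof. by move=> hx; have := exp_ineq1_le (ln x); rewrite exp_ln //; lra. Qed.

Lemma ln_step_bounds (n : nat) : (0 < n)%nat -> (/ INR n.+1 <= ln_step n <= / INR n)%R.
Proof.
move=> hn; have h := INR_pos n hn; have h1 := INR_pos n.+1 isT.
have hS := S_INR n; rewrite /ln_step -ln_div //; split.
  rewrite -[ln _]Ropp_involutive -ln_Rinv; last exact: Rdiv_lt_0_compat.
  have := ln_le_sub1 (/ (INR n.+1 / INR n)) ltac:(apply: Rinv_0_lt_compat; exact: Rdiv_lt_0_compat).
  have -> : (/ (INR n.+1 / INR n) - 1 = - / INR n.+1)%R by rewrite hS; field; lra.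
  lra.
have := ln_le_sub1 (INR n.+1 / INR n) ltac:(exact: Rdiv_lt_0_compat).
have -> : (INR n.+1 / INR n - 1 = / INR n)%R by rewrite hS; field; lra.
lra.
Qed.

Lemma INR_factS (n : nat) : RtoC (INR n.+1`!) = INR n.+1 * INR n`!.
Proof. by rewrite factS -RtoC_mult -mult_INR. Qed.

Lemma rgaussS (n : nat) (z : C) : (0 < n)%nat ->
  rgauss n.+1 z = rgauss n z * ((1 + z / INR n.+1) * Cexp (- (z * ln_step n))).
Proof.
move=> hn; have h0 := INR_pos n hn; have h1 := INR_pos n.+1 isT.
rewrite /rgauss pochhammer_S !Cpower_pos // INR_factS.
have -> : Cexp (z * ln (INR n.+1)) = Cexp (z * ln (INR n)) * Cexp (z * ln_step n).
  by rewrite -Cexp_plus; congr Cexp; rewrite /ln_step RtoC_minus; ring.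
rewrite Cexp_opp.
have hn1 := INR_neq0 n.+1 isT; have hf := INR_fact_neq0 n.
have he1 := Cexp_neq0 (z * ln (INR n)); have he2 := Cexp_neq0 (z * ln_step n).
by field.
Qed.

(** The factor in [rgaussS] is [1 + O(1 / n^2)] because [ln_step n] and [1 / (n + 1)] differ by
    [O(1 / n^2)]. The error is stated as a multiple of [1 / n - 1 / (n + 1)] so that sums over [n]
    telescope. *)
Lemma ln_step_defect (R0 : R) (n : nat) (z : C) : (0 < n)%nat -> (2 * R0 <= INR n)%R -> (Cmod z <= R0)%R ->
  (Cmod (z * ln_step n) <= 1 / 2)%R /\
  (Cmod (Cexp (z * ln_step n) - 1 - z / INR n.+1) <= (16 * R0 ^ 2 + R0) * (/ INR n - / INR n.+1))%R.
Proof.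
move=> hn hR hz; have h0 := INR_pos n hn; have h1 := INR_pos n.+1 isT.
have [q1 q2] := ln_step_bounds n hn; have hS := S_INR n.
have hz0 := Cmod_ge_0 z.
have hi : (0 < / INR n.+1)%R by apply: Rinv_0_lt_compat.
have hin : (INR n * / INR n = 1)%R by field; lra.
have hi0 : (0 < / INR n)%R by apply: Rinv_0_lt_compat.
have hm : (Cmod (z * ln_step n) <= R0 * / INR n)%R.
  rewrite Cmod_mult Cmod_R Rabs_pos_eq; last lra.
  by apply: Rmult_le_compat; lra.
have hm2 : (R0 * / INR n <= 1 / 2)%R by nra.
split; first lra.
have hd : (/ INR n - / INR n.+1 = / INR n * / INR n.+1)%R by rewrite hS; field; lra.
have -> : Cexp (z * ln_step n) - 1 - z / INR n.+1 =
  (Cexp (z * ln_step n) - 1 - z * ln_step n) + z * RtoC (ln_step n - / INR n.+1).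
  rewrite RtoC_minus RtoC_inv; last lra.
  by rewrite /Cdiv; ring.
apply: Rle_trans (Cmod_triangle _ _) _.
have hq := Cexp_quadratic (z * ln_step n) ltac:(lra).
rewrite [in X in (_ + X <= _)%R]Cmod_mult Cmod_R Rabs_pos_eq; last lra.
have t1 : (Cmod (z * ln_step n) ^ 2 <= (R0 * / INR n) ^ 2)%R by apply: pow_incr; split => //; apply: Cmod_ge_0.
have t2 : (Cmod z * (ln_step n - / INR n.+1) <= R0 * (/ INR n - / INR n.+1))%R.
  by apply: Rmult_le_compat; lra.
have t3 : (/ INR n <= 2 * / INR n.+1)%R.
  have -> : (2 * / INR n.+1 = / (INR n.+1 / 2))%R by field; lra.
  have : (1 <= INR n)%R by apply: (le_INR 1); lia.
  by move=> h; apply: Rinv_le_contravar; lra.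
have t4 : (8 * (R0 * / INR n) ^ 2 <= 16 * R0 ^ 2 * (/ INR n * / INR n.+1))%R.
  have -> : (8 * (R0 * / INR n) ^ 2 = 8 * R0 ^ 2 * (/ INR n * / INR n))%R by ring.
  have -> : (16 * R0 ^ 2 * (/ INR n * / INR n.+1) = 8 * R0 ^ 2 * (/ INR n * (2 * / INR n.+1)))%R by ring.
  apply: Rmult_le_compat_l; first nra.
  by apply: Rmult_le_compat_l; lra.
rewrite hd in t2 *; lra.
Qed.

Lemma Cmod_Cexp_half (w : C) : (Cmod w <= 1 / 2)%R -> (Cmod (Cexp w) <= 2)%R.
Proof.
move=> hw; apply: Rle_trans (Cmod_Cexp_le _) _.
have := exp_quadratic (Cmod w); have := Cmod_ge_0 w => h0.
rewrite Rabs_pos_eq // => h; have {h} := h hw; move/Rabs_le_between => h; nra.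
Qed.

Lemma rgauss_step (R0 : R) (n : nat) (z : C) : (0 < n)%nat -> (2 * R0 <= INR n)%R -> (Cmod z <= R0)%R ->
  (Cmod (rgauss n.+1 z - rgauss n z) <= Cmod (rgauss n z) * (2 * (16 * R0 ^ 2 + R0) * (/ INR n - / INR n.+1)))%R.
Proof.
move=> hn hR hz; have [h1 h2] := ln_step_defect R0 n z hn hR hz.
rewrite rgaussS //.
have -> : rgauss n z * ((1 + z / INR n.+1) * Cexp (- (z * ln_step n))) - rgauss n z =
  rgauss n z * (Cexp (- (z * ln_step n)) * - (Cexp (z * ln_step n) - 1 - z / INR n.+1)).
  have hn1 := INR_neq0 n.+1 isT.
  by rewrite Cexp_opp; have he2 := Cexp_neq0 (z * ln_step n); field.
move: (rgauss n z) => v; rewrite !Cmod_mult Cmod_opp; apply: Rmult_le_compat_l; first exact: Cmod_ge_0.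
rewrite Rmult_assoc; apply: Rmult_le_compat => //; try apply: Cmod_ge_0.
by apply: Cmod_Cexp_half; rewrite Cmod_opp.
Qed.

Lemma gauss_step (R0 : R) (n : nat) (z : C) : (0 < n)%nat -> (2 * R0 <= INR n)%R -> (Cmod z <= R0)%R ->
  (Cmod (gauss n.+1 z - gauss n z) <= Cmod (gauss n z) * (2 * (16 * R0 ^ 2 + R0) * (/ INR n - / INR n.+1)))%R.
Proof.
move=> hn hR hz; have [h1 h2] := ln_step_defect R0 n z hn hR hz.
have hn1 := INR_neq0 n.+1 isT; have hp := INR_pos n.+1 isT; have hp0 := INR_pos n hn.
have hS := S_INR n.
(* As [INR n] is at least [2 * R0], the factor stays away from 0 and dividing by it costs at most
   2. *)
have hm : (1 / 2 <= Cmod (1 + z / INR n.+1))%R.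
  have := Cmod_rev_plus 1 (z / INR n.+1); rewrite Cmod_1 Cmod_div // Cmod_INR.
  suff : (Cmod z / INR n.+1 <= 1 / 2)%R by lra.
  by apply/Rle_div_l; lra.
have hne : 1 + z / INR n.+1 <> 0 by apply/Cmod_gt_0; lra.
rewrite (gauss_inv n.+1) rgaussS // Cinv_mul -gauss_inv Cinv_mul -Cexp_opp.
have -> : - - (z * ln_step n) = z * ln_step n by ring.
have -> : gauss n z * (/ (1 + z / INR n.+1) * Cexp (z * ln_step n)) - gauss n z =
  gauss n z * (/ (1 + z / INR n.+1) * (Cexp (z * ln_step n) - 1 - z / INR n.+1)).
  field; split => // h; apply: hne.
  have -> : 1 + z / INR n.+1 = (INR n.+1 + z) / INR n.+1 by field.
  by rewrite h /Cdiv Cmult_0_l.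
move: (gauss n z) => v; rewrite !Cmod_mult Cmod_inv //; apply: Rmult_le_compat_l; first exact: Cmod_ge_0.
rewrite Rmult_assoc; apply: Rmult_le_compat => //; try apply: Cmod_ge_0.
  by apply/Rlt_le/Rinv_0_lt_compat; lra.
have -> : (2 = / (1 / 2))%R by field.
by apply: Rinv_le_contravar; lra.
Qed.

(* The hypothesis says that the quotients of consecutive terms are 1 + O(1/n^2). *)
Lemma quadratic_ratio_limit (X : Type) (S : X -> Prop) (u : nat -> X -> C) (K B : R) (n0 : nat) :
  (0 < n0)%nat -> (0 <= K)%R ->
  (forall x, S x -> (Cmod (u n0 x) <= B)%R) ->
  (forall n x, (n0 <= n)%nat -> S x ->
     (Cmod (u n.+1 x - u n x) <= Cmod (u n x) * (K * (/ INR n - / INR n.+1)))%R) ->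
  exists M : R, forall x, S x -> exists l,
    [/\ Clim (u^~ x) l, (Cmod l <= M)%R &
        forall n, (n0 <= n)%nat -> (Cmod (u n x - l) <= M / INR n)%R].
Proof.
move=> hn0 hK hB hu.
have hpos n : (n0 <= n)%nat -> (0 < / INR n)%R.
  by move=> hn; apply/Rinv_0_lt_compat/INR_pos; lia.
pose M0 := (B * exp (K * / INR n0))%R.
(* The growth factors [1 + K * (1 / m - 1 / (m + 1))] are bounded by exponentials whose exponents
   telescope, so that their product stays below [exp (K / n0)]. *)
have hbd n x : (n0 <= n)%nat -> S x -> (Cmod (u n x) <= B * exp (K * (/ INR n0 - / INR n)))%R.
  move=> hn hx; have -> : n = (n0 + (n - n0))%nat by lia.
  elim: (n - n0)%nat => [|k IH].
    by rewrite addn0 Rminus_diag Rmult_0_r exp_0 Rmult_1_r; apply: hB.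
  rewrite addnS; set m := (n0 + k)%nat in IH *.
  have hm := hu m x ltac:(lia) hx.
  have h1 := Cmod_triangle (u m x) (u m.+1 x - u m x).
  have h2 : u m x + (u m.+1 x - u m x) = u m.+1 x by ring.
  rewrite h2 in h1.
  have hd : (0 <= / INR m - / INR m.+1)%R.
    have : (/ INR m.+1 <= / INR m)%R; last lra.
    by apply: Rinv_le_contravar; [apply: INR_pos; lia|apply: le_INR; lia].
  have h3 := exp_ineq1_le (K * (/ INR m - / INR m.+1)).
  have -> : (K * (/ INR n0 - / INR m.+1) = K * (/ INR n0 - / INR m) + K * (/ INR m - / INR m.+1))%R by ring.
  rewrite exp_plus -Rmult_assoc.
  apply: Rle_trans (_ : Cmod (u m x) * exp (K * (/ INR m - / INR m.+1)) <= _)%R.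
    have := Cmod_ge_0 (u m x); nra.
  by apply: Rmult_le_compat_r => //; apply/Rlt_le/exp_pos.
have hbd0 n x : (n0 <= n)%nat -> S x -> (Cmod (u n x) <= M0)%R.
  move=> hn hx; apply: Rle_trans (hbd n x hn hx) _.
  apply: Rmult_le_compat_l; first by apply: Rle_trans (Cmod_ge_0 _) (hB x hx).
  by apply: exp_le; apply: Rmult_le_compat_l => //; have := hpos n hn; lra.
have hdiff n k x : (n0 <= n)%nat -> S x ->
    (Cmod (u (n + k)%nat x - u n x) <= M0 * K * (/ INR n - / INR (n + k)))%R.
  move=> hn hx; elim: k => [|k IH].
    rewrite addn0 Rminus_diag Rmult_0_r; have -> : u n x - u n x = 0 by ring.
    by rewrite Cmod_0; lra.
  rewrite addnS; set m := (n + k)%nat in IH *.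
  have -> : u m.+1 x - u n x = (u m.+1 x - u m x) + (u m x - u n x) by ring.
  apply: Rle_trans (Cmod_triangle _ _) _.
  have hm := hu m x ltac:(lia) hx; have hb := hbd0 m x ltac:(lia) hx.
  have hd : (0 <= K * (/ INR m - / INR m.+1))%R.
    apply: Rmult_le_pos => //.
    have : (/ INR m.+1 <= / INR m)%R; last lra.
    by apply: Rinv_le_contravar; [apply: INR_pos; lia|apply: le_INR; lia].
  have := Rmult_le_compat_r _ _ _ hd hb; nra.
(* [M0] bounds the terms and hence the limit, [M0 * K] governs the rate; one constant serves for
   both. *)
exists (Rmax M0 (M0 * K)) => x hx.
have hM0 : (0 <= M0)%R by apply: Rle_trans (Cmod_ge_0 _) (hbd0 n0 x (leqnn _) hx).
have hMK : (0 <= M0 * K)%R by apply: Rmult_le_pos.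
have hinv : is_lim_seq (fun n => M0 * K * / INR n)%R 0.
  have -> : Finite 0 = Rbar_mult (M0 * K)%R (Rbar_inv p_infty) by rewrite /= Rmult_0_r.
  by apply: is_lim_seq_scal_l; apply: is_lim_seq_inv => //; apply: is_lim_seq_INR.
have [l hl] : exists l, Clim (u^~ x) l.
  apply: Ccauchy => e he.
  move/is_lim_seq_spec: hinv => hinv; have [N hN] := hinv (mkposreal e he).
  exists (maxn n0 N) => n m hn hm.
  wlog hnm : n m hn hm / (n <= m)%nat.
    move=> H; case: (leqP n m) => h; first exact: H.
    by rewrite Cmod_sub_sym; apply: H => //; apply: ltnW.
  have := hdiff n (m - n)%nat x ltac:(lia) hx; rewrite subnKC // Cmod_sub_sym.
  have := hN n ltac:(lia); rewrite /= Rminus_0_r => h1 h2.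
  have h3 := hpos m ltac:(lia); have h4 := Rle_abs (M0 * K * / INR n); nra.
exists l; split => // [|n hn].
  by apply: Rle_trans (Rmax_l M0 (M0 * K)); apply: (Clim_le _ _ _ n0) hl => n hn; apply: hbd0.
have h5 := Clim_minus _ _ _ _ (Clim_const (u n x)) hl.
apply: Rle_trans (_ : M0 * K * / INR n <= _)%R; last first.
  by apply: Rmult_le_compat_r; [apply/Rlt_le/hpos|apply: Rmax_r].
apply: (Clim_le _ _ _ n) h5 => k hk.
have := hdiff n (k - n)%nat x hn hx; rewrite subnKC // Cmod_sub_sym => h.
have h3 := hpos k ltac:(lia); nra.
Qed.

Definition rgamma (z : C) : C := / Cgamma z.

Lemma nat_above (x : R) : exists n : nat, (0 < n)%nat /\ (x <= INR n)%R.
Proof.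
have [n hn] := INR_unbounded x; exists n.+1; split => //.
by rewrite S_INR; lra.
Qed.

Lemma gauss_rgauss (n : nat) (z : C) : (forall j : nat, z + INR j <> 0) -> gauss n z * rgauss n z = 1.
Proof.
move=> hz; rewrite gauss_inv; apply: Cinv_l; rewrite /rgauss.
apply: Cmult_neq_0; first by apply: pochhammer_neq0 => j _; apply: hz.
apply: Cinv_neq0; apply: Cmult_neq_0; first exact: INR_fact_neq0.
exact: Cexp_neq0.
Qed.

Definition is_pole (z : C) : Prop := exists j : nat, z + INR j = 0.

Lemma not_pole (z : C) : ~ is_pole z -> forall j : nat, z + INR j <> 0.
Proof. by move=> h j hj; apply: h; exists j. Qed.

Lemma pole_dec (z : C) : is_pole z \/ ~ is_pole z.
Proof. by case: (ClassicalEpsilon.excluded_middle_informative (is_pole z)); [left|right]. Qed.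

Lemma rgauss_gs_lim (z : C) : exists l m, Clim (rgauss^~ z) l /\ Clim (gauss^~ z) m.
Proof.
have [n0 [hn0 hR]] := nat_above (2 * Cmod z)%R.
have hK : (0 <= 2 * (16 * Cmod z ^ 2 + Cmod z))%R by have := Cmod_ge_0 z; nra.
(* On the singleton of [z] the initial bound is the value itself, so pointwise convergence is
   obtained at the poles too. *)
have H1 := quadratic_ratio_limit C (eq z) rgauss _ (Cmod (rgauss n0 z)) n0 hn0 hK.
have H2 := quadratic_ratio_limit C (eq z) gauss _ (Cmod (gauss n0 z)) n0 hn0 hK.
have hle n : (n0 <= n)%nat -> (2 * Cmod z <= INR n)%R.
  by move=> hn; have : (INR n0 <= INR n)%R; [apply: le_INR; lia|lra].
case: H1 => [x <-|n x hn <-|M1 /(_ z erefl) [l [hl _ _]]].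
- by apply: Rle_refl.
- by apply: rgauss_step; [lia|have := hle n hn; lra|lra].
case: H2 => [x <-|n x hn <-|M2 /(_ z erefl) [m [hm _ _]]].
- by apply: Rle_refl.
- by apply: gauss_step; [lia|have := hle n hn; lra|lra].
by exists l, m.
Qed.

Lemma Cgamma_lim (z : C) : Clim (gauss^~ z) (Cgamma z).
Proof. by have [l [m [_ hm]]] := rgauss_gs_lim z; rewrite /Cgamma (Climit_eventually _ _ hm). Qed.

Lemma gamma_rgauss (z : C) (l : C) : ~ is_pole z -> Clim (rgauss^~ z) l -> Cgamma z * l = 1.
Proof.
move=> hz hl; apply: (Clim_unique _ _ _ (Clim_mult _ _ _ _ (Cgamma_lim z) hl)).
apply: (Clim_ext _ _ _ 0) (Clim_const 1) => n _ /=.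
by rewrite gauss_rgauss //; apply: not_pole.
Qed.

Lemma rgauss_pole (n j : nat) (z : C) : z + INR j = 0 -> (j <= n)%nat -> rgauss n z = 0.
Proof. by move=> hj hn; rewrite /rgauss (pochhammer_eq0 z j n.+1) // /Cdiv Cmult_0_l. Qed.

Lemma rgamma_pole (z : C) : is_pole z -> rgamma z = 0.
Proof.
move=> [j hj]; rewrite /rgamma.
suff -> : Cgamma z = 0 by rewrite Cinv_0.
apply: (Clim_unique _ _ _ (Cgamma_lim z)).
apply: (Clim_ext _ _ _ j) (Clim_const 0) => n hn /=.
by rewrite gauss_inv (rgauss_pole n j) // Cinv_0.
Qed.

(** At a pole the approximants vanish from some index on, in agreement with [/ 0 = 0]; elsewhere the
    limits of [rgauss] and [gauss] both exist and their product is 1. *)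
Lemma rgamma_lim (z : C) : Clim (rgauss^~ z) (rgamma z).
Proof.
case: (pole_dec z) => hz.
  rewrite rgamma_pole //; case: hz => j hj.
  by apply: (Clim_ext _ _ _ j) (Clim_const 0) => n hn; rewrite /= (rgauss_pole n j).
have [l [m [hl _]]] := rgauss_gs_lim z.
suff -> : rgamma z = l by exact: hl.
have h := gamma_rgauss z l hz hl.
have hg : Cgamma z <> 0 by move=> h0; move: h; rewrite h0 Cmult_0_l => /esym; apply: C1_nz.
by rewrite /rgamma -(Cmult_1_r (/ _)) -h; field.
Qed.

Lemma rgamma_neq0 (z : C) : ~ is_pole z -> rgamma z <> 0.
Proof.
move=> hz h; have := gamma_rgauss z _ hz (rgamma_lim z); rewrite h Cmult_0_r => /esym; exact: C1_nz.
Qed.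

Lemma rgamma_inv (z : C) : / rgamma z = Cgamma z.
Proof. by rewrite /rgamma Cinv_inv. Qed.

Lemma pochhammer_le (z : C) (R0 : R) (n m : nat) : (Cmod z <= R0)%R -> (n <= m)%nat ->
  (Cmod (pochhammer z n) <= (R0 + INR m) ^ n)%R.
Proof.
move=> hz; have h0 := Cmod_ge_0 z.
elim: n => [|n IH] hn; first by rewrite pochhammer_0 Cmod_1 /=; lra.
rewrite pochhammer_S Cmod_mult -tech_pow_Rmult Rmult_comm.
apply: Rmult_le_compat; try exact: Cmod_ge_0; last by apply: IH; lia.
apply: Rle_trans (Cmod_triangle _ _) _; rewrite Cmod_INR.
by have := le_INR n m ltac:(lia); lra.
Qed.

Lemma pochhammer_ge (z : C) (tau : R) (n : nat) : (0 < tau)%R ->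
  (forall j : nat, (tau <= Cmod (z + INR j))%R) -> (tau ^ n <= Cmod (pochhammer z n))%R.
Proof.
move=> ht hz; elim: n => [|n IH]; first by rewrite pochhammer_0 Cmod_1 /=; lra.
rewrite pochhammer_S Cmod_mult -tech_pow_Rmult Rmult_comm.
by apply: Rmult_le_compat => //; [apply/pow_le/Rlt_le|apply: Rlt_le].
Qed.

Lemma Cmod_npow (n : nat) (z : C) (R0 : R) : (0 < n)%nat -> (Cmod z <= R0)%R ->
  (exp (- (R0 * ln (INR n))) <= Cmod (Cpower (INR n) z) <= exp (R0 * ln (INR n)))%R.
Proof.
move=> hn hz; have hp := INR_pos n hn.
have hl : (0 <= ln (INR n))%R.
  rewrite -ln_1; case: (Req_dec (INR n) 1) => [->|h]; first lra.
  by apply/Rlt_le/ln_increasing; [lra|have := le_INR 1 n ltac:(lia); rewrite /=; lra].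
rewrite Cpower_pos // Cmod_Cexp !ReImE.
have h1 := Re_bnd z.
by split; apply: exp_le; nra.
Qed.

Lemma rgamma_unif (R0 : R) : exists n0 M,
  [/\ (0 < n0)%nat,
      forall z, (Cmod z <= R0)%R -> (Cmod (rgamma z) <= M)%R &
      forall z n, (Cmod z <= R0)%R -> (n0 <= n)%nat -> (Cmod (rgauss n z - rgamma z) <= M / INR n)%R].
Proof.
case: (Rle_dec 0 R0) => hR0; last first.
  by exists 1%nat, 0%R; split => // z; have := Cmod_ge_0 z => *; lra.
have [n0 [hn0 hR]] := nat_above (2 * R0)%R.
have hle n : (n0 <= n)%nat -> (2 * R0 <= INR n)%R.
  by move=> hn; have : (INR n0 <= INR n)%R; [apply: le_INR; lia|lra].
have hK : (0 <= 2 * (16 * R0 ^ 2 + R0))%R by nra.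
have hf : (0 < INR n0`!)%R by apply: INR_pos; apply: fact_gt0.
pose B := ((R0 + INR n0.+1) ^ n0.+1 * / (INR n0`! * exp (- (R0 * ln (INR n0)))))%R.
case: (quadratic_ratio_limit C (fun z => Cmod z <= R0)%R rgauss _ B n0 hn0 hK).
- move=> z hz; rewrite /rgauss Cmod_mult Cmod_inv_tot Cmod_mult Cmod_INR.
  have he := exp_pos (- (R0 * ln (INR n0))).
  have [hc _] := Cmod_npow n0 z R0 hn0 hz.
  apply: Rmult_le_compat.
  + exact: Cmod_ge_0.
  + by apply/Rlt_le/Rinv_0_lt_compat/Rmult_lt_0_compat => //; lra.
  + exact: pochhammer_le.
  + apply: Rinv_le_contravar; first exact: Rmult_lt_0_compat.
    by apply: Rmult_le_compat_l => //; lra.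
- by move=> n z hn hz; apply: rgauss_step => //; [lia|exact: hle].
move=> M hM; exists n0, M; split => // [z hz|z n hz hn].
  by have [l [hl h1 h2]] := hM z hz; rewrite -(Clim_unique _ _ _ hl (rgamma_lim z)).
have [l [hl h1 h2]] := hM z hz; rewrite -(Clim_unique _ _ _ hl (rgamma_lim z)); exact: h2.
Qed.

(** The distance [tau] from the poles enters through the bound on [gauss n0]; the later steps only
    multiply by factors [1 + O(1 / n^2)], uniformly on the disc. *)
Lemma gamma_unif (R0 tau : R) : (0 < tau)%R -> exists n0 M,
  [/\ (0 < n0)%nat,
      forall z, (Cmod z <= R0)%R -> (forall j : nat, (tau <= Cmod (z + INR j))%R) -> (Cmod (Cgamma z) <= M)%R &
      forall z n, (Cmod z <= R0)%R -> (forall j : nat, (tau <= Cmod (z + INR j))%R) -> (n0 <= n)%nat ->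
        (Cmod (gauss n z - Cgamma z) <= M / INR n)%R].
Proof.
move=> ht; case: (Rle_dec 0 R0) => hR0; last first.
  by exists 1%nat, 0%R; split => // z; have := Cmod_ge_0 z => *; lra.
have [n0 [hn0 hR]] := nat_above (2 * R0)%R.
have hle n : (n0 <= n)%nat -> (2 * R0 <= INR n)%R.
  by move=> hn; have : (INR n0 <= INR n)%R; [apply: le_INR; lia|lra].
have hK : (0 <= 2 * (16 * R0 ^ 2 + R0))%R by nra.
have hf : (0 < INR n0`!)%R by apply: INR_pos; apply: fact_gt0.
pose B := (INR n0`! * exp (R0 * ln (INR n0)) * / tau ^ n0.+1)%R.
case: (quadratic_ratio_limit C (fun z => Cmod z <= R0 /\ forall j : nat, tau <= Cmod (z + INR j))%R gauss _ B n0 hn0 hK).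
- move=> z [hz hj]; rewrite /gauss Cmod_mult Cmod_inv_tot Cmod_mult Cmod_INR.
  have [_ hc] := Cmod_npow n0 z R0 hn0 hz.
  apply: Rmult_le_compat.
  + by apply: Rmult_le_pos; [lra|exact: Cmod_ge_0].
  + apply/Rlt_le/Rinv_0_lt_compat; apply: Rlt_le_trans (pochhammer_ge z tau n0.+1 ht hj).
    exact: pow_lt.
  + by apply: Rmult_le_compat_l => //; lra.
  + by apply: Rinv_le_contravar; [exact: pow_lt|exact: pochhammer_ge].
- by move=> n z hn [hz _]; apply: gauss_step => //; [lia|exact: hle].
move=> M hM; exists n0, M; split => // [z hz hj|z n hz hj hn].
  by have [l [hl h1 h2]] := hM z (conj hz hj); rewrite -(Clim_unique _ _ _ hl (Cgamma_lim z)).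
have [l [hl h1 h2]] := hM z (conj hz hj); rewrite -(Clim_unique _ _ _ hl (Cgamma_lim z)); exact: h2.
Qed.

Lemma Clim_invn : Clim (fun n => / INR n) 0.
Proof.
apply: (Clim_0_le _ _ (fun n => / INR n)%R) => [n|].
  have -> : / RtoC (INR n) - 0 = / INR n by ring.
  by rewrite Cmod_inv_tot Cmod_INR; lra.
by apply: (is_lim_seq_inv INR p_infty is_lim_seq_INR).
Qed.

(** Gauss's approximants satisfy the recurrence up to the factor [1 + (z + 1) / n], which tends to
    1. *)
Lemma rgamma_S (z : C) : rgamma z = z * rgamma (z + 1).
Proof.
have h1 : Clim (fun n => z * rgauss n (z + 1)) (z * rgamma (z + 1)).
  by apply: Clim_mult; [exact: Clim_const|exact: rgamma_lim].
have h2 : Clim (fun n => rgauss n z * (1 + (z + 1) * / INR n)) (rgamma z * (1 + (z + 1) * 0)).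
  apply: Clim_mult; first exact: rgamma_lim.
  apply: Clim_plus; first exact: Clim_const.
  by apply: Clim_mult; [exact: Clim_const|exact: Clim_invn].
have -> : rgamma z = rgamma z * (1 + (z + 1) * 0) by ring.
apply: Clim_unique h2 _; apply: (Clim_ext _ _ _ 1) h1 => n hn.
rewrite /rgauss !Cpower_pos; try exact: INR_pos.
have -> : Cexp ((z + 1) * ln (INR n)) = Cexp (z * ln (INR n)) * INR n.
  by rewrite Cmult_plus_distr_r Cexp_plus Cmult_1_l Cexp_R exp_ln //; apply: INR_pos.
have hp : z * pochhammer (z + 1) n.+1 = pochhammer z n.+1 * (z + INR n.+1).
  by rewrite -pochhammer_Sl pochhammer_S.
have -> : z * (pochhammer (z + 1) n.+1 / (INR n`! * (Cexp (z * ln (INR n)) * INR n))) =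
  z * pochhammer (z + 1) n.+1 / (INR n`! * (Cexp (z * ln (INR n)) * INR n)) by rewrite /Cdiv Cmult_assoc.
have hf := INR_fact_neq0 n; have he := Cexp_neq0 (z * ln (INR n)); have hn1 := INR_neq0 n hn.
by rewrite hp S_INR RtoC_plus; field.
Qed.

Lemma fact_pochhammer (n : nat) : pochhammer 1 n = INR n`!.
Proof.
elim: n => [//|n IH]; rewrite pochhammer_S IH INR_factS S_INR RtoC_plus; ring.
Qed.

Lemma rgamma_1 : rgamma 1 = 1.
Proof.
apply: Clim_unique (rgamma_lim 1) _.
have h : Clim (fun n => 1 + / INR n) (1 + 0) by apply: Clim_plus; [exact: Clim_const|exact: Clim_invn].
rewrite Cplus_0_r in h; apply: (Clim_ext _ _ _ 1) h => n hn.
rewrite /rgauss Cpower_pos; last exact: INR_pos.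
rewrite Cmult_1_l Cexp_R exp_ln; last exact: INR_pos.
rewrite fact_pochhammer INR_factS.
have hf := INR_fact_neq0 n; have hn1 := INR_neq0 n hn.
by rewrite S_INR RtoC_plus; field.
Qed.

Lemma rgamma_pochhammer (z : C) (k : nat) : rgamma z = pochhammer z k * rgamma (z + INR k).
Proof.
elim: k => [|k IH]; first by rewrite pochhammer_0 /= Cplus_0_r Cmult_1_l.
rewrite IH rgamma_S pochhammer_S S_INR RtoC_plus.
have -> : z + INR k + 1 = z + (INR k + 1) by ring.
ring.
Qed.

(** * Trigonometric functions and the reflection formula *)

(** Makes the reversal, shifting and splitting lemmas of iterated operators available for the finite
    products of Euler's formula. *)
HB.instance Definition _ := Monoid.isComLaw.Build C (RtoC 1) Cmult Cmult_assoc Cmult_comm Cmult_1_l.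

Lemma Ci2 : Ci * Ci = - (1).
Proof. by apply: C_eq; rewrite !ReImE; ring. Qed.

Lemma Ci_neq0 : Ci <> 0.
Proof. by move=> h; have := Ci2; rewrite h Cmult_0_l => /(f_equal Re); rewrite !ReImE; lra. Qed.

Lemma C2_neq0 : RtoC 2 <> 0.
Proof. by move/RtoC_inj; lra. Qed.

Lemma Cinv_1 : / RtoC 1 = 1.
Proof. by field. Qed.

Lemma Csin_expand (z : C) : Csin z = - Ci / 2 * (Cexp (Ci * z) - / Cexp (Ci * z)).
Proof.
rewrite /Csin -Cexp_opp; have h := Ci_neq0; have h2 := C2_neq0.
have e : - Ci / 2 * (2 * Ci) = 1.
  have -> : - Ci / 2 * (2 * Ci) = - (Ci * Ci) by field.
  by rewrite Ci2; ring.
have -> : - Ci / 2 = - Ci / 2 * (2 * Ci) * / (2 * Ci) by field.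
by rewrite e Cmult_1_l /Cdiv Cmult_comm.
Qed.

Lemma Ccos_expand (z : C) : Ccos z = / 2 * (Cexp (Ci * z) + / Cexp (Ci * z)).
Proof. by rewrite /Ccos -Cexp_opp /Cdiv Cmult_comm. Qed.

Lemma CexpiD (x y : C) : Cexp (Ci * (x + y)) = Cexp (Ci * x) * Cexp (Ci * y).
Proof. by rewrite -Cexp_plus; congr Cexp; ring. Qed.

Lemma CexpiN (x : C) : Cexp (Ci * (- x)) = / Cexp (Ci * x).
Proof. by rewrite -Cexp_opp; congr Cexp; ring. Qed.

Lemma Cexpi_trig (z : C) : Cexp (Ci * z) = Ccos z + Ci * Csin z.
Proof.
rewrite Ccos_expand Csin_expand; have h2 := C2_neq0; have he := Cexp_neq0 (Ci * z).
have -> : forall a b : C, Ci * (- Ci / 2 * (a - b)) = - (Ci * Ci) / 2 * (a - b) by move=> a b; rewrite /Cdiv; ring.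
by rewrite Ci2; field.
Qed.

Lemma Csin_plus (x y : C) : Csin (x + y) = Csin x * Ccos y + Ccos x * Csin y.
Proof.
rewrite !Csin_expand !Ccos_expand CexpiD.
by have h1 := Cexp_neq0 (Ci * x); have h2 := Cexp_neq0 (Ci * y); have h3 := C2_neq0; field.
Qed.

Lemma Ccos_plus (x y : C) : Ccos (x + y) = Ccos x * Ccos y - Csin x * Csin y.
Proof.
rewrite !Csin_expand !Ccos_expand CexpiD.
have h1 := Cexp_neq0 (Ci * x); have h2 := Cexp_neq0 (Ci * y); have h3 := C2_neq0.
have -> : forall a b c : C, - Ci / c * a * (- Ci / c * b) = (Ci * Ci) * / c * / c * a * b by move=> a b c; rewrite /Cdiv; ring.
by rewrite Ci2; field.
Qed.

Lemma Csin_opp (x : C) : Csin (- x) = - Csin x.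
Proof. by rewrite !Csin_expand CexpiN Cinv_inv; ring. Qed.

Lemma Ccos_opp (x : C) : Ccos (- x) = Ccos x.
Proof. by rewrite !Ccos_expand CexpiN Cinv_inv; ring. Qed.

Lemma Csin_minus (x y : C) : Csin (x - y) = Csin x * Ccos y - Ccos x * Csin y.
Proof. by rewrite /Cminus Csin_plus Csin_opp Ccos_opp; ring. Qed.

Lemma Ccos_minus (x y : C) : Ccos (x - y) = Ccos x * Ccos y + Csin x * Csin y.
Proof. by rewrite /Cminus Ccos_plus Csin_opp Ccos_opp; ring. Qed.

Lemma Csin_0 : Csin 0 = 0.
Proof. by rewrite Csin_expand Cmult_0_r Cexp_0 Cinv_1; ring. Qed.

Lemma Ccos_0 : Ccos 0 = 1.
Proof. by rewrite Ccos_expand Cmult_0_r Cexp_0 Cinv_1; have h := C2_neq0; field. Qed.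

Lemma Csin2_cos2 (x : C) : Csin x * Csin x + Ccos x * Ccos x = 1.
Proof.
have := Ccos_minus x x; have -> : x - x = 0 by ring.
by rewrite Ccos_0 Cplus_comm => <-.
Qed.

Lemma Csin_R (x : R) : Csin x = sin x.
Proof.
rewrite Csin_expand -Cexp_opp /Cexp !ReImE.
by apply: C_eq; rewrite !ReImE /= ?Rmult_0_l ?Rmult_0_r ?Rminus_diag ?Rplus_0_l ?Rplus_0_r ?Ropp_0 ?exp_0 ?Rmult_1_l ?cos_neg ?sin_neg; field.
Qed.

Lemma Ccos_R (x : R) : Ccos x = cos x.
Proof.
rewrite Ccos_expand -Cexp_opp /Cexp !ReImE.
by apply: C_eq; rewrite !ReImE /= ?Rmult_0_l ?Rmult_0_r ?Rminus_diag ?Rplus_0_l ?Rplus_0_r ?Ropp_0 ?exp_0 ?Rmult_1_l ?cos_neg ?sin_neg; field.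
Qed.

Lemma Csin_dbl (x : C) : Csin (2 * x) = 2 * Csin x * Ccos x.
Proof. have -> : 2 * x = x + x by ring. by rewrite Csin_plus; ring. Qed.

Lemma Ccos_dbl (x : C) : Ccos (2 * x) = 1 - 2 * (Csin x * Csin x).
Proof. have -> : 2 * x = x + x by ring. rewrite Ccos_plus -(Csin2_cos2 x); ring. Qed.

Lemma Csin_linear (y : C) : (Cmod y <= 1 / 2)%R -> (Cmod (Csin y - y) <= 8 * Cmod y ^ 2)%R.
Proof.
move=> hy; have h2 := C2_neq0.
have h : Cmod (Ci * y) = Cmod y by rewrite Cmod_mult Cmod_Ci Rmult_1_l.
have hp := Cexp_quadratic (Ci * y) ltac:(lra).
have hm := Cexp_quadratic (- (Ci * y)) ltac:(rewrite Cmod_opp; lra).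
have -> : Csin y - y = - Ci / 2 * ((Cexp (Ci * y) - 1 - Ci * y) - (Cexp (- (Ci * y)) - 1 - - (Ci * y))).
  rewrite Csin_expand -Cexp_opp.
  have -> : forall a b : C, - Ci / 2 * (a - 1 - Ci * y - (b - 1 - - (Ci * y))) = - Ci / 2 * (a - b) + (Ci * Ci) * y.
    by move=> a b; field.
  by rewrite Ci2; ring.
rewrite Cmod_mult Cmod_div // Cmod_opp Cmod_Ci Cmod_R Rabs_pos_eq; last lra.
have := Cmod_tri_sub (Cexp (Ci * y) - 1 - Ci * y) (Cexp (- (Ci * y)) - 1 - - (Ci * y)).
rewrite Cmod_opp h in hm; rewrite h in hp; lra.
Qed.

(** * Euler's finite product for the sine and its limit *)

Definition Cprod_range (f : nat -> C) (n : nat) : C := \big[Cmult/RtoC 1]_(1 <= j < n) f j.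

Lemma Cprod_rangeS (f : nat -> C) (n : nat) : (0 < n)%nat -> Cprod_range f n.+1 = Cprod_range f n * f n.
Proof. by move=> hn; rewrite /Cprod_range big_nat_recr. Qed.

(** With [N = 2^(m + 1)], the quotient of [sin (N y)] by [sin y cos y] is a polynomial in [sin^2 y]
    with roots [sin^2 (PI j / N)], [0 < j < N / 2]. This is its factor at the [j]-th root,
    normalised to 1 at [y = 0]. *)
Definition eulerfac (m : nat) (y : C) (j : nat) : C :=
  1 - Csin y * Csin y / (sin (PI * INR j / INR (expn 2 m.+1)) ^ 2)%R.

Lemma sin_pos_frac (j m : nat) : (0 < j)%nat -> (j < m)%nat -> (0 < sin (PI * INR j / INR m))%R.
Proof.
move=> hj hm; have h1 := INR_pos j hj; have h2 := INR_pos m ltac:(lia); have hP := PI_RGT_0.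
have h3 : (INR j < INR m)%R by apply: lt_INR; lia.
apply: sin_gt_0; first by apply: Rdiv_lt_0_compat => //; nra.
by apply/Rlt_div_l; nra.
Qed.

(** The root [sin^2 (2 a)] splits as [4 sin^2 a cos^2 a], and [cos a] is the sine at the
    complementary index [2^(m + 1) - j]; so one factor in [2 * y] becomes two in [y]. *)
Lemma eulerfac_pair (m j : nat) (y : C) : (0 < j)%nat -> (j < expn 2 m)%nat ->
  eulerfac m (2 * y) j = eulerfac m.+1 y j * eulerfac m.+1 y (expn 2 m.+1 - j).
Proof.
move=> hj hm; rewrite /eulerfac.
have hN : (INR (expn 2 m.+2) = 2 * INR (expn 2 m.+1))%R by rewrite expnS mult_INR.
have hNp : (0 < INR (expn 2 m.+1))%R by apply: INR_pos; rewrite expn_gt0.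
have hle : (j <= expn 2 m.+1)%nat by rewrite expnS; lia.
have hs1 : (0 < sin (PI * INR j / INR (expn 2 m.+2)))%R by apply: sin_pos_frac => //; rewrite !expnS; lia.
have hs2 : (0 < sin (PI * INR (expn 2 m.+1 - j) / INR (expn 2 m.+2)))%R by apply: sin_pos_frac; rewrite !expnS; lia.
have ha : (PI * INR j / INR (expn 2 m.+1) = 2 * (PI * INR j / INR (expn 2 m.+2)))%R by rewrite hN; field; lra.
have hb : (PI * INR (expn 2 m.+1 - j) / INR (expn 2 m.+2) = PI / 2 - PI * INR j / INR (expn 2 m.+2))%R.
  by rewrite minus_INR ?hN; [field; lra|lia].
rewrite hb sin_shift in hs2 *; rewrite ha sin_2a.
move: (PI * INR j / INR (expn 2 m.+2))%R hs1 hs2 => a h1 h2.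
rewrite Csin_dbl !RtoC_pow !RtoC_mult.
have e : Ccos y * Ccos y = 1 - Csin y * Csin y by rewrite -(Csin2_cos2 y); ring.
have ea : RtoC (cos a) * cos a = 1 - RtoC (sin a) * sin a.
  by rewrite -!RtoC_mult -RtoC_minus; congr RtoC; have := sin2_cos2 a; rewrite /Rsqr; lra.
have n1 : RtoC (sin a) <> 0 by move/RtoC_inj; lra.
have n2 : RtoC (cos a) <> 0 by move/RtoC_inj; lra.
have n3 := C2_neq0.
set s := Csin y in e *; set c := Ccos y in e *; set p := RtoC (sin a) in ea n1 *; set q := RtoC (cos a) in ea n2 *.
have -> : 2 * s * c * (2 * s * c) / (2 * p * q) ^ 2 = s * s * (c * c) / (p * p * (q * q)) by field.
have -> : (1 - s * s / p ^ 2) * (1 - s * s / q ^ 2) = 1 - (s * s * (p * p + q * q) - s * s * (s * s)) / (p * p * (q * q)) by field.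
by rewrite e ea; congr (_ - _ / _); ring.
Qed.

(** Restricting to powers of two makes the double-angle formulas the only induction step. The cosine
    produced by doubling supplies the one factor that has no partner. *)
Lemma Csin_euler (m : nat) (y : C) :
  Csin (INR (expn 2 m.+1) * y) = INR (expn 2 m.+1) * Csin y * Ccos y * Cprod_range (eulerfac m y) (expn 2 m).
Proof.
elim: m y => [|m IH] y.
  rewrite /Cprod_range big_geq // expn1 Cmult_1_r.
  have -> : INR 2 = 2%R by rewrite /=; lra.
  by rewrite Csin_dbl.
have hN : (INR (expn 2 m.+2) = 2 * INR (expn 2 m.+1))%R by rewrite (expnS 2 m.+1) mult_INR.
have -> : RtoC (INR (expn 2 m.+2)) * y = INR (expn 2 m.+1) * (2 * y) by rewrite hN RtoC_mult; ring.
rewrite IH Csin_dbl Ccos_dbl hN RtoC_mult.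
have hp : (0 < expn 2 m)%nat by rewrite expn_gt0.
(* The middle index corresponds to [sin^2 (PI / 4) = 1 / 2] and accounts for [Ccos (2 * y)]. *)
have hmid : 1 - 2 * (Csin y * Csin y) = eulerfac m.+1 y (expn 2 m).
  rewrite /eulerfac.
  have -> : (PI * INR (expn 2 m) / INR (expn 2 m.+2) = PI / 4)%R.
    have e2 : (INR (expn 2 m.+1) = 2 * INR (expn 2 m))%R by rewrite (expnS 2 m) mult_INR.
    rewrite hN e2; field; have := INR_pos _ hp; lra.
  have -> : (sin (PI / 4) ^ 2 = / 2)%R.
    rewrite sin_PI4; have := sqrt_lt_R0 2 ltac:(lra) => h.
    have -> : ((1 / sqrt 2) ^ 2 = / (sqrt 2 * sqrt 2))%R by field; lra.
    by rewrite sqrt_sqrt; lra.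
  by rewrite RtoC_inv; [have h2 := C2_neq0; field|lra].
suff -> : Cprod_range (eulerfac m.+1 y) (expn 2 m.+1) = Cprod_range (eulerfac m (2 * y)) (expn 2 m) * eulerfac m.+1 y (expn 2 m).
  by rewrite hmid; ring.
rewrite /Cprod_range (@big_cat_nat _ _ _ (expn 2 m)%nat) //=; last by rewrite expnS; lia.
rewrite (big_ltn (m := expn 2 m)); last by rewrite expnS; lia.
(* The upper half of the range is reversed, so that both halves run over the same indices and pair
   up. *)
rewrite [X in _ * (_ * X)](_ : _ = \big[Cmult/RtoC 1]_(1 <= j < expn 2 m) eulerfac m.+1 y (expn 2 m.+1 - j)); last first.
  rewrite -(add0n (expn 2 m).+1) -addn1.
  rewrite big_nat_rev /=.
  have e2 : (expn 2 m.+1 = expn 2 m + expn 2 m)%nat by rewrite expnS; lia.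
  rewrite (_ : (expn 2 m.+1 = (expn 2 m) + expn 2 m)%nat) // (_ : (0 + (expn 2 m + 1) = 1 + expn 2 m)%nat); last lia.
  rewrite big_addn addnK; apply: eq_big_nat => j hj; congr (eulerfac _ _ _); lia.
rewrite Cmult_assoc (Cmult_comm _ (eulerfac _ _ (expn 2 m))) -Cmult_assoc Cmult_comm; congr (_ * _).
rewrite -big_split /=; apply: eq_big_nat => j /andP[h1 h2].
by rewrite eulerfac_pair.
Qed.

Lemma Clim_squeeze (u v : nat -> C) (l : C) (K : R) (N : nat) :
  (forall n, (N <= n)%nat -> (Cmod (u n - l) <= K * Cmod (v n))%R) -> Clim v 0 -> Clim u l.
Proof.
move=> huv hv e he.
have hK : (0 < Rabs K + 1)%R by have := Rabs_pos K; lra.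
have [M hM] := hv (e / (Rabs K + 1))%R ltac:(exact: Rdiv_lt_0_compat).
exists (maxn N M) => n hn.
have h1 := huv n ltac:(lia); have := hM n ltac:(lia).
have -> : v n - 0 = v n by ring.
move/Rlt_div_r => /(_ hK) h2; have h3 := Cmod_ge_0 (v n); have h4 := Rle_abs K.
nra.
Qed.

(** Replaces the convergence of the series of [1 / j^2]: against this majorant all finite sums
    telescope and stay below 2. *)
Lemma inv_sq_tele (j : nat) : (0 < j)%nat -> (/ INR j ^ 2 <= 2 * (/ INR j - / INR j.+1))%R.
Proof.
move=> hj; have h := INR_pos j hj; have h1 : (1 <= INR j)%R by apply: (le_INR 1); lia.
have -> : (2 * (/ INR j - / INR j.+1) = / (INR j * (INR j.+1 / 2)))%R.
  by rewrite S_INR; field; lra.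
by apply: Rinv_le_contravar; rewrite S_INR; nra.
Qed.

Lemma tele_pos (j : nat) : (0 < j)%nat -> (0 < / INR j - / INR j.+1)%R.
Proof. by move=> hj; have := inv_sq_tele j hj; have : (0 < / INR j ^ 2)%R by [apply/Rinv_0_lt_compat/pow_lt/INR_pos|]; lra. Qed.

(** Factors are exchanged one at a time. Since partial products stay below [exp K], the error is at
    most [exp K] times the sum of the differences: [d1] accumulates linearly, the part in [d2]
    telescopes. *)
Lemma Cprod_range_diff (a b : nat -> C) (K d1 d2 : R) (n : nat) :
  (0 <= K)%R -> (0 <= d1)%R -> (0 <= d2)%R -> (0 < n)%nat ->
  (forall j, (0 < j)%nat -> (j < n)%nat ->
    [/\ (Cmod (a j) <= 1 + K * (/ INR j - / INR j.+1))%R,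
        (Cmod (b j) <= 1 + K * (/ INR j - / INR j.+1))%R &
        (Cmod (a j - b j) <= d1 + d2 * (/ INR j - / INR j.+1))%R]) ->
  (Cmod (Cprod_range a n - Cprod_range b n) <= exp K * (INR n * d1 + d2))%R.
Proof.
move=> hK h1 h2; case: n => // n _ h.
have hexp j : (0 < j)%nat -> (1 + K * (/ INR j - / INR j.+1) <= exp (K * (/ INR j - / INR j.+1)))%R.
  by move=> _; apply: exp_ineq1_le.
(* The induction needs the exact telescoped quantity [1 - 1 / (n + 1)], and the bound on the product
   of the [b j] alongside. *)
suff [_ hd] : (Cmod (Cprod_range b n.+1) <= exp (K * (1 - / INR n.+1)))%R /\
   (Cmod (Cprod_range a n.+1 - Cprod_range b n.+1) <= exp (K * (1 - / INR n.+1)) * (INR n * d1 + d2 * (1 - / INR n.+1)))%R.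
  apply: Rle_trans hd _.
  have hi : (0 < / INR n.+1)%R by apply: Rinv_0_lt_compat; apply: INR_pos.
  have hi1 : (/ INR n.+1 <= 1)%R.
    by rewrite -Rinv_1; apply: Rinv_le_contravar; [lra|apply: (le_INR 1); lia].
  have hn := pos_INR n.
  apply: Rmult_le_compat; try exact/Rlt_le/exp_pos.
  - by have := Rmult_le_pos _ _ hn h1; have := Rmult_le_pos d2 (1 - / INR n.+1) h2 ltac:(lra); lra.
  - by apply: exp_le; have := Rmult_le_pos K (/ INR n.+1) hK ltac:(lra); lra.
  - have := Rmult_le_pos d2 (/ INR n.+1) h2 ltac:(lra).
    by rewrite [X in (_ <= X * _ + _)%R]S_INR; lra.
elim: n h => [|n IH] h.
  rewrite /Cprod_range !big_geq // Cmod_1 Rinv_1 Rminus_diag !Rmult_0_r exp_0.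
  have -> : RtoC 1 - 1 = 0 by ring.
  by rewrite Cmod_0 /=; lra.
have [IH1 IH2] := IH (fun j h0 hj => h j h0 ltac:(lia)).
have [ha hb hab] := h n.+1 isT (ltnSn _).
have hw := tele_pos n.+1 isT.
set w := (/ INR n.+1 - / INR n.+2)%R in ha hb hab hw.
have he : (exp (K * (1 - / INR n.+2)) = exp (K * (1 - / INR n.+1)) * exp (K * w))%R.
  by rewrite -exp_plus; congr exp; rewrite /w; ring.
have hx := exp_ineq1_le (K * w).
set E := exp (K * (1 - / INR n.+1)) in IH1 IH2 he.
have hE : (0 < E)%R by apply: exp_pos.
have hE1 : (1 <= exp (K * w))%R by nra.
rewrite (Cprod_rangeS a n.+1) // (Cprod_rangeS b n.+1) // he; split.
  rewrite Cmod_mult; apply: Rmult_le_compat => //; try exact: Cmod_ge_0; lra.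
have -> : Cprod_range a n.+1 * a n.+1 - Cprod_range b n.+1 * b n.+1 =
  (Cprod_range a n.+1 - Cprod_range b n.+1) * a n.+1 + Cprod_range b n.+1 * (a n.+1 - b n.+1) by ring.
apply: Rle_trans (Cmod_triangle _ _) _; rewrite !Cmod_mult.
have hn := pos_INR n.
have hi1 : (/ INR n.+1 <= 1)%R.
  by rewrite -Rinv_1; apply: Rinv_le_contravar; [lra|apply: (le_INR 1); lia].
set D := (INR n * d1 + d2 * (1 - / INR n.+1))%R in IH2.
have hD : (0 <= D)%R.
  by have := Rmult_le_pos _ _ hn h1; have := Rmult_le_pos d2 (1 - / INR n.+1) h2 ltac:(lra); rewrite /D; lra.
have t1 : (Cmod (Cprod_range a n.+1 - Cprod_range b n.+1) * Cmod (a n.+1) <= (E * D) * exp (K * w))%R.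
  by apply: Rmult_le_compat => //; try exact: Cmod_ge_0; lra.
have t2 : (Cmod (Cprod_range b n.+1) * Cmod (a n.+1 - b n.+1) <= E * (d1 + d2 * w))%R.
  by apply: Rmult_le_compat => //; exact: Cmod_ge_0.
have t3 : (E * (d1 + d2 * w) <= (E * exp (K * w)) * (d1 + d2 * w))%R.
  apply: Rmult_le_compat_r; nra.
have -> : (INR n.+1 * d1 + d2 * (1 - / INR n.+2) = D + (d1 + d2 * w))%R by rewrite /D /w S_INR; ring.
lra.
Qed.

Definition sinprod (z : C) (j : nat) : C := 1 - z * z / (INR j ^ 2)%R.

(** The reflection formula in finite form: the approximants at [z] and [1 - z] multiply to the
    truncated sine product, up to a factor tending to 1. *)
Lemma rgauss_rgauss (n : nat) (z : C) : (0 < n)%nat ->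
  rgauss n z * rgauss n (1 - z) = z * Cprod_range (sinprod z) n.+1 * (1 + (1 - z) * / INR n).
Proof.
move=> hn; have hn0 := INR_neq0 n hn; have hf := INR_fact_neq0 n.
have hb k : pochhammer (z + 1) k * pochhammer (1 - z) k = Cprod_range (sinprod z) k.+1 * (INR k`! * INR k`!).
  elim: k => [|k IH]; first by rewrite /Cprod_range big_geq // !pochhammer_0 /=; ring.
  rewrite Cprod_rangeS // !pochhammer_S INR_factS.
  have -> : pochhammer (z + 1) k * (z + 1 + INR k) * (pochhammer (1 - z) k * (1 - z + INR k)) =
    pochhammer (z + 1) k * pochhammer (1 - z) k * ((z + 1 + INR k) * (1 - z + INR k)) by ring.
  rewrite IH /sinprod RtoC_pow; have hk := INR_neq0 k.+1 isT.
  by move: hk; rewrite S_INR RtoC_plus => hk; field.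
rewrite /rgauss !Cpower_pos; try exact: INR_pos.
rewrite pochhammer_Sl (pochhammer_S (1 - z)).
have he : Cexp (z * ln (INR n)) * Cexp ((1 - z) * ln (INR n)) = INR n.
  rewrite -Cexp_plus; have -> : z * ln (INR n) + (1 - z) * ln (INR n) = ln (INR n) by ring.
  by rewrite Cexp_R exp_ln //; apply: INR_pos.
set e1 := Cexp (z * _) in he *; set e2 := Cexp (_ * _) in he *.
have n1 : e1 <> 0 by apply: Cexp_neq0.
have n2 : e2 <> 0 by apply: Cexp_neq0.
set p1 := pochhammer _ _ in hb *.
transitivity (z * (pochhammer (z + 1) n * pochhammer (1 - z) n) * (1 - z + INR n) / (INR n`! * INR n`! * (e1 * e2))).
  by rewrite /p1; field.
by rewrite hb he; field.
Qed.

(** The boundedness of [1 / sin^2 a - 1 / a^2] is what makes the Euler factors close to the sine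
    factors uniformly in the index, up to the last indices, where [a] is no longer small. *)
Lemma sin_lower (a : R) : (0 < a <= 2)%R -> (a / 3 <= sin a)%R /\ (0 <= / sin a ^ 2 - / a ^ 2 <= 3)%R.
Proof.
move=> ha.
have h1 : (a - a ^ 3 / 6 <= sin a)%R.
  have := @pre_sin_bound a 0 ltac:(lra) ltac:(lra).
  by rewrite /sin_approx /sin_term /= => -[h _]; lra.
have h2 : (sin a < a)%R by apply: sin_lt_x; lra.
have h3 : (a / 3 <= sin a)%R.
  apply: Rle_trans h1; have -> : (a - a ^ 3 / 6 = a * (1 - a ^ 2 / 6))%R by field.
  have : (a ^ 2 <= 4)%R by nra.
  by move=> h; apply: Rmult_le_compat_l; lra.
split => //; set s := sin a in h1 h2 h3 *.
have hs : (0 < s)%R by lra.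
have -> : (/ s ^ 2 - / a ^ 2 = (a ^ 2 - s ^ 2) / (s ^ 2 * a ^ 2))%R by field; lra.
have hp : (0 < s ^ 2 * a ^ 2)%R by apply: Rmult_lt_0_compat; nra.
split; first by apply: Rdiv_le_0_compat => //; nra.
apply/Rle_div_l => //.
have t1 : (a ^ 2 - s ^ 2 <= (a ^ 3 / 6) * (2 * a))%R.
  have -> : (a ^ 2 - s ^ 2 = (a - s) * (a + s))%R by ring.
  by apply: Rmult_le_compat; lra.
have t2 : ((a / 3) ^ 2 <= s ^ 2)%R by apply: pow_incr; lra.
have t3 : ((a / 3) ^ 2 * a ^ 2 <= s ^ 2 * a ^ 2)%R by apply: Rmult_le_compat_r => //; nra.
have : (a ^ 3 / 6 * (2 * a) = a ^ 2 * a ^ 2 / 3)%R by field.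
nra.
Qed.

(** With [y = PI z / N], corresponding factors differ by [O(1 / N^2)] from replacing the sine of the
    root by its angle, and by [O(1 / N) / j^2] from replacing [Csin y] by [y]. Over [N / 2] factors
    the total is [O(1 / N)]. *)
Lemma Csin_euler_limit (z : C) :
  Clim (fun m => Cprod_range (eulerfac m (PI * z / INR (expn 2 m.+1))) (expn 2 m) - Cprod_range (sinprod z) (expn 2 m)) 0.
Proof.
have hP := PI_RGT_0; have hP4 := PI_4.
pose R0 := Cmod (PI * z); have hR0 : (0 <= R0)%R := Cmod_ge_0 _.
have hinv : Clim (fun m => / INR (expn 2 m.+1)) 0.
  apply: (Clim_subseq _ _ (fun m => expn 2 m.+1)) Clim_invn => n.
  by have := ltn_expl n.+1 (isT : (1 < 2)%nat); lia.
have [M0 [hM0 hM]] := nat_above (2 * R0)%R.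
pose z2 := (Cmod z ^ 2)%R.
have hz2 : (0 <= z2)%R by apply: pow_le; apply: Cmod_ge_0.
pose K := (2 * (225 * z2))%R.
apply: (Clim_squeeze _ _ _ (exp K * (3 * R0 ^ 2 + 2 * (9 * (8 * R0) * (6 * z2)))) M0) hinv => m hm.
set N := expn 2 m.+1; set h := expn 2 m.
have hh : (0 < h)%nat by rewrite expn_gt0.
have hNh : (N = h + h)%nat by rewrite /N expnS /h; lia.
have hN : (0 < INR N)%R by apply: INR_pos; lia.
have hNR : (2 * R0 <= INR N)%R.
  apply: Rle_trans hM _; apply: le_INR.
  by have := ltn_expl m.+1 (isT : (1 < 2)%nat); rewrite /N; lia.
have hNc := INR_neq0 N ltac:(lia).
set y := PI * z / INR N.
have hy : (Cmod y = R0 * / INR N)%R by rewrite /y Cmod_div // Cmod_INR.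
have hy2 : (Cmod y <= 1 / 2)%R by rewrite hy; apply/Rle_div_l; lra.
have hs := Csin_linear y hy2; have hy0 := Cmod_ge_0 y.
have hs4 : (Cmod (Csin y) <= 5 * Cmod y)%R.
  have -> : Csin y = (Csin y - y) + y by ring.
  by apply: Rle_trans (Cmod_triangle _ _) _; nra.
have hss : (Cmod (Csin y * Csin y - y * y) <= 8 * Cmod y ^ 2 * (6 * Cmod y))%R.
  have -> : Csin y * Csin y - y * y = (Csin y - y) * (Csin y + y) by ring.
  rewrite Cmod_mult; apply: Rmult_le_compat => //; try exact: Cmod_ge_0.
  by apply: Rle_trans (Cmod_triangle _ _) _; lra.
have hRN : (0 <= R0 * / INR N)%R by rewrite -hy.
apply: Rle_trans (_ : exp K * (INR h * (3 * (R0 * / INR N) ^ 2) + 2 * (9 * (8 * (R0 * / INR N)) * (6 * z2))) <= _)%R; last first.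
  have -> : Cmod (/ INR N) = (/ INR N)%R by rewrite Cmod_inv_tot Cmod_INR.
  rewrite [X in (_ <= X)%R]Rmult_assoc; apply: Rmult_le_compat_l; first exact/Rlt_le/exp_pos.
  have hhN : (INR h * / INR N <= 1)%R.
    by apply/Rle_div_l => //; rewrite Rmult_1_l; apply: le_INR; lia.
  have hi : (0 < / INR N)%R by apply: Rinv_0_lt_compat.
  have t : (INR h * / INR N * (3 * R0 ^ 2 * / INR N) <= 1 * (3 * R0 ^ 2 * / INR N))%R.
    by apply: Rmult_le_compat_r => //; apply: Rmult_le_pos; [nra|lra].
  have -> : (INR h * (3 * (R0 * / INR N) ^ 2) = INR h * / INR N * (3 * R0 ^ 2 * / INR N))%R by ring.
  lra.
have -> : Cprod_range (eulerfac m y) h - Cprod_range (sinprod z) h - 0 = Cprod_range (eulerfac m y) h - Cprod_range (sinprod z) h by ring.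
apply: Cprod_range_diff => //.
- by rewrite /K; lra.
- by nra.
- have t : (0 <= R0 * / INR N * z2)%R by apply: Rmult_le_pos.
  by lra.
move=> j hj hjh.
have hjp := INR_pos j hj; have hw := inv_sq_tele j hj; have htp := tele_pos j hj.
set w := (/ INR j - / INR j.+1)%R in hw htp *.
set th := (PI * INR j / INR N)%R.
(* As [j < N / 2], the angle is below [PI / 2], and [PI <= 4] gives the bound 2 that [sin_lower]
   requires. *)
have hth : (0 < th <= 2)%R.
  split; first by apply: Rdiv_lt_0_compat => //; apply: Rmult_lt_0_compat.
  apply/Rle_div_l => //.
  have : (2 * INR j <= INR N)%R by have := le_INR (2 * j)%nat N ltac:(lia); rewrite mult_INR.
  by move=> h2; have : (0 < INR j)%R := hjp; nra.
have [hs1 hs2] := sin_lower th hth.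
set s := sin th in hs1 hs2.
have hsp : (0 < s)%R by lra.
have hzj : (Cmod y ^ 2 * / th ^ 2 = z2 * / INR j ^ 2)%R.
  rewrite hy /th /R0 Cmod_mult Cmod_R Rabs_pos_eq; last lra.
  by rewrite /z2; field; lra.
have hij : (0 < / INR j ^ 2)%R by apply/Rinv_0_lt_compat/pow_lt.
have hsth : (/ s ^ 2 <= 9 * / th ^ 2)%R.
  have -> : (9 * / th ^ 2 = / (th / 3) ^ 2)%R by field; lra.
  by apply: Rinv_le_contravar; [apply: pow_lt; lra|apply: pow_incr; lra].
have his : (0 < / s ^ 2)%R by apply/Rinv_0_lt_compat/pow_lt.
have hit : (0 < / th ^ 2)%R by apply/Rinv_0_lt_compat/pow_lt; lra.
have hzw : (z2 * / INR j ^ 2 <= 2 * z2 * w)%R by nra.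
have mod_s2 : Cmod (RtoC (s ^ 2)%R) = (s ^ 2)%R by rewrite Cmod_R Rabs_pos_eq //; apply: pow2_ge_0.
have mod_j2 : Cmod (RtoC (INR j ^ 2)%R) = (INR j ^ 2)%R by rewrite Cmod_R Rabs_pos_eq //; apply: pow2_ge_0.
have mod_sq u : Cmod (u * u) = (Cmod u ^ 2)%R by rewrite Cmod_mult /= Rmult_1_r.
have ha : (Cmod (Csin y * Csin y / (s ^ 2)%R) <= 225 * (z2 * / INR j ^ 2))%R.
  rewrite Cmod_mult Cmod_inv_tot mod_s2 mod_sq -hzj.
  have t1 : (Cmod (Csin y) ^ 2 <= (5 * Cmod y) ^ 2)%R by apply: pow_incr; split => //; apply: Cmod_ge_0.
  have -> : (225 * (Cmod y ^ 2 * / th ^ 2) = (5 * Cmod y) ^ 2 * (9 * / th ^ 2))%R by ring.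
  by apply: Rmult_le_compat => //; [apply: pow2_ge_0|lra].
have hb : (Cmod (z * z / (INR j ^ 2)%R) <= z2 * / INR j ^ 2)%R.
  by rewrite Cmod_mult Cmod_inv_tot mod_j2 mod_sq; apply: Rle_refl.
rewrite /eulerfac /sinprod -/N -/th -/s; split.
- apply: Rle_trans (Cmod_tri_sub _ _) _; rewrite Cmod_1 /K; nra.
- apply: Rle_trans (Cmod_tri_sub _ _) _; rewrite Cmod_1 /K.
  have : (0 <= z2 * w)%R by apply: Rmult_le_pos; lra.
  nra.
have hs2c : RtoC (s ^ 2)%R <> 0 by move/RtoC_inj => e; have := pow_lt s 2 hsp; lra.
have hj2c : RtoC (INR j ^ 2)%R <> 0 by move/RtoC_inj => e; have := pow_lt (INR j) 2 hjp; lra.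
have -> : 1 - Csin y * Csin y / (s ^ 2)%R - (1 - z * z / (INR j ^ 2)%R) =
  - ((Csin y * Csin y - y * y) / (s ^ 2)%R) - y * y * RtoC (/ s ^ 2 - / th ^ 2)%R.
  have -> : z * z / (INR j ^ 2)%R = y * y * RtoC (/ th ^ 2).
    rewrite /y /th.
    have -> : (/ (PI * INR j / INR N) ^ 2 = INR N ^ 2 / (PI ^ 2 * INR j ^ 2))%R by field; lra.
    have hPc : RtoC PI <> 0 by move/RtoC_inj; lra.
    have hjc : RtoC (INR j) <> 0 by move/RtoC_inj; lra.
    have hPj : (PI ^ 2 * INR j ^ 2)%R <> 0%R by apply: Rmult_integral_contrapositive; split; apply: pow_nonzero; lra.
    by rewrite RtoC_div // RtoC_mult !RtoC_pow; field.
  have hne : (s ^ 2)%R <> 0%R by have := pow_lt s 2 hsp; lra.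
  by rewrite RtoC_minus (RtoC_inv (s ^ 2)) //; field.
apply: Rle_trans (Cmod_tri_sub _ _) _; rewrite Cmod_opp.
rewrite [Cmod (_ / _)]Cmod_mult Cmod_inv_tot mod_s2 [Cmod (y * y * _)]Cmod_mult mod_sq Cmod_R Rabs_pos_eq; last lra.
have t1 : (Cmod y ^ 2 * (/ s ^ 2 - / th ^ 2) <= Cmod y ^ 2 * 3)%R by apply: Rmult_le_compat_l; [apply: pow2_ge_0|lra].
have t2 : (Cmod (Csin y * Csin y - y * y) * / s ^ 2 <= 8 * Cmod y ^ 2 * (6 * Cmod y) * (9 * / th ^ 2))%R.
  by apply: Rmult_le_compat => //; [exact: Cmod_ge_0|lra].
have t3 : (8 * Cmod y ^ 2 * (6 * Cmod y) * (9 * / th ^ 2) = 9 * (8 * Cmod y) * 6 * (z2 * / INR j ^ 2))%R.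
  by rewrite -hzj; ring.
have t4 : (9 * (8 * Cmod y) * 6 * (z2 * / INR j ^ 2) <= 9 * (8 * Cmod y) * 6 * (2 * z2 * w))%R.
  by apply: Rmult_le_compat_l => //; lra.
rewrite -hy; lra.
Qed.

(** Euler's product at [y = PI z / N] writes [Csin (PI * z)] as [N sin y], times [cos y], times a
    product with the same limit as the truncated sine product, which [rgauss_rgauss] identifies as
    [rgamma z * rgamma (1 - z) / z]. *)
Lemma rgamma_reflection (z : C) : rgamma z * rgamma (1 - z) = Csin (PI * z) / PI.
Proof.
have hP : RtoC PI <> 0 by move/RtoC_inj; have := PI_RGT_0; lra.
case: (Ceq_dec z 0) => [->|hz].
  rewrite (rgamma_pole 0); last by exists 0%nat; rewrite Cplus_0_l.
  by rewrite Cmult_0_r Csin_0 /Cdiv !Cmult_0_l.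
set N := fun m => expn 2 m.+1; set h := fun m => expn 2 m.
have hh m : (m < h m)%nat by apply: ltn_expl.
have hNh m : (h m < N m)%nat by rewrite /N expnS -/(h m); have := hh m; lia.
have hinv : Clim (fun m => / INR (N m)) 0.
  by apply: (Clim_subseq _ _ N) Clim_invn => n; have := hh n; have := hNh n; lia.
have hB : Clim (fun m => Cprod_range (sinprod z) (h m)) (rgamma z * rgamma (1 - z) / z).
  have t1 : Clim (fun n => rgauss n z * rgauss n (1 - z)) (rgamma z * rgamma (1 - z)) by apply: Clim_mult; exact: rgamma_lim.
  have t2 : Clim (fun n => 1 + (1 - z) * / INR n) 1.
    have e : Clim (fun n => 1 + (1 - z) * / INR n) (1 + (1 - z) * 0).
      apply: Clim_plus; first exact: Clim_const.
      by apply: Clim_mult; [exact: Clim_const|exact: Clim_invn].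
    by rewrite Cmult_0_r Cplus_0_r in e.
  have t3 := Clim_inv _ _ C1_nz t2; rewrite Cinv_1 in t3.
  have t4 := Clim_mult _ _ _ _ (Clim_mult _ _ _ _ t1 t3) (Clim_const (/ z)).
  have -> : rgamma z * rgamma (1 - z) / z = rgamma z * rgamma (1 - z) * 1 * / z by rewrite Cmult_1_r.
  have t5 : Clim (fun n => Cprod_range (sinprod z) n.+1) (rgamma z * rgamma (1 - z) * 1 * / z).
    have [K [hK1 hK2]] := nat_above (Cmod (1 - z) + 1)%R.
    apply: (Clim_ext _ _ _ K) t4 => n hn.
    rewrite rgauss_rgauss; last lia.
    have hne : 1 + (1 - z) * / INR n <> 0.
      apply/Cmod_gt_0; have := Cmod_rev_plus 1 ((1 - z) * / INR n).
      rewrite Cmod_1 Cmod_mult Cmod_inv_tot Cmod_INR.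
      have hnp := INR_pos n ltac:(lia).
      have hKn : (INR K <= INR n)%R by apply: le_INR; lia.
      suff : (Cmod (1 - z) * / INR n < 1)%R by lra.
      by apply/Rlt_div_l => //; lra.
    have hn0 := INR_neq0 n ltac:(lia).
    field; do !split => //; rewrite /Cminus.
    by move=> h0; apply: hne; have -> : 1 + (1 - z) * / INR n = (INR n + (1 + - z)) / INR n; [field|rewrite h0 /Cdiv Cmult_0_l].
  have t6 := Clim_subseq _ _ (fun m => (h m).-1) (fun n => ltac:(have := hh n; lia)) t5.
  by apply: (Clim_ext _ _ _ 0) t6 => m _; rewrite prednK //; have := hh m; lia.
have hA : Clim (fun m => Cprod_range (eulerfac m (PI * z / INR (N m))) (h m)) (rgamma z * rgamma (1 - z) / z).
  have t := Clim_plus _ _ _ _ (Csin_euler_limit z) hB; rewrite Cplus_0_l in t.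
  by apply: (Clim_ext _ _ _ 0) t => m _; rewrite -/(N m) -/(h m); ring.
pose R0 := Cmod (PI * z); have hR0 : (0 <= R0)%R := Cmod_ge_0 _.
have [M0 [hM0 hM]] := nat_above (2 * R0)%R.
have hNM m : (M0 <= m)%nat -> (0 < INR (N m))%R /\ (2 * R0 <= INR (N m))%R.
  move=> hm; split; first by apply: INR_pos; have := hNh m; lia.
  by apply: Rle_trans hM _; apply: le_INR; have := hh m; have := hNh m; lia.
have hS : Clim (fun m => INR (N m) * Csin (PI * z / INR (N m))) (PI * z).
  apply: (Clim_squeeze _ _ _ (8 * R0 ^ 2) M0) hinv => m hm; have [h1 h2] := hNM m hm.
  have hc : RtoC (INR (N m)) <> 0 by move/RtoC_inj; lra.
  have e : PI * z = INR (N m) * (PI * z / INR (N m)) by field.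
  rewrite {2}e; set y := PI * z / INR (N m).
  have hy : (Cmod y = R0 * / INR (N m))%R by rewrite /y Cmod_mult Cmod_inv_tot Cmod_INR.
  have hs := Csin_linear y ltac:(rewrite hy; apply/Rle_div_l; lra).
  have -> : INR (N m) * Csin y - INR (N m) * y = INR (N m) * (Csin y - y) by ring.
  rewrite Cmod_mult Cmod_inv_tot Cmod_INR.
  apply: Rle_trans (Rmult_le_compat_l _ _ _ (Rlt_le _ _ h1) hs) _; rewrite hy.
  by apply: Req_le; field; lra.
have hSy : Clim (fun m => Csin (PI * z / INR (N m))) 0.
  have t := Clim_mult _ _ _ _ hS hinv; rewrite Cmult_0_r in t.
  apply: (Clim_ext _ _ _ 0) t => m _.
  by have := INR_neq0 (N m) ltac:(have := hNh m; lia) => hc; field.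
have hC : Clim (fun m => Ccos (PI * z / INR (N m))) 1.
  (* The half angle at level [m] is the full angle at level [m + 1], so its sine tends to 0 by a
     shift of the index. *)
  have t : Clim (fun m => Csin (PI * z / 2 / INR (N m))) 0.
    apply: (Clim_ext (fun m => Csin (PI * z / INR (N m.+1))) _ _ 0) => [m _|].
      congr Csin; rewrite /N (expnS 2 m.+1) mult_INR RtoC_mult -/(N m).
      have := INR_neq0 (N m) ltac:(have := hNh m; lia) => hc.
      by have -> : INR 2 = 2%R by [rewrite /=; lra]; have := C2_neq0 => h2; field.
    exact: (Clim_subseq _ _ S (fun n => leqnSn n) hSy).
  have t2 := Clim_minus _ _ _ _ (Clim_const 1) (Clim_mult _ _ _ _ (Clim_const 2) (Clim_mult _ _ _ _ t t)).
  rewrite !Cmult_0_r in t2; have e : 1 - 0 = 1 by ring.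
  rewrite e in t2; apply: (Clim_ext _ _ _ 0) t2 => m _.
  rewrite -Ccos_dbl; congr Ccos.
  by have := INR_neq0 (N m) ltac:(have := hNh m; lia) => hc; have := C2_neq0 => h2; field.
have hall := Clim_mult _ _ _ _ (Clim_mult _ _ _ _ hS hC) hA.
have hconst : Clim (fun=> Csin (PI * z)) (PI * z * 1 * (rgamma z * rgamma (1 - z) / z)).
  apply: (Clim_ext _ _ _ 0) hall => m _; rewrite -Csin_euler; congr Csin.
  by have := INR_neq0 (N m) ltac:(have := hNh m; lia) => hc; rewrite /N in hc *; field.
rewrite (Clim_unique _ _ _ (Clim_const _) hconst); field; split => //.
Qed.

(** * Duplication and decay *)

Lemma Clim_Cexp (u : nat -> C) (l : C) : Clim u l -> Clim (fun n => Cexp (u n)) (Cexp l).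
Proof.
move=> hu.
have h0 : Clim (fun n => u n - l) 0.
  by have := Clim_minus _ _ _ _ hu (Clim_const l); have -> : l - l = 0 by ring.
have [N hN] := hu (1 / 2)%R ltac:(lra).
apply: (Clim_squeeze _ _ _ (Cmod (Cexp l) * 5) N) h0 => n hn.
have hd := hN n hn; set d := u n - l in hd *.
have -> : u n = l + d by rewrite /d; ring.
have -> : Cexp (l + d) - Cexp l = Cexp l * ((Cexp d - 1 - d) + d) by rewrite Cexp_plus; ring.
rewrite Cmod_mult Rmult_assoc; apply: Rmult_le_compat_l; first exact: Cmod_ge_0.
apply: Rle_trans (Cmod_triangle _ _) _.
by have := Cexp_quadratic d ltac:(lra); have := Cmod_ge_0 d; nra.
Qed.

Lemma pochhammer_dup (z : C) (n : nat) :
  pochhammer z n * pochhammer (z + / 2) n * 4 ^ n = pochhammer (2 * z) (n + n).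
Proof.
elim: n => [|n IH]; first by rewrite !pochhammer_0 /=; ring.
rewrite addSn addnS !pochhammer_S -IH S_INR plus_INR !RtoC_plus.
have h2 := C2_neq0; rewrite /Cpow -/Cpow.
by field.
Qed.

Lemma ln_ratio_lim : Clim (fun n => RtoC (ln (INR (n + n).+1) - ln (INR n))) (ln 2).
Proof.
apply: (Clim_squeeze _ _ _ 1 1) Clim_invn => n hn.
have hp := INR_pos n hn.
rewrite -RtoC_minus Cmod_R Cmod_inv_tot Cmod_INR Rmult_1_l.
have e : (INR (n + n).+1 = 2 * INR n * (1 + / (2 * INR n)))%R by rewrite S_INR plus_INR; field; lra.
have hi : (0 < / (2 * INR n))%R by apply: Rinv_0_lt_compat; lra.
rewrite e ln_mult; try lra.
rewrite ln_mult; try lra.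
have -> : (ln 2 + ln (INR n) + ln (1 + / (2 * INR n)) - ln (INR n) - ln 2 = ln (1 + / (2 * INR n)))%R by ring.
have h1 := ln_le_sub1 (1 + / (2 * INR n)) ltac:(lra).
have h2 : (0 <= ln (1 + / (2 * INR n)))%R by rewrite -ln_1; apply: Rlt_le; apply: ln_increasing; lra.
have h3 : (/ (2 * INR n) <= / INR n)%R by apply: Rinv_le_contravar; lra.
by rewrite Rabs_pos_eq; lra.
Qed.

(** The approximants of order [n] at [z] and [z + 1/2] combine into the one of order [2 n + 1] at
    [2 z]. Dividing by the same relation at [z = 1/2] removes the factorials, so no asymptotics of
    [n!] enters; the price is the constant [rgamma (/ 2)], evaluated next. *)
Lemma rgamma_dup_gen (z : C) : rgamma z * rgamma (z + / 2) * 2 = Cexp (2 * z * ln 2) * rgamma (2 * z) * rgamma (/ 2).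
Proof.
have h2 := C2_neq0.
(* Two Pochhammer symbols with [n + 1] factors each make one with [2 n + 2], that is [phi n + 1],
   factors. *)
pose phi n := (n + n).+1.
have hphi n : (n <= phi n)%nat by rewrite /phi; lia.
have L1 : Clim (fun n => rgauss n z * rgauss n (z + / 2) * Cexp (RtoC (ln (INR (n + n).+1) - ln (INR n))) * rgauss (phi n) 1)
    (rgamma z * rgamma (z + / 2) * Cexp (ln 2) * rgamma 1).
  apply: Clim_mult; last exact: (Clim_subseq _ _ phi hphi (rgamma_lim 1)).
  apply: Clim_mult; last exact: Clim_Cexp ln_ratio_lim.
  by apply: Clim_mult; exact: rgamma_lim.
have L2 : Clim (fun n => Cexp (2 * z * RtoC (ln (INR (n + n).+1) - ln (INR n))) * rgauss (phi n) (2 * z) * (rgauss n (/ 2) * rgauss n 1))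
    (Cexp (2 * z * ln 2) * rgamma (2 * z) * (rgamma (/ 2) * rgamma 1)).
  apply: Clim_mult; last by apply: Clim_mult; exact: rgamma_lim.
  apply: Clim_mult; last exact: (Clim_subseq _ _ phi hphi (rgamma_lim (2 * z))).
  by apply: Clim_Cexp; apply: Clim_mult; [exact: Clim_const|exact: ln_ratio_lim].
rewrite rgamma_1 Cexp_R exp_ln ?Cmult_1_r in L1 L2; last lra.
apply: Clim_unique L1 _; apply: (Clim_ext _ _ _ 1) L2 => n hn.
have hpn := INR_pos n hn; have hpp := INR_pos (phi n) isT.
rewrite /rgauss !Cpower_pos // -/(phi n).
set ln_n := ln (INR n); set ln_p := ln (INR (phi n)).
have e1 : Cexp (2 * z * RtoC (ln_p - ln_n)) = Cexp (2 * z * ln_p) / (Cexp (z * ln_n) * Cexp (z * ln_n)).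
  by rewrite /Cdiv -Cexp_plus -Cexp_opp -Cexp_plus RtoC_minus; congr Cexp; ring.
have e2 : Cexp ((z + / 2) * ln_n) = Cexp (z * ln_n) * Cexp (/ 2 * ln_n).
  by rewrite -Cexp_plus; congr Cexp; ring.
have e3 : Cexp (RtoC (ln_p - ln_n)) = INR (phi n) / INR n.
  rewrite RtoC_minus /Cminus Cexp_plus Cexp_opp !Cexp_R /ln_n /ln_p !exp_ln //.
have e4 : Cexp (1 * ln_n) = INR n by rewrite Cmult_1_l Cexp_R exp_ln.
have e5 : Cexp (1 * ln_p) = INR (phi n) by rewrite Cmult_1_l Cexp_R exp_ln.
have e6 : Cexp (2 * z * ln_n) = Cexp (z * ln_n) * Cexp (z * ln_n) by rewrite -Cexp_plus; congr Cexp; ring.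
have hp1 := pochhammer_dup z n.+1; have hp2 := pochhammer_dup (/ 2) n.+1.
have hh : / 2 + / 2 = 1 by field.
have hh2 : 2 * / 2 = 1 by field.
rewrite hh hh2 in hp2.
have es : (n.+1 + n.+1 = (phi n).+1)%nat by rewrite /phi; lia.
rewrite es in hp1 hp2.
rewrite e1 e2 e3 e4 e5.
set a := Cexp (z * ln_n); set b := Cexp (/ 2 * ln_n); set c := Cexp (2 * z * ln_p).
have ha : a <> 0 by apply: Cexp_neq0.
have hb : b <> 0 by apply: Cexp_neq0.
have hc : c <> 0 by apply: Cexp_neq0.
have hf1 := INR_fact_neq0 n; have hf2 := INR_fact_neq0 (phi n).
have hn1 := INR_neq0 n hn; have hn2 := INR_neq0 (phi n) isT.
have h4 : RtoC 4 ^ n.+1 <> 0 by apply: Cpow_nz; move/RtoC_inj; lra.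
rewrite -{1}hp1 -hp2.
by field.
Qed.

(** Reflection at 1/2 gives the square; the sign is fixed by the approximants, which are nonnegative
    reals. *)
Lemma rgamma_half : rgamma (/ 2) = / sqrt PI.
Proof.
have hP := PI_RGT_0; have h2 := C2_neq0.
have hsq : rgamma (/ 2) * rgamma (/ 2) = / PI.
  have e := rgamma_reflection (/ 2).
  have -> : rgamma (/ 2) * rgamma (/ 2) = rgamma (/ 2) * rgamma (1 - / 2) by congr (_ * rgamma _); field.
  rewrite e; have -> : PI * / 2 = RtoC (PI / 2) by rewrite RtoC_div; [|lra].
  by rewrite Csin_R sin_PI2 /Cdiv Cmult_1_l.
have hreal : exists x : R, (0 <= x)%R /\ rgamma (/ 2) = x.
  have hr n : (0 < n)%nat -> exists x : R, (0 <= x)%R /\ rgauss n (/ 2) = x.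
    move=> hn; have hp k : exists x : R, (0 <= x)%R /\ pochhammer (/ 2) k = x.
      elim: k => [|k [x [hx IH]]]; first by exists 1%R; split; [lra|].
      exists (x * (/ 2 + INR k))%R; split; first by have := pos_INR k; nra.
      by rewrite pochhammer_S IH RtoC_mult RtoC_plus RtoC_inv //; lra.
    have [x [hx e]] := hp n.+1.
    have hf : (0 < INR n`!)%R by apply: INR_pos; apply: fact_gt0.
    exists (x / (INR n`! * exp (/ 2 * ln (INR n))))%R; split.
      by apply: Rdiv_le_0_compat => //; apply: Rmult_lt_0_compat => //; apply: exp_pos.
    rewrite /rgauss e Cpower_pos; last exact: INR_pos.
    have he := exp_pos (/ 2 * ln (INR n)).
    rewrite RtoC_div; last by apply: Rmult_integral_contrapositive; split; lra.
    by rewrite RtoC_mult -Cexp_R RtoC_mult RtoC_inv.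
  exists (Re (rgamma (/ 2))); split.
    apply: Rnot_lt_le => hlt; have [N hN] := rgamma_lim (/ 2) (- Re (rgamma (/ 2)))%R ltac:(lra).
    have [x [hx e]] := hr N.+1 isT; have := hN N.+1 ltac:(lia); rewrite e.
    by move: (rgamma (/ 2)) hlt => v hlt h; have := Re_bnd (x - v); rewrite !ReImE; lra.
  apply: C_eq; rewrite !ReImE //.
  case: (Req_dec (Im (rgamma (/ 2))) 0) => // hne.
  have hpos : (0 < Rabs (Im (rgamma (/ 2))))%R by apply: Rabs_pos_lt.
  have [N hN] := rgamma_lim (/ 2) _ hpos.
  have [x [hx e]] := hr N.+1 isT; have := hN N.+1 ltac:(lia); rewrite e.
  by move: (rgamma (/ 2)) => v h; have := Im_le_Cmod (x - v); rewrite !ReImE Rminus_0_l Rabs_Ropp; lra.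
case: hreal => x [hx e]; rewrite e in hsq *.
have hsp := sqrt_lt_R0 PI hP.
rewrite -RtoC_inv; last lra.
congr RtoC; move: hsq; rewrite -RtoC_mult -RtoC_inv; last lra.
move/RtoC_inj => h; by rewrite -(sqrt_square x) // h; apply: sqrt_inv.
Qed.

Lemma rgamma_dup (z : C) : rgamma z * rgamma (z + / 2) = Cpower 2 (2 * z) * rgamma (2 * z) / (2 * sqrt PI).
Proof.
have h2 := C2_neq0; have hs : RtoC (sqrt PI) <> 0.
  by move/RtoC_inj; have := sqrt_lt_R0 PI PI_RGT_0; lra.
have := rgamma_dup_gen z; rewrite rgamma_half Cpower_pos; last lra.
move=> e; have -> : rgamma z * rgamma (z + / 2) = rgamma z * rgamma (z + / 2) * 2 / 2 by field.
by rewrite e; field.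
Qed.

(** The rate [a] is arbitrary: as soon as [Re z] exceeds [exp a + 1], a unit step to the right
    divides by [z - 1], of modulus at least [exp a]. The induction counts the unit steps beyond the
    bounded part. *)
Lemma rgamma_decay (R0 a : R) : (0 <= a)%R -> exists M, (0 <= M)%R /\
  forall z, (Rabs (Im z) <= R0)%R -> (- R0 <= Re z)%R -> (Cmod (rgamma z) <= M * exp (- (a * Re z)))%R.
Proof.
move=> ha; pose U := (exp a + 1)%R.
have hA := exp_ineq1_le a.
have [n0 [M [_ hM _]]] := rgamma_unif (R0 + U + R0).
have hM0 : (0 <= Rmax 0 M)%R by apply: Rmax_l.
exists (Rmax 0 M * exp (a * U))%R; split; first by apply: Rmult_le_pos => //; apply/Rlt_le/exp_pos.
suff H : forall n z, (Rabs (Im z) <= R0)%R -> (- R0 <= Re z)%R -> (Re z <= U + INR n)%R ->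
    (Cmod (rgamma z) <= Rmax 0 M * exp (a * U) * exp (- (a * Re z)))%R.
  by move=> z h1 h2; have [n [_ hn]] := nat_above (Re z); apply: (H n) => //; rewrite /U; lra.
elim=> [|n IH] z h1 h2 h3.
  rewrite Rmult_assoc -exp_plus; apply: Rle_trans (_ : Rmax 0 M * 1 <= _)%R.
    rewrite Rmult_1_r; apply: Rle_trans (Rmax_r 0 M); apply: hM.
    apply: Rle_trans (Cmod_le_ReIm _) _; rewrite /= in h3.
    have := Rabs_pos (Im z) => h4.
    by have : (Rabs (Re z) <= R0 + U)%R; [apply/Rabs_le_between; rewrite /U in h3 *; lra|lra].
  apply: Rmult_le_compat_l => //; rewrite -exp_0; apply: exp_le.
  by move: h3; rewrite /= => h3; nra.
case: (Rle_dec (Re z) (U + INR n)) => h4; first exact: IH.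
have hn := pos_INR n.
have := IH (z - 1); rewrite !ReImE Rminus_0_r => /(_ h1).
rewrite S_INR in h3 => IHz; have {}IHz := IHz ltac:(have := Rabs_pos (Im z); rewrite /U in h4; lra) ltac:(lra).
have e : rgamma (z - 1) = (z - 1) * rgamma z by rewrite rgamma_S; congr (_ * rgamma _); ring.
have hz1 : (exp a <= Cmod (z - 1))%R.
  by have := Re_bnd (z - 1); rewrite !ReImE; rewrite /U in h4; lra.
rewrite e Cmod_mult in IHz.
have -> : (- (a * Re z) = - (a * (Re z - 1)) + - a)%R by ring.
rewrite exp_plus -Rmult_assoc (exp_Ropp a); have hp := exp_pos a.
apply: (proj1 (Rle_div_r _ _ (exp a) hp)); apply: Rle_trans IHz; rewrite Rmult_comm.
by apply: Rmult_le_compat_r => //; apply: Cmod_ge_0.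
Qed.

Lemma gamma_S (z : C) : Cgamma z = / z * Cgamma (z + 1).
Proof. by rewrite -!rgamma_inv (rgamma_S z) Cinv_mul. Qed.

(** The mirror image of [rgamma_decay]: a unit step to the left divides by a number of modulus at
    least [exp a], and the distance [tau] from the poles bounds Gamma on the bounded part. *)
Lemma gamma_decay (R0 a tau : R) : (0 <= a)%R -> (0 < tau)%R -> exists M, (0 <= M)%R /\
  forall z, (Rabs (Im z) <= R0)%R -> (Re z <= R0)%R -> (forall j : nat, (tau <= Cmod (z + INR j))%R) ->
    (Cmod (Cgamma z) <= M * exp (a * Re z))%R.
Proof.
move=> ha ht; pose U := (exp a + 1)%R.
have hA := exp_ineq1_le a.
have [n0 [M [_ hM _]]] := gamma_unif (R0 + U + R0) tau ht.
have hM0 : (0 <= Rmax 0 M)%R by apply: Rmax_l.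
exists (Rmax 0 M * exp (a * U))%R; split; first by apply: Rmult_le_pos => //; apply/Rlt_le/exp_pos.
suff H : forall n z, (Rabs (Im z) <= R0)%R -> (Re z <= R0)%R -> (forall j : nat, (tau <= Cmod (z + INR j))%R) -> (- (U + INR n) <= Re z)%R ->
    (Cmod (Cgamma z) <= Rmax 0 M * exp (a * U) * exp (a * Re z))%R.
  by move=> z h1 h2 h3; have [n [_ hn]] := nat_above (- Re z); apply: (H n) => //; rewrite /U; lra.
elim=> [|n IH] z h1 h2 ht2 h3.
  rewrite Rmult_assoc -exp_plus; apply: Rle_trans (_ : Rmax 0 M * 1 <= _)%R.
    rewrite Rmult_1_r; apply: Rle_trans (Rmax_r 0 M); apply: hM => //.
    apply: Rle_trans (Cmod_le_ReIm _) _; rewrite /= in h3.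
    have := Rabs_pos (Im z) => h4.
    by have : (Rabs (Re z) <= R0 + U)%R; [apply/Rabs_le_between; rewrite /U in h3 *; lra|lra].
  apply: Rmult_le_compat_l => //; rewrite -exp_0; apply: exp_le.
  by move: h3; rewrite /= => h3; nra.
case: (Rle_dec (- (U + INR n)) (Re z)) => h4; first exact: IH.
have hn := pos_INR n.
have := IH (z + 1); rewrite !ReImE Rplus_0_r => /(_ h1).
rewrite S_INR in h3 => IHz; have {}IHz := IHz ltac:(have := Rabs_pos (Im z); rewrite /U in h4; lra).
have {}IHz := IHz (fun j => _) ltac:(lra).
have hj j : (tau <= Cmod (z + 1 + INR j))%R.
  by have := ht2 j.+1; rewrite S_INR RtoC_plus; have -> : z + (INR j + 1) = z + 1 + INR j by ring.
have {}IHz := IHz hj.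
have hz1 : (exp a <= Cmod z)%R.
  by have := Re_bnd z; rewrite /U in h4; lra.
have hp := exp_pos a.
have hz0 : z <> 0 by apply/Cmod_gt_0; lra.
rewrite gamma_S Cmod_mult Cmod_inv // Rmult_comm.
have hzp : (0 < Cmod z)%R by lra.
apply: (proj2 (Rle_div_l _ _ (Cmod z) hzp)).
apply: Rle_trans IHz _; rewrite Rmult_plus_distr_l Rmult_1_r exp_plus.
rewrite -Rmult_assoc; apply: Rmult_le_compat_l => //.
by apply: Rmult_le_pos; [apply: Rmult_le_pos => //|]; apply/Rlt_le/exp_pos.
Qed.

(** * Uniform approximation by polynomials *)

Definition horner (l : seq C) (s : C) : C := foldr (fun c v => c + s * v) 0 l.

Definition is_poly (P : C -> C) : Prop := exists l, forall s, P s = horner l s.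

Lemma is_poly_plus (P Q : C -> C) : is_poly P -> is_poly Q -> is_poly (fun s => P s + Q s).
Proof.
move=> [l hl] [m hm].
suff [k hk] : exists k, forall s, horner l s + horner m s = horner k s by exists k => s; rewrite hl hm.
elim: l m {hl hm} => [|c l IH] m; first by exists m => s; rewrite Cplus_0_l.
case: m => [|d m]; first by exists (c :: l) => s; rewrite Cplus_0_r.
have [k hk] := IH m; exists ((c + d) :: k) => s /=; rewrite -hk; ring.
Qed.

Lemma is_poly_scal (a : C) (P : C -> C) : is_poly P -> is_poly (fun s => a * P s).
Proof.
move=> [l hl].
suff [k hk] : exists k, forall s, a * horner l s = horner k s by exists k => s; rewrite hl.
elim: l {hl} => [|c l [k IH]]; first by exists [::] => s; rewrite Cmult_0_r.
by exists ((a * c) :: k) => s /=; rewrite -IH; ring.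
Qed.

Lemma is_poly_shift (P : C -> C) : is_poly P -> is_poly (fun s => s * P s).
Proof. by move=> [l hl]; exists (RtoC 0 :: l) => s /=; rewrite hl; ring. Qed.

Lemma is_poly_ext (P Q : C -> C) : (forall s, P s = Q s) -> is_poly P -> is_poly Q.
Proof. by move=> h [l hl]; exists l => s; rewrite -h. Qed.

Lemma is_poly_mult (P Q : C -> C) : is_poly P -> is_poly Q -> is_poly (fun s => P s * Q s).
Proof.
move=> [l hl] hQ; apply: (is_poly_ext (fun s => horner l s * Q s)) => [s|]; first by rewrite hl.
elim: l {hl} => [|c l IH].
  by exists [::] => s; rewrite Cmult_0_l.
apply: (is_poly_ext (fun s => c * Q s + s * (horner l s * Q s))) => [s|]; first by rewrite /=; ring.
by apply: is_poly_plus; [exact: is_poly_scal|exact: is_poly_shift].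
Qed.

Lemma is_poly_const (c : C) : is_poly (fun=> c).
Proof. by exists [:: c] => s /=; ring. Qed.

Lemma is_poly_id : is_poly (fun s => s).
Proof. by exists [:: RtoC 0; RtoC 1] => s /=; ring. Qed.

Definition Cbounded (S : C -> Prop) : Prop := exists B : R, forall s, S s -> (Cmod s <= B)%R.

Lemma poly_bounded (S : C -> Prop) (P : C -> C) : Cbounded S -> is_poly P ->
  exists M, (0 <= M)%R /\ forall s, S s -> (Cmod (P s) <= M)%R.
Proof.
move=> [B hB] [l hl].
suff [M [h0 hM]] : exists M, (0 <= M)%R /\ forall s, S s -> (Cmod (horner l s) <= M)%R.
  by exists M; split => // s hs; rewrite hl; apply: hM.
elim: l {hl} => [|c l [M [h0 IH]]]; first by exists 0%R; split; [lra|move=> s _; rewrite Cmod_0; lra].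
exists (Cmod c + Rmax 0 B * M)%R; split.
  by have := Cmod_ge_0 c; have := Rmult_le_pos (Rmax 0 B) M (Rmax_l _ _) h0; lra.
move=> s hs /=; apply: Rle_trans (Cmod_triangle _ _) _; apply: Rplus_le_compat_l.
rewrite Cmod_mult; apply: Rmult_le_compat; try exact: Cmod_ge_0; last exact: IH.
by apply: Rle_trans (hB s hs) (Rmax_r _ _).
Qed.

(** Closed under sums, uniform limits and, on bounded sets, products. Unlike holomorphy it depends
    on the shape of [S]: [1 / s] is not approximable on a circle around 0. *)
Definition Apx (S : C -> Prop) (f : C -> C) : Prop :=
  forall e, (0 < e)%R -> exists P, is_poly P /\ forall s, S s -> (Cmod (f s - P s) <= e)%R.

Lemma Apx_poly (S : C -> Prop) (P : C -> C) : is_poly P -> Apx S P.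
Proof.
move=> hP e he; exists P; split => // s _.
have -> : P s - P s = 0 by ring.
by rewrite Cmod_0; lra.
Qed.

Lemma Apx_const (S : C -> Prop) (c : C) : Apx S (fun=> c).
Proof. by apply: Apx_poly; apply: is_poly_const. Qed.

Lemma Apx_id (S : C -> Prop) : Apx S (fun s => s).
Proof. by apply: Apx_poly; apply: is_poly_id. Qed.

Lemma Apx_lim (S : C -> Prop) (f : C -> C) :
  (forall e, (0 < e)%R -> exists g, Apx S g /\ forall s, S s -> (Cmod (f s - g s) <= e)%R) -> Apx S f.
Proof.
move=> h e he; have [g [hg hfg]] := h (e / 2)%R ltac:(lra).
have [P [hP hgP]] := hg (e / 2)%R ltac:(lra).
exists P; split => // s hs.
have -> : f s - P s = (f s - g s) + (g s - P s) by ring.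
by apply: Rle_trans (Cmod_triangle _ _) _; have := hfg s hs; have := hgP s hs; lra.
Qed.

Lemma Apx_ext (S : C -> Prop) (f g : C -> C) : (forall s, S s -> f s = g s) -> Apx S f -> Apx S g.
Proof.
move=> h hf e he; have [P [hP hfP]] := hf e he.
by exists P; split => // s hs; rewrite -h //; apply: hfP.
Qed.

Lemma Apx_plus (S : C -> Prop) (f g : C -> C) : Apx S f -> Apx S g -> Apx S (fun s => f s + g s).
Proof.
move=> hf hg e he.
have [P [hP h1]] := hf (e / 2)%R ltac:(lra); have [Q [hQ h2]] := hg (e / 2)%R ltac:(lra).
exists (fun s => P s + Q s); split; first exact: is_poly_plus.
move=> s hs; have -> : f s + g s - (P s + Q s) = (f s - P s) + (g s - Q s) by ring.
by apply: Rle_trans (Cmod_triangle _ _) _; have := h1 s hs; have := h2 s hs; lra.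
Qed.

Lemma Apx_bounded (S : C -> Prop) (f : C -> C) : Cbounded S -> Apx S f ->
  exists M, (0 <= M)%R /\ forall s, S s -> (Cmod (f s) <= M)%R.
Proof.
move=> hS hf; have [P [hP h]] := hf 1%R Rlt_0_1.
have [M [h0 hM]] := poly_bounded S P hS hP.
exists (M + 1)%R; split; first lra.
move=> s hs; have := h s hs; have := hM s hs; have := Cmod_rev (f s) (P s); lra.
Qed.

Lemma Apx_mult (S : C -> Prop) (f g : C -> C) : Cbounded S -> Apx S f -> Apx S g -> Apx S (fun s => f s * g s).
Proof.
move=> hS hf hg e he.
have [M [hM0 hM]] := Apx_bounded S f hS hf.
have [Q [hQ h2]] := hg (e / (2 * (M + 1)))%R ltac:(apply: Rdiv_lt_0_compat; lra).
have [N [hN0 hN]] := poly_bounded S Q hS hQ.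
have [P [hP h1]] := hf (e / (2 * (N + 1)))%R ltac:(apply: Rdiv_lt_0_compat; lra).
exists (fun s => P s * Q s); split; first exact: is_poly_mult.
move=> s hs; have -> : f s * g s - P s * Q s = f s * (g s - Q s) + (f s - P s) * Q s by ring.
apply: Rle_trans (Cmod_triangle _ _) _; rewrite !Cmod_mult.
have t1 : (Cmod (f s) * Cmod (g s - Q s) <= (M + 1) * (e / (2 * (M + 1))))%R.
  by apply: Rmult_le_compat; try exact: Cmod_ge_0; [have := hM s hs; lra|exact: h2].
have t2 : (Cmod (f s - P s) * Cmod (Q s) <= (e / (2 * (N + 1))) * (N + 1))%R.
  by apply: Rmult_le_compat; try exact: Cmod_ge_0; [exact: h1|have := hN s hs; lra].
have e1 : ((M + 1) * (e / (2 * (M + 1))) = e / 2)%R by field; lra.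
have e2 : ((e / (2 * (N + 1))) * (N + 1) = e / 2)%R by field; lra.
lra.
Qed.

Lemma Apx_scal (S : C -> Prop) (c : C) (f : C -> C) : Cbounded S -> Apx S f -> Apx S (fun s => c * f s).
Proof. by move=> hS; apply: Apx_mult => //; apply: Apx_const. Qed.

Lemma Apx_minus (S : C -> Prop) (f g : C -> C) : Cbounded S -> Apx S f -> Apx S g -> Apx S (fun s => f s - g s).
Proof.
move=> hS hf hg; apply: (Apx_ext _ (fun s => f s + - (1) * g s)) => [s _|]; first by ring.
by apply: Apx_plus => //; apply: Apx_scal.
Qed.

Lemma Apx_pow (S : C -> Prop) (f : C -> C) (n : nat) : Cbounded S -> Apx S f -> Apx S (fun s => f s ^ n).
Proof.
move=> hS hf; elim: n => [|n IH]; first exact: Apx_const.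
exact: Apx_mult.
Qed.

Lemma pow_diff (a b : C) (E : R) (n : nat) : (1 <= E)%R -> (Cmod a <= E)%R -> (Cmod b <= E)%R ->
  (Cmod (a ^ n - b ^ n) <= INR n * (E ^ n * Cmod (a - b)))%R.
Proof.
move=> hE ha hb.
have hd := Cmod_ge_0 (a - b).
elim: n => [|n IH].
  by have -> : a ^ 0 - b ^ 0 = 0 by [rewrite /=; ring]; rewrite Cmod_0 /=; lra.
have -> : a ^ n.+1 - b ^ n.+1 = a * (a ^ n - b ^ n) + (a - b) * b ^ n by rewrite /=; ring.
apply: Rle_trans (Cmod_triangle _ _) _; rewrite !Cmod_mult Cmod_pow S_INR.
have hp : (1 <= E ^ n)%R by apply: pow_R1_Rle.
have t1 : (Cmod a * Cmod (a ^ n - b ^ n) <= E * (INR n * (E ^ n * Cmod (a - b))))%R.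
  by apply: Rmult_le_compat => //; apply: Cmod_ge_0.
have t2 : (Cmod (a - b) * Cmod b ^ n <= Cmod (a - b) * E ^ n)%R.
  by apply: Rmult_le_compat_l => //; apply: pow_incr; split => //; apply: Cmod_ge_0.
rewrite -tech_pow_Rmult.
have t3 : (Cmod (a - b) * E ^ n <= E * E ^ n * Cmod (a - b))%R.
  have : (0 <= Cmod (a - b) * E ^ n)%R by apply: Rmult_le_pos => //; lra.
  nra.
have -> : ((INR n + 1) * (E * E ^ n * Cmod (a - b)) = E * (INR n * (E ^ n * Cmod (a - b))) + E * E ^ n * Cmod (a - b))%R by ring.
lra.
Qed.

Lemma exp_INR_mult (n : nat) (x : R) : exp (INR n * x) = (exp x ^ n)%R.
Proof.
elim: n => [|n IH]; first by rewrite Rmult_0_l exp_0.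
by rewrite S_INR Rmult_plus_distr_r exp_plus IH Rmult_1_l /= Rmult_comm.
Qed.

Lemma Cexp_pow_approx (w : C) (R0 : R) (n : nat) : (Cmod w <= R0)%R -> (0 < n)%nat -> (2 * R0 <= INR n)%R ->
  (Cmod (Cexp w - (1 + w / INR n) ^ n) <= 8 * R0 ^ 2 * exp R0 * / INR n)%R.
Proof.
move=> hw hn hR; have hp := INR_pos n hn; have hc := INR_neq0 n hn.
have hw0 := Cmod_ge_0 w.
have hm : (Cmod (w / INR n) <= R0 / INR n)%R.
  rewrite Cmod_div // Cmod_INR; apply: Rmult_le_compat_r => //.
  by apply/Rlt_le/Rinv_0_lt_compat.
have hm2 : (R0 / INR n <= 1 / 2)%R by apply/Rle_div_l; lra.
(* Once the exponential is an [n]-th power too, it suffices to compare the bases, which differ by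
   [O(1 / n^2)]. *)
have -> : Cexp w = Cexp (w / INR n) ^ n by rewrite -Cexp_nat; congr Cexp; field.
have hq := Cexp_quadratic (w / INR n) ltac:(lra).
have h0 : (0 <= R0 / INR n)%R by apply: Rdiv_le_0_compat => //; lra.
have := pow_diff (Cexp (w / INR n)) (1 + w / INR n) (exp (R0 / INR n)) n _ _ _.
move=> H; apply: Rle_trans (H _ _ _) _.
- by rewrite -exp_0; apply: exp_le.
- by apply: Rle_trans (Cmod_Cexp_le _) _; apply: exp_le.
- apply: Rle_trans (Cmod_triangle _ _) _; rewrite Cmod_1.
  by have := exp_ineq1_le (R0 / INR n); lra.
have -> : (exp (R0 / INR n) ^ n = exp R0)%R.
  rewrite -exp_INR_mult; congr exp; field; lra.
have hd : (Cmod (Cexp (w / INR n) - (1 + w / INR n)) <= 8 * (R0 / INR n) ^ 2)%R.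
  have -> : Cexp (w / INR n) - (1 + w / INR n) = Cexp (w / INR n) - 1 - w / INR n by ring.
  apply: Rle_trans hq _; apply: Rmult_le_compat_l; first lra.
  by apply: pow_incr; split => //; apply: Cmod_ge_0.
have he := exp_pos R0.
have t : (exp R0 * Cmod (Cexp (w / INR n) - (1 + w / INR n)) <= exp R0 * (8 * (R0 / INR n) ^ 2))%R.
  by apply: Rmult_le_compat_l => //; lra.
apply: Rle_trans (Rmult_le_compat_l _ _ _ (Rlt_le _ _ hp) t) _.
by apply: Req_le; field; lra.
Qed.

(** The powers of [1 + g / n] approximate the exponential uniformly where [g] is bounded, and only
    products lead from [g] to them. *)
Lemma Apx_exp (S : C -> Prop) (g : C -> C) : Cbounded S -> Apx S g -> Apx S (fun s => Cexp (g s)).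
Proof.
move=> hS hg; have [M [hM0 hM]] := Apx_bounded S g hS hg.
apply: Apx_lim => e he.
have hE := exp_pos M.
have [n [hn hnR]] := nat_above (2 * M + 8 * M ^ 2 * exp M / e)%R.
have hp := INR_pos n hn.
have hq : (0 <= 8 * M ^ 2 * exp M)%R by apply: Rmult_le_pos; nra.
have hq2 : (0 <= 8 * M ^ 2 * exp M / e)%R by apply: Rdiv_le_0_compat.
exists (fun s => (1 + / INR n * g s) ^ n); split.
  by apply: Apx_pow => //; apply: Apx_plus; [exact: Apx_const|exact: Apx_scal].
move=> s hs.
have -> : 1 + / INR n * g s = 1 + g s / INR n by rewrite /Cdiv; ring.
apply: Rle_trans (Cexp_pow_approx (g s) M n (hM s hs) hn ltac:(lra)) _.
apply: (proj2 (Rle_div_l _ _ (INR n) hp)).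
have : (8 * M ^ 2 * exp M / e <= INR n)%R by lra.
by move/(Rle_div_l _ _ e he) => h; lra.
Qed.

Lemma geom_approx (w : C) (q : R) (n : nat) : (Cmod w <= q)%R -> (q < 1)%R ->
  (Cmod (/ (1 - w) - sum_n (fun k => Cpow w k) n) <= q ^ n.+1 / (1 - q))%R.
Proof.
move=> hw hq; have h0 := Cmod_ge_0 w.
have hm : (1 - q <= Cmod (1 - w))%R by have := Cmod_rev 1 w; rewrite Cmod_1; lra.
have hne : 1 - w <> 0 by apply/Cmod_gt_0; lra.
have hs : forall k, sum_n (fun k => Cpow w k) k = (1 - w ^ k.+1) / (1 - w).
  elim=> [|k IH]; first by rewrite sum_O /=; field.
  by rewrite sum_Sn IH /plus /=; field.
have -> : / (1 - w) - sum_n (fun k => Cpow w k) n = w ^ n.+1 / (1 - w) by rewrite hs; field.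
rewrite Cmod_div // Cmod_pow; apply: Rmult_le_compat.
- by apply: pow_le.
- by apply/Rlt_le/Rinv_0_lt_compat; lra.
- by apply: pow_incr.
- by apply: Rinv_le_contravar; lra.
Qed.

Lemma Apx_sum (S : C -> Prop) (f : nat -> C -> C) (n : nat) : (forall k, Apx S (f k)) ->
  Apx S (fun s => sum_n (fun k => f k s) n).
Proof.
move=> h; elim: n => [|n IH].
  by apply: Apx_ext (h 0%nat) => s _; rewrite sum_O.
by apply: (Apx_ext _ (fun s => sum_n (fun k => f k s) n + f n.+1 s)) => [s _|]; [rewrite sum_Sn|apply: Apx_plus].
Qed.

Lemma Apx_inv1 (S : C -> Prop) (w : C -> C) (q : R) : Cbounded S -> Apx S w -> (0 <= q < 1)%R ->
  (forall s, S s -> (Cmod (w s) <= q)%R) -> Apx S (fun s => / (1 - w s)).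
Proof.
move=> hS hw hq hwq; apply: Apx_lim => e he.
have hl : is_lim_seq (fun n => q ^ n * (q / (1 - q)))%R 0.
  have -> : Finite 0 = Rbar_mult 0%R (q / (1 - q))%R by rewrite /= Rmult_0_l.
  by apply: is_lim_seq_scal_r; apply: is_lim_seq_geom; rewrite Rabs_pos_eq; lra.
move/is_lim_seq_spec: hl => hl; have [N hN] := hl (mkposreal e he).
have := hN N (le_n _); rewrite /= Rminus_0_r => hNe.
exists (fun s => sum_n (fun k => Cpow (w s) k) N); split.
  by apply: Apx_sum => k; apply: Apx_pow.
move=> s hs; apply: Rle_trans (geom_approx (w s) q N (hwq s hs) ltac:(lra)) _.
apply: Rle_trans (Rlt_le _ _ hNe); apply: Rle_trans (Rle_abs _).
by apply: Req_le; rewrite /=; field; lra.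
Qed.

(* [c] is a unit vector whose half-plane separates [p] from [S]; the geometric
   series is expanded about a point far away on the other side of [S]. *)
Lemma Apx_inv_dir (S : C -> Prop) (p c : C) (d : R) : Cbounded S -> (0 < d)%R -> Cmod c = 1 ->
  (forall s, S s -> (d <= Re (c * (p - s)))%R) -> Apx S (fun s => / (p - s)).
Proof.
move=> [B hB] hd hc hS.
pose M := (Rmax d (Cmod p + B))%R.
have hMd : (d <= M)%R by apply: Rmax_l.
have hM s : S s -> (Cmod (c * (p - s)) <= M)%R.
  move=> hs; rewrite Cmod_mult hc Rmult_1_l; apply: Rle_trans (Cmod_tri_sub _ _) _.
  by apply: Rle_trans (Rmax_r d (Cmod p + B)); have := hB s hs; lra.
(* With [t = c * (p - s)], the bounds [Re t >= d] and [Cmod t <= M] give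
   [Cmod (X - t)^2 <= X^2 - 2 X d + M^2], which for this [X] is [X^2 - M^2]. The ratio of the
   geometric series is thus at most [q < 1]. *)
pose X := (M ^ 2 / d)%R.
have hX : (0 < X)%R by apply: Rdiv_lt_0_compat => //; apply: pow_lt; lra.
have hXd : (X * d = M ^ 2)%R by rewrite /X; field; lra.
pose q := sqrt (1 - (M / X) ^ 2).
have hMX : (M / X <= 1)%R by apply/Rle_div_l => //; nra.
have hMX0 : (0 < M / X)%R by apply: Rdiv_lt_0_compat; lra.
have hsq : (0 <= 1 - (M / X) ^ 2 < 1)%R by nra.
have hq : (0 <= q < 1)%R.
  by split; [exact: sqrt_pos|rewrite -sqrt_1; apply: sqrt_lt_1; lra].
have hXc : RtoC X <> 0 by move/RtoC_inj; lra.
have hc0 : c <> 0 by apply/Cmod_gt_0; lra.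
have hSb : Cbounded S by exists B.
have hps s : S s -> c * (p - s) <> 0.
  by move=> hs h; have := hS s hs; rewrite h ReR; lra.
apply: (Apx_ext _ (fun s => c / X * / (1 - (1 - c * (p - s) / X)))) => [s hs|].
  have h1 := hps s hs; have h2 : p - s <> 0 by move=> h; apply: h1; rewrite h Cmult_0_r.
  have -> : 1 - (1 - c * (p - s) / X) = c * (p - s) / X by ring.
  by field.
apply: Apx_scal => //; apply: (Apx_inv1 _ _ q) => //.
  apply: Apx_minus => //; first exact: Apx_const.
  apply: (Apx_ext _ (fun s => (c / X) * (p - s))) => [s _|]; first by field.
  by apply: Apx_scal => //; apply: Apx_minus => //; [exact: Apx_const|exact: Apx_id].
move=> s hs; set t := c * (p - s).
have -> : 1 - t / X = (X - t) / X by field.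
rewrite Cmod_div // Cmod_R Rabs_pos_eq; last lra.
apply/Rle_div_l => //.
rewrite -(Rabs_pos_eq (Cmod (X - t))); last exact: Cmod_ge_0.
rewrite -(Rabs_pos_eq (q * X)); last by apply: Rmult_le_pos; lra.
apply: Rsqr_le_abs_0; rewrite /Rsqr.
have -> : (q * X * (q * X) = (q * q) * (X * X))%R by ring.
have -> : (q * q = 1 - (M / X) ^ 2)%R by apply: sqrt_sqrt; lra.
have -> : ((1 - (M / X) ^ 2) * (X * X) = X * X - M * M)%R by field; lra.
have e1 u : (Cmod u * Cmod u = Re u ^ 2 + Im u ^ 2)%R by rewrite -Cmod2_alt /= Rmult_1_r.
rewrite e1 ReB ImB ReR ImR.
have ht := hM s hs; have hr := hS s hs; rewrite -/t in ht hr.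
have : (Re t ^ 2 + Im t ^ 2 <= M * M)%R.
  by rewrite -e1; apply: Rmult_le_compat => //; apply: Cmod_ge_0.
have h9 := Rmult_le_compat_l X d (Re t) (Rlt_le _ _ hX) hr.
move: (Re t) (Im t) h9 => x y h9 h10; nra.
Qed.

Lemma Apx_pochhammer (S : C -> Prop) (g : C -> C) (n : nat) : Cbounded S -> Apx S g ->
  Apx S (fun s => pochhammer (g s) n).
Proof.
move=> hS hg; elim: n => [|n IH]; first by apply: Apx_ext (Apx_const S 1) => s _.
apply: (Apx_ext _ (fun s => pochhammer (g s) n * (g s + INR n))) => [s _|]; first by rewrite pochhammer_S.
by apply: Apx_mult => //; apply: Apx_plus => //; apply: Apx_const.
Qed.

Lemma Apx_rgamma (S : C -> Prop) (g : C -> C) : Cbounded S -> Apx S g -> Apx S (fun s => rgamma (g s)).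
Proof.
move=> hS hg; have [B [hB0 hB]] := Apx_bounded S g hS hg.
have [n0 [M [hn0 _ hM]]] := rgamma_unif B.
apply: Apx_lim => e he.
have [n1 [hn1 hn]] := nat_above (M / e).
pose n := maxn n0 n1; have hnp : (0 < n)%nat by rewrite /n; lia.
have hp := INR_pos n hnp.
exists (fun s => rgauss n (g s)); split.
  apply: (Apx_ext _ (fun s => / INR n`! * pochhammer (g s) n.+1 * Cexp (- ln (INR n) * g s))) => [s _|].
    rewrite /rgauss Cpower_pos // /Cdiv Cinv_mul -Cexp_opp.
    have -> : - (g s * ln (INR n)) = - ln (INR n) * g s by ring.
    ring.
  apply: Apx_mult => //; first by apply: Apx_scal => //; apply: Apx_pochhammer.
  by apply: Apx_exp => //; apply: Apx_scal.
move=> s hs; rewrite Cmod_sub_sym; apply: Rle_trans (hM (g s) n (hB s hs) ltac:(rewrite /n; lia)) _.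
apply/Rle_div_l => //; rewrite Rmult_comm; apply: (proj1 (Rle_div_l M (INR n) e he)).
by apply: Rle_trans hn _; apply: le_INR; rewrite /n; lia.
Qed.

(** The approximability of each [1 / (g s + j)] is a hypothesis of its own because it depends on how
    the set lies around the pole, and not only on the distance [tau]. *)
Lemma Apx_gamma (S : C -> Prop) (g : C -> C) (tau : R) : Cbounded S -> Apx S g -> (0 < tau)%R ->
  (forall s, S s -> forall j : nat, (tau <= Cmod (g s + INR j))%R) ->
  (forall j : nat, Apx S (fun s => / (g s + INR j))) -> Apx S (fun s => Cgamma (g s)).
Proof.
move=> hS hg ht hj hi; have [B [hB0 hB]] := Apx_bounded S g hS hg.
have [n0 [M [hn0 _ hM]]] := gamma_unif B tau ht.
apply: Apx_lim => e he.
have [n1 [hn1 hn]] := nat_above (M / e).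
pose n := maxn n0 n1; have hnp : (0 < n)%nat by rewrite /n; lia.
have hp := INR_pos n hnp.
exists (fun s => gauss n (g s)); split.
  apply: (Apx_ext _ (fun s => INR n`! * Cexp (ln (INR n) * g s) * / pochhammer (g s) n.+1)) => [s _|].
    by rewrite /gauss Cpower_pos // [ln _ * _]Cmult_comm.
  apply: Apx_mult => //; first by apply: Apx_scal => //; apply: Apx_exp => //; apply: Apx_scal.
  elim: n.+1 => [|k IH]; first by apply: Apx_ext (Apx_const S (/ 1)) => s _.
  apply: (Apx_ext _ (fun s => / pochhammer (g s) k * / (g s + INR k))) => [s _|].
    by rewrite pochhammer_S Cinv_mul.
  exact: Apx_mult.
move=> s hs; rewrite Cmod_sub_sym; apply: Rle_trans (hM (g s) n (hB s hs) (hj s hs) ltac:(rewrite /n; lia)) _.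
apply/Rle_div_l => //; rewrite Rmult_comm; apply: (proj1 (Rle_div_l M (INR n) e he)).
by apply: Rle_trans hn _; apply: le_INR; rewrite /n; lia.
Qed.

(** * Integrals along segments and Cauchy's formula on rectangles *)

Notation CRInt := (@is_RInt C_R_NormedModule).

Lemma CRInt_pair (f : R -> C) (a b : R) (l : C) :
  CRInt f a b l <-> (is_RInt (fun t => Re (f t)) a b (Re l) /\ is_RInt (fun t => Im (f t)) a b (Im l)).
Proof.
split=> [h|[h1 h2]].
  split; first exact: (is_RInt_fct_extend_fst f a b l h).
  exact: (is_RInt_fct_extend_snd f a b l h).
rewrite (surjective_pairing l).
exact: (is_RInt_fct_extend_pair (U := R_NormedModule) (V := R_NormedModule) f a b _ _ h1 h2).
Qed.

Lemma CRInt_unique (f : R -> C) (a b : R) (l m : C) : CRInt f a b l -> CRInt f a b m -> l = m.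
Proof.
move=> /CRInt_pair [h1 h2] /CRInt_pair [h3 h4]; apply: C_eq.
  by rewrite -(is_RInt_unique _ _ _ _ h1) -(is_RInt_unique _ _ _ _ h3).
by rewrite -(is_RInt_unique _ _ _ _ h2) -(is_RInt_unique _ _ _ _ h4).
Qed.

Lemma CRInt_ext (f g : R -> C) (a b : R) (l : C) :
  (forall t, (Rmin a b < t < Rmax a b)%R -> f t = g t) -> CRInt f a b l -> CRInt g a b l.
Proof. exact: is_RInt_ext. Qed.

Lemma CRInt_plus (f g : R -> C) (a b : R) (l m : C) :
  CRInt f a b l -> CRInt g a b m -> CRInt (fun t => f t + g t) a b (l + m).
Proof. by move=> h1 h2; apply: (is_RInt_plus _ _ _ _ _ _ h1 h2). Qed.

Lemma CRInt_scal (c : C) (f : R -> C) (a b : R) (l : C) :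
  CRInt f a b l -> CRInt (fun t => c * f t) a b (c * l).
Proof.
move=> /CRInt_pair [h1 h2]; apply/CRInt_pair; rewrite !ReM !ImM; split.
  by apply: is_RInt_minus; apply: is_RInt_scal.
by apply: is_RInt_plus; apply: is_RInt_scal.
Qed.

Lemma CRInt_norm (f : R -> C) (a b M : R) (l : C) : (a <= b)%R ->
  (forall t, (a <= t <= b)%R -> (Cmod (f t) <= M)%R) -> CRInt f a b l -> (Cmod l <= (b - a) * M)%R.
Proof.
move=> hab hf hl; rewrite Cmod_norm.
apply: (norm_RInt_le f (fun=> M) a b l _ hab _ hl) => [t ht|].
  by have := hf t ht; rewrite Cmod_norm.
exact: is_RInt_const.
Qed.

Definition cpath (g : R -> C) : Prop :=
  (forall t : R, continuous (fun u => Re (g u)) t) /\ (forall t : R, continuous (fun u => Im (g u)) t).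

Lemma cpath_plus (f g : R -> C) : cpath f -> cpath g -> cpath (fun t => f t + g t).
Proof. by move=> [f1 f2] [g1 g2]; split=> t; apply: (continuous_plus (V := R_NormedModule)). Qed.

Lemma cpath_mult (f g : R -> C) : cpath f -> cpath g -> cpath (fun t => f t * g t).
Proof.
move=> [f1 f2] [g1 g2]; split=> t.
  by apply: (continuous_minus (V := R_NormedModule)); apply: (continuous_mult (K := R_AbsRing)).
by apply: (continuous_plus (V := R_NormedModule)); apply: (continuous_mult (K := R_AbsRing)).
Qed.

Lemma cpath_const (c : C) : cpath (fun=> c).
Proof. by split=> t; apply: continuous_const. Qed.

Lemma cpath_poly (g : R -> C) (P : C -> C) : cpath g -> is_poly P -> cpath (fun t => P (g t)).
Proof.
move=> hg [l hl].
have H : cpath (fun t => horner l (g t)).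
  elim: l {hl} => [|c l IH]; first exact: cpath_const.
  by apply: cpath_plus; [exact: cpath_const|exact: cpath_mult].
by case: H => h1 h2; split=> t; [apply: continuous_ext (h1 t)|apply: continuous_ext (h2 t)] => u; rewrite hl.
Qed.

Lemma cpath_CRInt (f : R -> C) (a b : R) : cpath f -> exists l, CRInt f a b l.
Proof.
move=> [h1 h2].
have [x hx] := ex_RInt_continuous (V := R_CompleteNormedModule) (fun t => Re (f t)) a b (fun t _ => h1 t).
have [y hy] := ex_RInt_continuous (V := R_CompleteNormedModule) (fun t => Im (f t)) a b (fun t _ => h2 t).
by exists (x, y); apply/CRInt_pair.
Qed.

Lemma Apx_CRInt (S : C -> Prop) (f : C -> C) (g : R -> C) (a b : R) : (a <= b)%R ->
  Apx S f -> cpath g -> (forall t, (a <= t <= b)%R -> S (g t)) -> exists l, CRInt (fun t => f (g t)) a b l.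
Proof.
move=> hab hf hg hS.
have hP n : exists P, is_poly P /\ forall s, S s -> (Cmod (f s - P s) <= / (INR n + 1))%R.
  by apply: hf; apply: Rinv_0_lt_compat; have := pos_INR n; lra.
have [P hPn] := ClassicalEpsilon.choice (fun n P => is_poly P /\ forall s, S s -> (Cmod (f s - P s) <= / (INR n + 1))%R) hP.
have hI n : exists l, CRInt (fun t => P n (g t)) a b l.
  by apply: cpath_CRInt; apply: cpath_poly => //; case: (hPn n).
have [I hIn] := ClassicalEpsilon.choice _ hI.
(* The theorem on limits of integrals asks for uniform convergence on the whole line, hence the
   extension by 0 outside [[a, b]]. *)
pose cut (h : R -> C) (t : R) : C := if Rle_dec a t then (if Rle_dec t b then h t else 0) else 0.
have hcut h t : (Rmin a b < t < Rmax a b)%R -> h t = cut h t.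
  by rewrite Rmin_left // Rmax_right // /cut => ht; case: Rle_dec => h1; case: Rle_dec => h2 //; lra.
have [||l [_ hl]] := filterlim_RInt (V := C_R_CompleteNormedModule) (fun n => cut (fun t => P n (g t))) a b eventually _ (cut (fun t => f (g t))) I.
- by move=> n; apply: CRInt_ext (hIn n); exact: hcut.
- apply/filterlim_locally => e.
  have [N [hN0 hN]] := nat_above (/ e).
  exists N => n hn t; apply: (C_NormedModule_mixin_compat1 _ _ e); rewrite /minus /plus /opp /= -/(Cminus _ _).
  have he := cond_pos e.
  have hz : (Cmod (0 - 0) < e)%R by rewrite /Cminus Cplus_opp_r Cmod_0.
  rewrite /cut; case: Rle_dec => h1 //; case: Rle_dec => h2 //.
  rewrite Cmod_sub_sym; have [_ hb] := hPn n; apply: Rle_lt_trans (hb _ (hS t (conj h1 h2))) _.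
  have hi := Rinv_0_lt_compat _ he.
  have hNn : (INR N <= INR n)%R by apply: le_INR; lia.
  by rewrite -(Rinv_inv e); apply: Rinv_lt_contravar; [apply: Rmult_lt_0_compat; lra|lra].
by exists l; apply: CRInt_ext hl => t ht; rewrite -hcut.
Qed.

Definition rect_integral (f : C -> C) (x1 x2 y1 y2 : R) (v : C) : Prop :=
  exists lo ri up le,
  [/\ CRInt (fun u => f (u, y1)) x1 x2 lo, CRInt (fun y => f (x2, y)) y1 y2 ri,
      CRInt (fun u => f (u, y2)) x1 x2 up, CRInt (fun y => f (x1, y)) y1 y2 le &
      v = lo + Ci * ri - up - Ci * le].

Definition closed_rect (x1 x2 y1 y2 : R) (s : C) : Prop := (x1 <= Re s <= x2)%R /\ (y1 <= Im s <= y2)%R.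

Definition rect_side (x1 x2 y1 y2 : R) (s : C) : Prop :=
  closed_rect x1 x2 y1 y2 s /\ (Re s = x1 \/ Re s = x2 \/ Im s = y1 \/ Im s = y2).

Lemma closed_rect_bounded (x1 x2 y1 y2 : R) : Cbounded (closed_rect x1 x2 y1 y2).
Proof.
exists (Rabs x1 + Rabs x2 + Rabs y1 + Rabs y2)%R => s [h1 h2].
apply: Rle_trans (Cmod_le_ReIm _) _.
have a1 : (Rabs (Re s) <= Rabs x1 + Rabs x2)%R.
  by apply/Rabs_le_between; split_Rabs; lra.
have a2 : (Rabs (Im s) <= Rabs y1 + Rabs y2)%R.
  by apply/Rabs_le_between; split_Rabs; lra.
lra.
Qed.

Lemma cpath_h (y : R) : cpath (fun u => (u, y) : C).
Proof. by split=> t; [apply: continuous_id|apply: continuous_const]. Qed.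

Lemma cpath_v (x : R) : cpath (fun y => (x, y) : C).
Proof. by split=> t; [apply: continuous_const|apply: continuous_id]. Qed.

Lemma rect_integral_plus (f g : C -> C) (x1 x2 y1 y2 : R) (v w : C) :
  rect_integral f x1 x2 y1 y2 v -> rect_integral g x1 x2 y1 y2 w -> rect_integral (fun s => f s + g s) x1 x2 y1 y2 (v + w).
Proof.
move=> [a [b [c [d [h1 h2 h3 h4 ->]]]]] [a' [b' [c' [d' [k1 k2 k3 k4 ->]]]]].
exists (a + a'), (b + b'), (c + c'), (d + d'); split; try exact: CRInt_plus.
ring.
Qed.

Lemma rect_integral_scal (z : C) (f : C -> C) (x1 x2 y1 y2 : R) (v : C) :
  rect_integral f x1 x2 y1 y2 v -> rect_integral (fun s => z * f s) x1 x2 y1 y2 (z * v).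
Proof.
move=> [a [b [c [d [h1 h2 h3 h4 ->]]]]].
exists (z * a), (z * b), (z * c), (z * d); split; try exact: CRInt_scal.
ring.
Qed.

Lemma rect_integral_ext (f g : C -> C) (x1 x2 y1 y2 : R) (v : C) : (x1 <= x2)%R -> (y1 <= y2)%R ->
  (forall s, rect_side x1 x2 y1 y2 s -> f s = g s) -> rect_integral f x1 x2 y1 y2 v -> rect_integral g x1 x2 y1 y2 v.
Proof.
move=> hx hy h [a [b [c [d [h1 h2 h3 h4 ->]]]]].
exists a, b, c, d; split => //; [apply: CRInt_ext h1|apply: CRInt_ext h2|apply: CRInt_ext h3|apply: CRInt_ext h4] => t;
  rewrite Rmin_left // Rmax_right // => ht; apply: h; rewrite /rect_side /closed_rect !ReImE; (split; [lra|tauto]).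
Qed.

Lemma rect_integral_bound (f : C -> C) (x1 x2 y1 y2 M : R) (v : C) : (x1 <= x2)%R -> (y1 <= y2)%R ->
  (forall s, rect_side x1 x2 y1 y2 s -> (Cmod (f s) <= M)%R) -> rect_integral f x1 x2 y1 y2 v ->
  (Cmod v <= 2 * ((x2 - x1) + (y2 - y1)) * M)%R.
Proof.
move=> hx hy h [a [b [c [d [h1 h2 h3 h4 ->]]]]].
have H1 : (Cmod a <= (x2 - x1) * M)%R.
  by apply: CRInt_norm h1 => // t ht; apply: h; rewrite /rect_side /closed_rect !ReImE; (split; [lra|tauto]).
have H2 : (Cmod b <= (y2 - y1) * M)%R.
  by apply: CRInt_norm h2 => // t ht; apply: h; rewrite /rect_side /closed_rect !ReImE; (split; [lra|tauto]).
have H3 : (Cmod c <= (x2 - x1) * M)%R.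
  by apply: CRInt_norm h3 => // t ht; apply: h; rewrite /rect_side /closed_rect !ReImE; (split; [lra|tauto]).
have H4 : (Cmod d <= (y2 - y1) * M)%R.
  by apply: CRInt_norm h4 => // t ht; apply: h; rewrite /rect_side /closed_rect !ReImE; (split; [lra|tauto]).
have t1 := Cmod_tri_sub (a + Ci * b - c) (Ci * d).
have t2 := Cmod_tri_sub (a + Ci * b) c.
have t3 := Cmod_triangle a (Ci * b).
rewrite !(Cmod_mult Ci) Cmod_Ci in t1 t3; lra.
Qed.

Definition path_derive (F : R -> C) (t : R) (l : C) : Prop :=
  is_derive (fun u => Re (F u)) t (Re l) /\ is_derive (fun u => Im (F u)) t (Im l).

Lemma path_derive_mult (F G : R -> C) (t : R) (l m : C) :
  path_derive F t l -> path_derive G t m -> path_derive (fun u => F u * G u) t (l * G t + F t * m).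
Proof.
move=> [f1 f2] [g1 g2]; split.
  have -> : Re (l * G t + F t * m) = minus (plus (mult (Re l) (Re (G t))) (mult (Re (F t)) (Re m)))
      (plus (mult (Im l) (Im (G t))) (mult (Im (F t)) (Im m))).
    by rewrite !ReImE /minus /plus /opp /mult /=; ring.
  exact: (is_derive_minus _ _ _ _ _ (is_derive_mult _ _ _ _ _ f1 g1 Rmult_comm) (is_derive_mult _ _ _ _ _ f2 g2 Rmult_comm)).
have -> : Im (l * G t + F t * m) = plus (plus (mult (Re l) (Im (G t))) (mult (Re (F t)) (Im m)))
    (plus (mult (Im l) (Re (G t))) (mult (Im (F t)) (Re m))).
  by rewrite !ReImE /minus /plus /opp /mult /=; ring.
exact: (is_derive_plus _ _ _ _ _ (is_derive_mult _ _ _ _ _ f1 g2 Rmult_comm) (is_derive_mult _ _ _ _ _ f2 g1 Rmult_comm)).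
Qed.

Lemma path_derive_affine (z d : C) (t : R) : path_derive (fun u => z + u * d) t d.
Proof.
by split; rewrite /Re /Im /=; auto_derive => //; rewrite /Re /Im /=; ring.
Qed.

Lemma path_derive_pow (z d : C) (n : nat) (t : R) :
  path_derive (fun u => (z + u * d) ^ n.+1) t (INR n.+1 * (z + t * d) ^ n * d).
Proof.
elim: n => [|n IH].
  have := path_derive_affine z d t; rewrite /path_derive.
  have -> : INR 1 * (z + t * d) ^ 0 * d = d by rewrite /=; ring.
  have e u : (z + u * d) ^ 1 = z + u * d by exact: Cmult_1_r.
  by move=> [h1 h2]; split; [apply: is_derive_ext h1|apply: is_derive_ext h2] => u; rewrite e.
have := path_derive_mult _ _ _ _ _ (path_derive_affine z d t) IH.
have -> // : d * (z + t * d) ^ n.+1 + (z + t * d) * (INR n.+1 * (z + t * d) ^ n * d) = INR n.+2 * (z + t * d) ^ n.+1 * d.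
by rewrite (S_INR n.+1) RtoC_plus [(z + t * d) ^ n.+1]/=; ring.
Qed.

Lemma cpath_affine (z d : C) : cpath (fun u => z + u * d).
Proof.
split=> t; apply: ex_derive_continuous.
  by have [h _] := path_derive_affine z d t; exists (Re d).
by have [_ h] := path_derive_affine z d t; exists (Im d).
Qed.

Lemma path_derive_CRInt (F f : R -> C) (a b : R) : (forall t, path_derive F t (f t)) -> cpath f ->
  CRInt f a b (F b - F a).
Proof.
move=> hF [h1 h2]; apply/CRInt_pair; rewrite ReB ImB; split.
  apply: (is_RInt_derive (V := R_CompleteNormedModule) (fun t => Re (F t))) => t _; last exact: h1.
  by case: (hF t).
apply: (is_RInt_derive (V := R_CompleteNormedModule) (fun t => Im (F t))) => t _; last exact: h2.
by case: (hF t).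
Qed.

Lemma pow_CRInt (z d : C) (n : nat) (a b : R) :
  CRInt (fun u => (z + u * d) ^ n * d) a b ((z + b * d) ^ n.+1 / INR n.+1 - (z + a * d) ^ n.+1 / INR n.+1).
Proof.
have hn := INR_neq0 n.+1 isT.
have hp : cpath (fun u => INR n.+1 * (z + u * d) ^ n * d).
  apply: cpath_mult; last exact: cpath_const.
  apply: cpath_mult; first exact: cpath_const.
  elim: n {hn} => [|n IH]; first exact: cpath_const.
  exact: cpath_mult (cpath_affine z d) IH.
have H := CRInt_scal (/ INR n.+1) _ _ _ _ (path_derive_CRInt _ _ a b (path_derive_pow z d n) hp).
have -> : (z + b * d) ^ n.+1 / INR n.+1 - (z + a * d) ^ n.+1 / INR n.+1 =
  / INR n.+1 * ((z + b * d) ^ n.+1 - (z + a * d) ^ n.+1) by rewrite /Cdiv; ring.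
by apply: CRInt_ext H => t _; field.
Qed.

Lemma poly_primitive (P : C -> C) : is_poly P -> exists Q : C -> C,
  forall (z d : C) (a b : R), CRInt (fun u => P (z + u * d) * d) a b (Q (z + b * d) - Q (z + a * d)).
Proof.
move=> [l hl].
(* The induction on the coefficients needs a running power of the variable in front; its exponent,
   here 0, is generalised together with the list. *)
suff [Q hQ] : exists Q : C -> C, forall (z d : C) (a b : R),
    CRInt (fun u => (z + u * d) ^ 0 * horner l (z + u * d) * d) a b (Q (z + b * d) - Q (z + a * d)).
  by exists Q => z d a b; apply: CRInt_ext (hQ z d a b) => t _; rewrite hl Cmult_1_l.
elim: l 0%nat {hl} => [|c l IH] n.
  exists (fun=> 0) => z d a b; have := CRInt_scal 0 _ _ _ _ (pow_CRInt z d n a b).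
  rewrite Cmult_0_l; have -> : 0 - 0 = 0 :> C by ring.
  by apply: CRInt_ext => t _ /=; ring.
have [Q hQ] := IH n.+1.
exists (fun s => c * (s ^ n.+1 / INR n.+1) + Q s) => z d a b.
have H := CRInt_plus _ _ _ _ _ _ (CRInt_scal c _ _ _ _ (pow_CRInt z d n a b)) (hQ z d a b).
set L := (X in CRInt _ _ _ X) in H; set L' := (X in CRInt _ _ _ X).
have -> : L' = L by rewrite /L /L'; ring.
by apply: CRInt_ext H => t _ /=; ring.
Qed.

Lemma poly_rect (P : C -> C) (x1 x2 y1 y2 : R) : is_poly P -> rect_integral P x1 x2 y1 y2 0.
Proof.
move=> /poly_primitive [Q hQ].
have hH y : CRInt (fun u => P (u, y)) x1 x2 (Q (x2, y) - Q (x1, y)).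
  have e (u : R) : ((0, y)%R : C) + u * 1 = (u, y) by apply: C_eq; rewrite !ReImE; ring.
  have := hQ (0%R, y) 1 x1 x2; rewrite !e; apply: CRInt_ext => t _.
  by rewrite e Cmult_1_r.
have hV x : CRInt (fun y => P (x, y)) y1 y2 (- Ci * (Q (x, y2) - Q (x, y1))).
  have e (u : R) : ((x, 0)%R : C) + u * Ci = (x, u) by apply: C_eq; rewrite !ReImE; ring.
  have := CRInt_scal (- Ci) _ _ _ _ (hQ (x, 0%R) Ci y1 y2); rewrite !e; apply: CRInt_ext => t _.
  rewrite e; have -> : - Ci * (P (x, t) * Ci) = - (Ci * Ci) * P (x, t) by ring.
  have -> : Ci * Ci = - (1) by apply: C_eq; rewrite !ReImE; ring.
  ring.
exists (Q (x2, y1) - Q (x1, y1)), (- Ci * (Q (x2, y2) - Q (x2, y1))), (Q (x2, y2) - Q (x1, y2)), (- Ci * (Q (x1, y2) - Q (x1, y1))).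
split => //.
have e w : Ci * (- Ci * w) = w.
  have -> : Ci * (- Ci * w) = - (Ci * Ci) * w by ring.
  have -> : Ci * Ci = - (1) by apply: C_eq; rewrite !ReImE; ring.
  ring.
rewrite !e; ring.
Qed.

Lemma atan_inv_sum (x : R) : (0 < x)%R -> (atan x + atan (/ x) = PI / 2)%R.
Proof. by move=> hx; rewrite atan_inv //; ring. Qed.

(** The primitive is the logarithm in real form: as [c] is nonzero, the line avoids 0 and
    [- atan ((u - p) / c)] is, up to a constant, a continuous choice of the argument. *)
Lemma inv_h_CRInt (p c a b : R) : c <> 0%R ->
  CRInt (fun u => / ((u - p)%R, c)) a b
    ((ln ((b - p) ^ 2 + c ^ 2) / 2 - ln ((a - p) ^ 2 + c ^ 2) / 2)%R, (- atan ((b - p) / c) - - atan ((a - p) / c))%R).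
Proof.
move=> hc.
have hpos u : (0 < (u - p) ^ 2 + c ^ 2)%R by have := pow2_gt_0 c hc; have := pow2_ge_0 (u - p); lra.
have hd t : path_derive (fun u => ((ln ((u - p) ^ 2 + c ^ 2) / 2)%R, (- atan ((u - p) / c))%R)) t (/ ((t - p)%R, c)).
  split; rewrite /Re /Im /=; have := hpos t => /= ht; auto_derive.
  - by have := hpos t; rewrite /= !Rmult_1_r; lra.
  - by field; move: ht; rewrite !Rmult_1_r; lra.
  - by [].
  - field; do !split => //; move: ht; rewrite !Rmult_1_r; nra.
apply: (path_derive_CRInt (fun u => ((ln ((u - p) ^ 2 + c ^ 2) / 2)%R, (- atan ((u - p) / c))%R)) _ a b hd).
split=> t; rewrite /Re /Im /=; apply: ex_derive_continuous; auto_derive; have := hpos t; rewrite /= !Rmult_1_r; lra.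
Qed.

Lemma inv_v_CRInt (p c a b : R) : c <> 0%R ->
  CRInt (fun u => / (c, (u - p)%R)) a b
    ((atan ((b - p) / c) - atan ((a - p) / c))%R, (- (ln ((b - p) ^ 2 + c ^ 2) / 2) - - (ln ((a - p) ^ 2 + c ^ 2) / 2))%R).
Proof.
move=> hc.
have hpos u : (0 < (u - p) ^ 2 + c ^ 2)%R by have := pow2_gt_0 c hc; have := pow2_ge_0 (u - p); lra.
have hd t : path_derive (fun u => (atan ((u - p) / c), (- (ln ((u - p) ^ 2 + c ^ 2) / 2))%R)) t (/ (c, (t - p)%R)).
  split; rewrite /Re /Im /=; have := hpos t => /= ht; auto_derive.
  - by [].
  - field; do !split => //; move: ht; rewrite !Rmult_1_r; nra.
  - by have := hpos t; rewrite /= !Rmult_1_r; lra.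
  - by field; move: ht; rewrite !Rmult_1_r; lra.
apply: (path_derive_CRInt (fun u => (atan ((u - p) / c), (- (ln ((u - p) ^ 2 + c ^ 2) / 2))%R)) _ a b hd).
split=> t; rewrite /Re /Im /=; apply: ex_derive_continuous; auto_derive; have := hpos t; rewrite /= !Rmult_1_r; lra.
Qed.

(** The logarithms at the four corners cancel. At each corner two arctangents of inverse quotients
    add up to a quarter turn, and the four quarter turns make [2 * PI]. *)
Lemma inv_rect (p : C) (x1 x2 y1 y2 : R) : (x1 < Re p < x2)%R -> (y1 < Im p < y2)%R ->
  rect_integral (fun s => / (s - p)) x1 x2 y1 y2 (2 * PI * Ci).
Proof.
case: p => px py; rewrite !ReImE => hx hy.
set a := (x1 - px)%R; set b := (x2 - px)%R; set c := (y1 - py)%R; set d := (y2 - py)%R.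
have [ha hb hc hd] : [/\ (a < 0)%R, (0 < b)%R, (c < 0)%R & (0 < d)%R] by rewrite /a /b /c /d; split; lra.
have E1 (u y : R) : (u, y) - (px, py) = ((u - px)%R, (y - py)%R) :> C by apply: C_eq; rewrite !ReImE.
have ext g h u v l : (forall t, g t = h t) -> CRInt g u v l -> CRInt h u v l.
  by move=> e; apply: CRInt_ext => t _; exact: e.
have hne u : (u < 0 \/ 0 < u)%R -> u <> 0%R by lra.
have I1 := ext _ (fun u => / ((u, y1) - (px, py))) _ _ _ (fun t => f_equal Cinv (esym (E1 t y1))) (inv_h_CRInt px c x1 x2 (hne _ (or_introl hc))).
have I2 := ext _ (fun y => / ((x2, y) - (px, py))) _ _ _ (fun t => f_equal Cinv (esym (E1 x2 t))) (inv_v_CRInt py b y1 y2 (hne _ (or_intror hb))).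
have I3 := ext _ (fun u => / ((u, y2) - (px, py))) _ _ _ (fun t => f_equal Cinv (esym (E1 t y2))) (inv_h_CRInt px d x1 x2 (hne _ (or_intror hd))).
have I4 := ext _ (fun y => / ((x1, y) - (px, py))) _ _ _ (fun t => f_equal Cinv (esym (E1 x1 t))) (inv_v_CRInt py a y1 y2 (hne _ (or_introl ha))).
eexists; eexists; eexists; eexists; split; [exact: I1|exact: I2|exact: I3|exact: I4|].
rewrite -/a -/b -/c -/d.
have at_inv u v : (0 < u / v)%R -> u <> 0%R -> v <> 0%R -> (atan (u / v) + atan (v / u) = PI / 2)%R.
  by move=> h h1 h2; rewrite -(atan_inv_sum _ h); congr (_ + atan _)%R; field.
have at_opp u v : (atan (- u / v) = - atan (u / v))%R by rewrite -atan_opp; congr atan; rewrite /Rdiv; ring.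
have at_opp2 u v : v <> 0%R -> (atan (u / - v) = - atan (u / v))%R.
  by move=> h; rewrite -atan_opp; congr atan; field; lra.
have A1 : (atan (d / b) + atan (b / d) = PI / 2)%R by apply: at_inv; [apply: Rdiv_lt_0_compat|lra|lra].
have A2 : (atan (b / c) + atan (c / b) = - (PI / 2))%R.
  have := at_inv b (- c)%R ltac:(apply: Rdiv_lt_0_compat; lra) ltac:(lra) ltac:(lra).
  by rewrite at_opp at_opp2; lra.
have A3 : (atan (a / c) + atan (c / a) = PI / 2)%R.
  have := at_inv (- a)%R (- c)%R ltac:(apply: Rdiv_lt_0_compat; lra) ltac:(lra) ltac:(lra).
  by rewrite !at_opp !at_opp2; lra.
have A4 : (atan (a / d) + atan (d / a) = - (PI / 2))%R.
  have := at_inv (- a)%R d ltac:(apply: Rdiv_lt_0_compat; lra) ltac:(lra) ltac:(lra).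
  by rewrite at_opp at_opp2; lra.
have E2 u v : (u ^ 2 + v ^ 2 = v ^ 2 + u ^ 2)%R by ring.
rewrite (E2 d b) (E2 c b) (E2 d a) (E2 c a).
apply: C_eq; rewrite !ReImE; lra.
Qed.

Lemma side_crect (x1 x2 y1 y2 : R) (s : C) : rect_side x1 x2 y1 y2 s -> closed_rect x1 x2 y1 y2 s.
Proof. by case. Qed.

Lemma Cmod_small_eq0 (v : C) (K : R) : (forall e, (0 < e)%R -> (Cmod v <= K * e)%R) -> v = 0.
Proof.
move=> h; apply: Cmod_eq_0; apply: Rle_antisym; last exact: Cmod_ge_0.
apply: Rnot_lt_le => hlt.
have hK : (0 < Rabs K + 1)%R by have := Rabs_pos K; lra.
have := h (Cmod v / (2 * (Rabs K + 1)))%R ltac:(apply: Rdiv_lt_0_compat; lra).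
have e : ((Rabs K + 1) * (Cmod v / (2 * (Rabs K + 1))) = Cmod v / 2)%R by field; lra.
have he : (0 < Cmod v / (2 * (Rabs K + 1)))%R by apply: Rdiv_lt_0_compat; lra.
by have := Rle_abs K; nra.
Qed.

Lemma poly_remainder (P : C -> C) (p : C) : is_poly P -> exists Q, is_poly Q /\ forall s, P s = P p + (s - p) * Q s.
Proof.
move=> [l hl].
suff [Q [hQ h]] : exists Q, is_poly Q /\ forall s, horner l s = horner l p + (s - p) * Q s.
  by exists Q; split => // s; rewrite !hl.
elim: l {hl} => [|c l [Q [hQ IH]]].
  by exists (fun=> 0); split; [exact: is_poly_const|move=> s /=; ring].
exists (fun s => horner l p + s * Q s); split.
  by apply: is_poly_plus; [exact: is_poly_const|exact: is_poly_shift].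
by move=> s /=; rewrite IH; ring.
Qed.

(** Replacing [f] by a polynomial [P] changes the integral and the value at [p] by [O(e)], because
    the sides stay at distance [d] from [p]. For [P] itself, division by [s - p] leaves the constant
    [P p] over [s - p] plus a polynomial. *)
Lemma cauchy_formula (f : C -> C) (p : C) (x1 x2 y1 y2 : R) (v : C) :
  (x1 < Re p < x2)%R -> (y1 < Im p < y2)%R ->
  Apx (closed_rect x1 x2 y1 y2) f -> rect_integral (fun s => f s / (s - p)) x1 x2 y1 y2 v ->
  v = 2 * PI * Ci * f p.
Proof.
move=> hx hy hf hv.
have hx' : (x1 <= x2)%R by lra.
have hy' : (y1 <= y2)%R by lra.
pose d := Rmin (Rmin (Re p - x1) (x2 - Re p)) (Rmin (Im p - y1) (y2 - Im p)).
have [hd0 hd1 hd2 hd3 hd4] : [/\ (0 < d)%R, (d <= Re p - x1)%R, (d <= x2 - Re p)%R, (d <= Im p - y1)%R & (d <= y2 - Im p)%R].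
  rewrite /d; split; first by apply: Rmin_pos; apply: Rmin_pos; lra.
  - by apply: Rle_trans (Rmin_l _ _) (Rmin_l _ _).
  - by apply: Rle_trans (Rmin_l _ _) (Rmin_r _ _).
  - by apply: Rle_trans (Rmin_r _ _) (Rmin_l _ _).
  - by apply: Rle_trans (Rmin_r _ _) (Rmin_r _ _).
have hdist s : rect_side x1 x2 y1 y2 s -> (d <= Cmod (s - p))%R.
  move=> [_ hs]; have h1 := Re_bnd (s - p); have h2 := Im_bnd (s - p).
  by rewrite ReB in h1; rewrite ImB in h2; case: hs => [|[|[|]]] e; rewrite e in h1 h2; lra.
suff : v - 2 * PI * Ci * f p = 0 by move=> h; rewrite -(Cplus_0_l (2 * PI * Ci * f p)) -h; ring.
apply: (Cmod_small_eq0 _ (2 * ((x2 - x1) + (y2 - y1)) * / d + 2 * PI)) => e he.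
have [P [hP hfP]] := hf e he.
have [Q [hQ hPQ]] := poly_remainder P p hP.
have h1 := rect_integral_plus _ _ _ _ _ _ _ _ (rect_integral_scal (P p) _ _ _ _ _ _ (inv_rect p x1 x2 y1 y2 hx hy)) (poly_rect Q x1 x2 y1 y2 hQ).
have h := rect_integral_plus _ _ _ _ _ _ _ _ hv (rect_integral_scal (- (1)) _ _ _ _ _ _ h1).
have hb : (Cmod (v + - (1) * (P p * (2 * PI * Ci) + 0)) <= 2 * ((x2 - x1) + (y2 - y1)) * (e * / d))%R.
  apply: rect_integral_bound h => // s hs.
  have hsp := hdist s hs.
  have hne : s - p <> 0 by apply/Cmod_gt_0; lra.
  have -> : f s / (s - p) + - (1) * (P p * / (s - p) + Q s) = (f s - P s) * / (s - p) by rewrite (hPQ s); field.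
  rewrite Cmod_mult Cmod_inv //; apply: Rmult_le_compat; try exact: Cmod_ge_0.
  - by apply/Rlt_le/Rinv_0_lt_compat; lra.
  - by apply: hfP; apply: side_crect.
  - exact: Rinv_le_contravar.
have -> : v - 2 * PI * Ci * f p = (v + - (1) * (P p * (2 * PI * Ci) + 0)) + (2 * PI * Ci) * (P p - f p) by ring.
apply: Rle_trans (Cmod_triangle _ _) _.
have hp : (Cmod (P p - f p) <= e)%R by rewrite Cmod_sub_sym; apply: hfP; split; lra.
have hPI := PI_RGT_0.
have : (Cmod (2 * PI * Ci * (P p - f p)) <= 2 * PI * e)%R.
  rewrite !Cmod_mult Cmod_Ci !Cmod_R !Rabs_pos_eq; try lra.
  by rewrite Rmult_1_r; apply: Rmult_le_compat_l => //; lra.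
lra.
Qed.

(** * Loop integrals *)

Definition tail_int (g : R -> C) (a : R) (l : C) : Prop :=
  is_RInt_gen (V := C_R_NormedModule) g (at_point a) (Rbar_locally p_infty) l.

Lemma tail_spec (g : R -> C) (a : R) (l : C) :
  tail_int g a l <->
  forall e, (0 < e)%R -> exists M, forall b, (M < b)%R -> exists y, CRInt g a b y /\ (Cmod (y - l) < e)%R.
Proof.
split=> [h e he|h].
  have he2 : (0 < e / 2)%R by lra.
  have := h _ (locally_ball (T := C_UniformSpace) l (mkposreal _ he2)); case=> Q R hQ [M hM] hQR.
  exists M => b hb; have [y [hy hy2]] := hQR a b hQ (hM b hb).
  exists y; split => //.
  have := C_NormedModule_mixin_compat2 l y (mkposreal _ he2) hy2; rewrite /= => h3.
  apply: Rlt_le_trans h3 _.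
  suff : (sqrt 2 <= 2)%R by nra.
  by rewrite -{2}(sqrt_square 2); [apply: sqrt_le_1_alt; lra|lra].
move=> P [e hP]; have [M hM] := h e (cond_pos e).
apply: (Filter_prod _ _ _ (fun x => x = a) (fun b => (M < b)%R)) => //.
  by exists M.
move=> x b -> hb; have [y [h1 h2]] := hM b hb.
exists y; split => //; apply: hP; exact: (C_NormedModule_mixin_compat1 l y e h2).
Qed.

Lemma tail_unique (g : R -> C) (a : R) (l m : C) : tail_int g a l -> tail_int g a m -> l = m.
Proof.
move=> /tail_spec hl /tail_spec hm.
suff : l - m = 0 by move=> h; rewrite -(Cplus_0_l m) -h; ring.
apply: (Cmod_small_eq0 _ 2) => e he.
have [M1 h1] := hl e he; have [M2 h2] := hm e he.
pose b := (Rmax M1 M2 + 1)%R.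
have [y [hy1 hy2]] := h1 b ltac:(rewrite /b; have := Rmax_l M1 M2; lra).
have [z [hz1 hz2]] := h2 b ltac:(rewrite /b; have := Rmax_r M1 M2; lra).
rewrite -(CRInt_unique _ _ _ _ _ hy1 hz1) in hz2.
have -> : l - m = - (y - l) + (y - m) by ring.
by apply: Rle_trans (Cmod_triangle _ _) _; rewrite Cmod_opp; lra.
Qed.

Lemma tail_ext (f g : R -> C) (a : R) (l : C) : (forall u, (a <= u)%R -> f u = g u) -> tail_int f a l -> tail_int g a l.
Proof.
move=> h /tail_spec hf; apply/tail_spec => e he; have [M hM] := hf e he.
exists (Rmax M a) => b hb.
have [y [h1 h2]] := hM b ltac:(have := Rmax_l M a; lra).
exists y; split => //; apply: CRInt_ext h1 => t ht; apply: h.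
by have := Rmax_r M a => h3; rewrite Rmin_left in ht; lra.
Qed.

Lemma tail_plus (f g : R -> C) (a : R) (l m : C) :
  tail_int f a l -> tail_int g a m -> tail_int (fun u => f u + g u) a (l + m).
Proof. by move=> h1 h2; apply: (is_RInt_gen_plus (V := C_R_NormedModule) _ _ _ _ h1 h2). Qed.

Lemma tail_scal (c : C) (f : R -> C) (a : R) (l : C) :
  tail_int f a l -> tail_int (fun u => c * f u) a (c * l).
Proof.
move=> /tail_spec hf; apply/tail_spec => e he.
have hc := Cmod_ge_0 c.
have [M hM] := hf (e / (Cmod c + 1))%R ltac:(apply: Rdiv_lt_0_compat; lra).
exists M => b hb; have [y [h1 h2]] := hM b hb.
exists (c * y); split; first exact: CRInt_scal.
have -> : c * y - c * l = c * (y - l) by ring.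
rewrite Cmod_mult; have h3 := Cmod_ge_0 (y - l).
have : ((Cmod c + 1) * (e / (Cmod c + 1)) = e)%R by field; lra.
nra.
Qed.

Lemma exp_RInt (K a b : R) : is_RInt (fun u => K * exp (- u))%R a b (K * (exp (- a) - exp (- b)))%R.
Proof.
have -> : (K * (exp (- a) - exp (- b)) = minus (- K * exp (- b)) (- K * exp (- a)))%R.
  by rewrite /minus /plus /opp /=; ring.
apply: (is_RInt_derive (V := R_CompleteNormedModule) (fun u => - K * exp (- u))%R) => t _.
  by auto_derive => //; ring.
by apply: ex_derive_continuous; auto_derive.
Qed.

Lemma CRInt_exp_bound (g : R -> C) (a b K : R) (l : C) : (a <= b)%R ->
  (forall u, (a <= u <= b)%R -> (Cmod (g u) <= K * exp (- u))%R) -> CRInt g a b l -> (0 <= K)%R ->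
  (Cmod l <= K * exp (- a))%R.
Proof.
move=> hab hg hl hK.
have hn u : (a <= u <= b)%R -> (norm (g u : C_R_NormedModule) <= K * exp (- u))%R by rewrite -Cmod_norm; apply: hg.
have := norm_RInt_le g _ a b l _ hab hn hl (exp_RInt K a b); rewrite -Cmod_norm => H.
apply: Rle_trans H _.
by have := exp_pos (- b); nra.
Qed.

Lemma tail_bound (g : R -> C) (a K : R) (l : C) : (0 <= K)%R ->
  (forall u, (a <= u)%R -> (Cmod (g u) <= K * exp (- u))%R) -> tail_int g a l -> (Cmod l <= K * exp (- a))%R.
Proof.
move=> hK hg /tail_spec hl; apply: Rnot_lt_le => hlt.
have [M hM] := hl (Cmod l - K * exp (- a))%R ltac:(lra).
pose b := (Rmax M a + 1)%R.
have hba : (a <= b)%R by rewrite /b; have := Rmax_r M a; lra.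
have [y [h1 h2]] := hM b ltac:(rewrite /b; have := Rmax_l M a; lra).
have := CRInt_exp_bound g a b K y hba (fun u hu => hg u (proj1 hu)) h1 hK.
by have := Cmod_rev l y; rewrite Cmod_sub_sym; lra.
Qed.

Lemma exp_small (K e : R) : (0 <= K)%R -> (0 < e)%R -> exists M, forall b, (M <= b)%R -> (K * exp (- b) < e)%R.
Proof.
move=> hK he; exists (K / e)%R => b hb.
have h0 : (0 <= K / e)%R by apply: Rdiv_le_0_compat.
have h1 : (K < e * exp b)%R.
  have h2 := exp_ineq1_le b; have : (K = e * (K / e))%R by field; lra.
  by move=> h3; rewrite h3; apply: Rmult_lt_compat_l => //; lra.
rewrite exp_Ropp; have h3 := exp_pos b.
by apply: (proj2 (Rlt_div_l K e (exp b) h3)).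
Qed.

(** The integrals up to [a + n] form a Cauchy sequence by the exponential bound, and the integrals
    up to other endpoints are compared with them. *)
Lemma tail_exists (g : R -> C) (a K : R) : (0 <= K)%R ->
  (forall b, (a <= b)%R -> exists y, CRInt g a b y) ->
  (forall u, (a <= u)%R -> (Cmod (g u) <= K * exp (- u))%R) -> exists l, tail_int g a l.
Proof.
move=> hK hI hg.
have hIn (n : nat) : exists y, CRInt g a (a + INR n) y by apply: hI; have := pos_INR n; lra.
have [I hIi] := ClassicalEpsilon.choice _ hIn.
have hdiff b c y z : (a <= b)%R -> (b <= c)%R -> CRInt g a b y -> CRInt g a c z -> (Cmod (z - y) <= K * exp (- b))%R.
  move=> h1 h2 hy hz.
  have hbc : CRInt g b c (z - y).
    have e : z - y = plus (opp y : C_R_NormedModule) z by exact: (Cplus_comm z (- y)).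
    by rewrite e; apply: (is_RInt_Chasles (V := C_R_NormedModule) g b a c) => //; exact: (is_RInt_swap (V := C_R_NormedModule)).
  by apply: CRInt_exp_bound hbc hK => // u hu; apply: hg; lra.
have [l hl] : exists l, Clim I l.
  apply: Ccauchy => e he.
  have [M hM] := exp_small K e hK he.
  have [N [_ hN]] := nat_above (M - a).
  exists N => n m hn hm.
  wlog hnm : n m hn hm / (n <= m)%nat.
    move=> H; case: (leqP n m) => h; first exact: H.
    by rewrite Cmod_sub_sym; apply: H => //; apply: ltnW.
  rewrite Cmod_sub_sym.
  have h1 : (INR N <= INR n)%R by apply: le_INR; lia.
  have h2 : (INR n <= INR m)%R by apply: le_INR; lia.
  have h3 := pos_INR n.
  by apply: Rle_lt_trans (hdiff _ _ _ _ _ _ (hIi n) (hIi m)) (hM _ _); lra.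
exists l; apply/tail_spec => e he.
have [M hM] := exp_small K (e / 2) hK ltac:(lra).
have [N hN] := hl (e / 2)%R ltac:(lra).
have [n0 [_ hn0]] := nat_above (M - a).
pose n := maxn n0 N.
have h1 : (INR n0 <= INR n)%R by apply: le_INR; rewrite /n; lia.
have h3 := pos_INR n.
exists (a + INR n)%R => b hb.
have [y hy] := hI b ltac:(lra).
exists y; split => //.
have -> : y - l = (y - I n) + (I n - l) by ring.
apply: Rle_lt_trans (Cmod_triangle _ _) _.
have := hN n ltac:(rewrite /n; lia).
have := hdiff (a + INR n)%R b (I n) y ltac:(lra) ltac:(lra) (hIi n) hy.
by have := hM (a + INR n)%R ltac:(lra); lra.
Qed.

Lemma tail_seq (g : R -> C) (a : R) (l : C) (x : nat -> R) (I : nat -> C) :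
  tail_int g a l -> (forall n, (x 0%nat + INR n <= x n)%R) -> (forall n, CRInt g a (x n) (I n)) -> Clim I l.
Proof.
move=> /tail_spec hl hx hI e he.
have [M hM] := hl e he; have [N [_ hN]] := nat_above (M - x 0%nat + 1).
exists N => n hn; have hxn := hx n.
have h1 : (INR N <= INR n)%R by apply: le_INR; lia.
have [y [h2 h3]] := hM (x n) ltac:(lra).
by rewrite (CRInt_unique _ _ _ _ _ (hI n) h2).
Qed.

Definition loop_pt (sigma T : R) (s : C) : Prop :=
  (sigma <= Re s)%R /\ (Im s = T \/ Im s = (- T)%R \/ (Re s = sigma /\ (- T <= Im s <= T)%R)).

Lemma loop_plus (f g : C -> C) (sigma T : R) (v w : C) :
  is_loop_integral f sigma T v -> is_loop_integral g sigma T w -> is_loop_integral (fun s => f s + g s) sigma T (v + w).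
Proof.
move=> [a [b [c [h1 h2 h3 ->]]]] [a' [b' [c' [k1 k2 k3 ->]]]].
exists (a + a'), (b + b'), (c + c'); split; [exact: tail_plus|exact: CRInt_plus|exact: tail_plus|ring].
Qed.

Lemma loop_scal (z : C) (f : C -> C) (sigma T : R) (v : C) :
  is_loop_integral f sigma T v -> is_loop_integral (fun s => z * f s) sigma T (z * v).
Proof.
move=> [a [b [c [h1 h2 h3 ->]]]].
exists (z * a), (z * b), (z * c); split; [exact: (tail_scal z _ _ _ h1)|exact: (CRInt_scal z _ _ _ _ h2)|exact: (tail_scal z _ _ _ h3)|ring].
Qed.

Lemma loop_ext (f g : C -> C) (sigma T : R) (v : C) : (0 <= T)%R ->
  (forall s, loop_pt sigma T s -> f s = g s) -> is_loop_integral f sigma T v -> is_loop_integral g sigma T v.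
Proof.
move=> hT h [a [b [c [h1 h2 h3 ->]]]]; exists a, b, c; split => //.
- by apply: tail_ext h1 => u hu; apply: h; rewrite /loop_pt !ReImE; tauto.
- apply: CRInt_ext h2 => t; rewrite Rmin_left ?Rmax_right; try lra.
  by move=> ht; apply: h; rewrite /loop_pt !ReImE; split; [lra|right; right; lra].
- by apply: tail_ext h3 => u hu; apply: h; rewrite /loop_pt !ReImE; tauto.
Qed.

Lemma loop_unique (f : C -> C) (sigma T : R) (v w : C) :
  is_loop_integral f sigma T v -> is_loop_integral f sigma T w -> v = w.
Proof.
move=> [a [b [c [h1 h2 h3 ->]]]] [a' [b' [c' [k1 k2 k3 ->]]]].
by rewrite (tail_unique _ _ _ _ h1 k1) (CRInt_unique _ _ _ _ _ h2 k2) (tail_unique _ _ _ _ h3 k3).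
Qed.

Lemma loop_bound (f : C -> C) (sigma T K : R) (v : C) : (0 <= T)%R -> (0 <= K)%R ->
  (forall s, loop_pt sigma T s -> (Cmod (f s) <= K * exp (- Re s))%R) ->
  is_loop_integral f sigma T v -> (Cmod v <= (2 + 2 * T) * exp (- sigma) * K)%R.
Proof.
move=> hT hK h [a [b [c [h1 h2 h3 ->]]]].
have H1 : (Cmod a <= K * exp (- sigma))%R.
  by apply: tail_bound hK _ h1 => u hu; apply: h; rewrite /loop_pt !ReImE; tauto.
have H3 : (Cmod c <= K * exp (- sigma))%R.
  by apply: tail_bound hK _ h3 => u hu; apply: h; rewrite /loop_pt !ReImE; tauto.
have H2 : (Cmod b <= (T - - T) * (K * exp (- sigma)))%R.
  apply: CRInt_norm _ _ h2; first lra.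
  by move=> t ht; apply: (h (sigma, t)); rewrite /loop_pt !ReImE; split; [lra|right; right; lra].
have t1 := Cmod_triangle (- a + Ci * b) c; have t2 := Cmod_triangle (- a) (Ci * b).
rewrite Cmod_opp Cmod_mult Cmod_Ci in t2; lra.
Qed.

Definition hseg (a b y : R) (s : C) : Prop := (a <= Re s <= b)%R /\ Im s = y.
Definition vseg (x T : R) (s : C) : Prop := Re s = x /\ (- T <= Im s <= T)%R.

Lemma hseg_bounded (a b y : R) : Cbounded (hseg a b y).
Proof.
have [B hB] := closed_rect_bounded a b y y; exists B => s [h1 h2]; apply: hB.
by split => //; rewrite h2; lra.
Qed.

Lemma vseg_bounded (x T : R) : Cbounded (vseg x T).
Proof.
have [B hB] := closed_rect_bounded x x (- T) T; exists B => s [h1 h2]; apply: hB.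
by split => //; rewrite h1; lra.
Qed.

(** Asked on each straight piece separately: a line separates every pole inside the loop from each
    piece, but not from the three together, and [Apx_inv_dir] needs such a line. The horizontal
    pieces are cut at an arbitrary abscissa to keep the sets bounded. *)
Definition loop_Apx (sigma T : R) (f : C -> C) : Prop :=
  [/\ forall b, Apx (hseg sigma b (- T)) f, Apx (vseg sigma T) f & forall b, Apx (hseg sigma b T) f].

Lemma loop_Apx_mult (sigma T : R) (f g : C -> C) :
  loop_Apx sigma T f -> loop_Apx sigma T g -> loop_Apx sigma T (fun s => f s * g s).
Proof.
move=> [f1 f2 f3] [g1 g2 g3]; split=> [b||b]; apply: Apx_mult => //; try exact: hseg_bounded; exact: vseg_bounded.
Qed.

Lemma loop_Apx_all (sigma T : R) (f : C -> C) : (forall S, Cbounded S -> Apx S f) -> loop_Apx sigma T f.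
Proof. by move=> h; split=> [b||b]; apply: h; try exact: hseg_bounded; exact: vseg_bounded. Qed.

Lemma loop_exists (f : C -> C) (sigma T K : R) : (0 <= T)%R -> (0 <= K)%R -> loop_Apx sigma T f ->
  (forall s, loop_pt sigma T s -> (Cmod (f s) <= K * exp (- Re s))%R) -> exists v, is_loop_integral f sigma T v.
Proof.
move=> hT hK [f1 f2 f3] hf.
have [a ha] : exists a, tail_int (fun u => f (u, (- T)%R)) sigma a.
  apply: (tail_exists _ _ K hK) => [b hb|u hu].
    by apply: (Apx_CRInt _ f _ _ _ hb (f1 b) (cpath_h (- T))) => t ht; split.
  by apply: (hf (u, (- T)%R)); rewrite /loop_pt !ReImE; tauto.
have [c hc] : exists c, tail_int (fun u => f (u, T)) sigma c.
  apply: (tail_exists _ _ K hK) => [b hb|u hu].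
    by apply: (Apx_CRInt _ f _ _ _ hb (f3 b) (cpath_h T)) => t ht; split.
  by apply: (hf (u, T)); rewrite /loop_pt !ReImE; tauto.
have [b hb] : exists b, CRInt (fun y => f (sigma, y)) (- T) T b.
  by apply: (Apx_CRInt _ f _ _ _ _ f2 (cpath_v sigma)) => [|t ht]; [lra|split].
by exists (- a + Ci * b + c), a, b, c.
Qed.

(** * Continuity of loop integrals in a parameter *)

Lemma poly_lipschitz (S : C -> Prop) (P : C -> C) : Cbounded S -> is_poly P ->
  exists L, (0 <= L)%R /\ forall s s', S s -> S s' -> (Cmod (P s - P s') <= L * Cmod (s - s'))%R.
Proof.
move=> [B hB] [l hl].
suff [L [h0 hL]] : exists L, (0 <= L)%R /\ forall s s', S s -> S s' -> (Cmod (horner l s - horner l s') <= L * Cmod (s - s'))%R.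
  by exists L; split => // s s' h1 h2; rewrite !hl; apply: hL.
elim: l {hl} => [|c l [L [h0 IH]]].
  exists 0%R; split; [lra|move=> s s' _ _ /=].
  by rewrite /Cminus Cplus_opp_r Cmod_0 Rmult_0_l; lra.
have [M [hM0 hM]] := poly_bounded S (horner l) (ex_intro _ B hB) (ex_intro _ l (fun s => erefl)).
exists (Rmax 0 B * L + M)%R; split; first by have := Rmult_le_pos (Rmax 0 B) L (Rmax_l _ _) h0; lra.
move=> s s' hs hs' /=.
have -> : c + s * horner l s - (c + s' * horner l s') = s * (horner l s - horner l s') + (s - s') * horner l s' by ring.
apply: Rle_trans (Cmod_triangle _ _) _; rewrite !Cmod_mult.
have t1 : (Cmod s * Cmod (horner l s - horner l s') <= Rmax 0 B * (L * Cmod (s - s')))%R.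
  apply: Rmult_le_compat; try exact: Cmod_ge_0; last exact: IH.
  by apply: Rle_trans (hB s hs) (Rmax_r _ _).
have t2 : (Cmod (s - s') * Cmod (horner l s') <= Cmod (s - s') * M)%R.
  by apply: Rmult_le_compat_l; [exact: Cmod_ge_0|exact: hM].
lra.
Qed.

(** A polynomial within [e / 3] of [rgamma] is Lipschitz on the disc, which leaves another [e / 3]
    for its own variation. *)
Lemma rgamma_ucont (B e : R) : (0 < e)%R -> exists d, (0 < d)%R /\
  forall z z', (Cmod z <= B)%R -> (Cmod z' <= B)%R -> (Cmod (z - z') <= d)%R -> (Cmod (rgamma z - rgamma z') <= e)%R.
Proof.
move=> he; pose S := fun s => (Cmod s <= B)%R.
have hS : Cbounded S by exists B.
have [P [hP h]] := Apx_rgamma S (fun s => s) hS (Apx_id S) (e / 3)%R ltac:(lra).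
have [L [hL0 hL]] := poly_lipschitz S P hS hP.
exists (e / (3 * (L + 1)))%R; split; first by apply: Rdiv_lt_0_compat; lra.
move=> z z' hz hz' hd.
have -> : rgamma z - rgamma z' = (rgamma z - P z) + (P z - P z') - (rgamma z' - P z') by ring.
apply: Rle_trans (Cmod_tri_sub _ _) _.
have := Cmod_triangle (rgamma z - P z) (P z - P z').
have := h z hz; have := h z' hz'; have := hL z z' hz hz'.
have h1 : (L * Cmod (z - z') <= (L + 1) * (e / (3 * (L + 1))))%R.
  by apply: Rmult_le_compat; try lra; exact: Cmod_ge_0.
have h2 : ((L + 1) * (e / (3 * (L + 1))) = e / 3)%R by field; lra.
lra.
Qed.

Definition cont_at (b : C -> C) (m0 : C) : Prop :=
  forall e, (0 < e)%R -> exists d, (0 < d)%R /\ forall m, (Cmod (m - m0) < d)%R -> (Cmod (b m - b m0) <= e)%R.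

(* Families of integrands, continuous in the parameter [m] at [m0] uniformly
   enough on the loop for the loop integral to be continuous at [m0]. *)
Record tame (sigma T : R) (m0 : C) (f : C -> C -> C) : Prop := Tame {
  tame_decay : forall a, (0 <= a)%R -> exists K d, [/\ (0 <= K)%R, (0 < d)%R &
    forall m s, (Cmod (m - m0) < d)%R -> loop_pt sigma T s -> (Cmod (f m s) <= K * exp (- (a * Re s)))%R];
  tame_cont : forall U e, (0 < e)%R -> exists d, (0 < d)%R /\
    forall m s, (Cmod (m - m0) < d)%R -> loop_pt sigma T s -> (Re s <= U)%R -> (Cmod (f m s - f m0 s) <= e)%R;
  tame_Apx : exists d, (0 < d)%R /\ forall m, (Cmod (m - m0) < d)%R -> loop_Apx sigma T (f m) }.

Lemma Cmod_diag_lt (m : C) (d : R) : (0 < d)%R -> (Cmod (m - m) < d)%R.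
Proof. by move=> hd; rewrite /Cminus Cplus_opp_r Cmod_0. Qed.

Lemma tame_mult (sigma T : R) (m0 : C) (f g : C -> C -> C) :
  tame sigma T m0 f -> tame sigma T m0 g -> tame sigma T m0 (fun m s => f m s * g m s).
Proof.
move=> hf hg; split.
- move=> a ha.
  have [K [d [hK hd h1]]] := tame_decay _ _ _ _ hf a ha.
  have [L [d' [hL hd' h2]]] := tame_decay _ _ _ _ hg 0%R (Rle_refl _).
  exists (K * L)%R, (Rmin d d'); split; [exact: Rmult_le_pos|exact: Rmin_pos|] => m s hm hs.
  have k1 := h1 m s ltac:(have := Rmin_l d d'; lra) hs.
  have k2 := h2 m s ltac:(have := Rmin_r d d'; lra) hs.
  rewrite Rmult_0_l Ropp_0 exp_0 Rmult_1_r in k2.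
  have -> : (K * L * exp (- (a * Re s)) = K * exp (- (a * Re s)) * L)%R by ring.
  by rewrite Cmod_mult; apply: Rmult_le_compat => //; exact: Cmod_ge_0.
- move=> U e he.
  have [K [d1 [hK hd1 h1]]] := tame_decay _ _ _ _ hf 0%R (Rle_refl _).
  have [L [d2 [hL hd2 h2]]] := tame_decay _ _ _ _ hg 0%R (Rle_refl _).
  have [d3 [hd3 h3]] := tame_cont _ _ _ _ hf U (e / (2 * (L + 1)))%R ltac:(apply: Rdiv_lt_0_compat; lra).
  have [d4 [hd4 h4]] := tame_cont _ _ _ _ hg U (e / (2 * (K + 1)))%R ltac:(apply: Rdiv_lt_0_compat; lra).
  exists (Rmin d1 (Rmin d3 d4)); split; first by apply: Rmin_pos => //; apply: Rmin_pos.
  move=> m s hm hs hU.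
  have m1 := Rmin_l d1 (Rmin d3 d4); have m2 := Rmin_r d1 (Rmin d3 d4).
  have m3 := Rmin_l d3 d4; have m4 := Rmin_r d3 d4.
  have k1 := h1 m s ltac:(lra) hs; have k2 := h2 m0 s (Cmod_diag_lt m0 d2 hd2) hs.
  have k3 := h3 m s ltac:(lra) hs hU; have k4 := h4 m s ltac:(lra) hs hU.
  rewrite Rmult_0_l Ropp_0 exp_0 Rmult_1_r in k1 k2.
  have -> : f m s * g m s - f m0 s * g m0 s = f m s * (g m s - g m0 s) + (f m s - f m0 s) * g m0 s by ring.
  apply: Rle_trans (Cmod_triangle _ _) _; rewrite !Cmod_mult.
  have t1 : (Cmod (f m s) * Cmod (g m s - g m0 s) <= (K + 1) * (e / (2 * (K + 1))))%R.
    by apply: Rmult_le_compat; try exact: Cmod_ge_0; lra.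
  have t2 : (Cmod (f m s - f m0 s) * Cmod (g m0 s) <= (e / (2 * (L + 1))) * (L + 1))%R.
    by apply: Rmult_le_compat; try exact: Cmod_ge_0; lra.
  have e1 : ((K + 1) * (e / (2 * (K + 1))) = e / 2)%R by field; lra.
  have e2 : ((e / (2 * (L + 1))) * (L + 1) = e / 2)%R by field; lra.
  lra.
have [d [hd h1]] := tame_Apx _ _ _ _ hf; have [d' [hd' h2]] := tame_Apx _ _ _ _ hg.
exists (Rmin d d'); split; first exact: Rmin_pos.
move=> m hm; apply: loop_Apx_mult; [apply: h1|apply: h2].
  by have := Rmin_l d d'; lra.
by have := Rmin_r d d'; lra.
Qed.

Lemma loop_pt_Im (sigma T : R) (s : C) : (0 <= T)%R -> loop_pt sigma T s -> (Rabs (Im s) <= T)%R.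
Proof. by move=> hT [_ [->|[->|[_ h]]]]; apply/Rabs_le_between; lra. Qed.

Lemma tame_rgamma (sigma T : R) (m0 : C) (c : C -> C) : (0 <= T)%R -> cont_at c m0 ->
  tame sigma T m0 (fun m s => rgamma (c m + s)).
Proof.
move=> hT hc; have [d [hd hcd]] := hc 1%R Rlt_0_1.
have hcb m : (Cmod (m - m0) < d)%R -> (Cmod (c m) <= Cmod (c m0) + 1)%R.
  by move=> hm; have := hcd m hm; have := Cmod_rev (c m) (c m0); lra.
pose B := (Cmod (c m0) + 1)%R; have hB : (0 <= B)%R by rewrite /B; have := Cmod_ge_0 (c m0); lra.
have hsig := Rabs_pos sigma; have hsig2 := Rle_abs (- sigma); rewrite Rabs_Ropp in hsig2.
split.
- move=> a ha; have [M [hM0 hM]] := rgamma_decay (B + T + Rabs sigma) a ha.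
  exists (M * exp (a * B))%R, d; split => //; first by apply: Rmult_le_pos => //; apply/Rlt_le/exp_pos.
  move=> m s hm hs; have hi := loop_pt_Im _ _ _ hT hs; have hcm := hcb m hm; rewrite -/B in hcm.
  have h1 := Re_bnd (c m); have h2 := Im_le_Cmod (c m).
  have hs1 : (sigma <= Re s)%R by case: hs.
  apply: Rle_trans (hM (c m + s) _ _) _.
  + by rewrite ImD; apply: Rle_trans (Rabs_triang _ _) _; lra.
  + by rewrite ReD; lra.
  rewrite Rmult_assoc -exp_plus; apply: Rmult_le_compat_l => //; apply: exp_le; rewrite ReD; nra.
- move=> U e he.
  have [d1 [hd1 h1]] := rgamma_ucont (B + (Rabs U + Rabs sigma) + T) e he.
  have [d2 [hd2 h2]] := hc d1 hd1.
  exists (Rmin d d2); split; first exact: Rmin_pos.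
  move=> m s hm hs hU; have hi := loop_pt_Im _ _ _ hT hs.
  have m1 := Rmin_l d d2; have m2 := Rmin_r d d2.
  have hs1 : (sigma <= Re s)%R by case: hs.
  have hss : (Cmod s <= (Rabs U + Rabs sigma) + T)%R.
    apply: Rle_trans (Cmod_le_ReIm _) _.
    have : (Rabs (Re s) <= Rabs U + Rabs sigma)%R by apply/Rabs_le_between; split_Rabs; lra.
    lra.
  apply: h1.
  + by apply: Rle_trans (Cmod_triangle _ _) _; have := hcb m ltac:(lra); rewrite -/B; lra.
  + by apply: Rle_trans (Cmod_triangle _ _) _; have := hcb m0 (Cmod_diag_lt _ _ hd); rewrite -/B; lra.
  + have -> : c m + s - (c m0 + s) = c m - c m0 by ring.
    by apply: h2; lra.
exists d; split => // m hm; apply: loop_Apx_all => S hS; apply: Apx_rgamma => //.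
by apply: Apx_plus; [exact: Apx_const|exact: Apx_id].
Qed.

Lemma loop_dist (sigma T tau : R) (b s : C) (j : nat) : (tau <= Re b - sigma)%R -> (tau <= T - Rabs (Im b))%R ->
  loop_pt sigma T s -> (tau <= Cmod (b - s + INR j))%R.
Proof.
move=> h1 h2 [hs1 hs2].
have k1 := Re_bnd (b - s + INR j); have k2 := Im_bnd (b - s + INR j).
rewrite ReD ReB ReR in k1; rewrite ImD ImB ImR in k2.
have k3 := Rle_abs (Im b); have k4 := Rle_abs (- Im b); rewrite Rabs_Ropp in k4.
have hj := pos_INR j.
by case: hs2 => [e|[e|[e _]]]; lra.
Qed.

Lemma Apx_gamma_seg (S : C -> Prop) (b : C) (tau : R) : Cbounded S -> (0 < tau)%R ->
  (forall j : nat, exists c, Cmod c = 1 /\ forall s, S s -> (tau <= Re (c * (b + INR j - s)))%R) ->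
  Apx S (fun s => Cgamma (b - s)).
Proof.
move=> hS ht h; apply: (Apx_gamma _ _ tau) => //.
- by apply: Apx_minus => //; [exact: Apx_const|exact: Apx_id].
- move=> s hs j; have [c [hc hj]] := h j; have h1 := hj s hs; have h2 := Re_bnd (c * (b + INR j - s)).
  rewrite Cmod_mult hc Rmult_1_l in h2.
  have -> : b - s + INR j = b + INR j - s by ring.
  by lra.
- move=> j; have [c [hc hj]] := h j.
  apply: (Apx_ext _ (fun s => / (b + INR j - s))) => [s _|]; first by congr (/ _); ring.
  exact: (Apx_inv_dir _ _ c tau).
Qed.

Lemma loop_Apx_gamma (sigma T : R) (b : C) : (sigma < Re b)%R -> (Rabs (Im b) < T)%R ->
  loop_Apx sigma T (fun s => Cgamma (b - s)).
Proof.
move=> h1 h2.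
have k3 := Rle_abs (Im b); have k4 := Rle_abs (- Im b); rewrite Rabs_Ropp in k4.
pose tau := Rmin (Re b - sigma) (T - Rabs (Im b)).
have ht : (0 < tau)%R by apply: Rmin_pos; lra.
have ht1 : (tau <= Re b - sigma)%R by apply: Rmin_l.
have ht2 : (tau <= T - Rabs (Im b))%R by apply: Rmin_r.
split=> [x||x]; apply: (Apx_gamma_seg _ _ tau) => //; try exact: hseg_bounded; try exact: vseg_bounded.
- move=> j; exists (- Ci); split; first by rewrite Cmod_opp Cmod_Ci.
  by move=> s [hs1 hs2]; rewrite !ReImE hs2; lra.
- move=> j; exists 1; split; first by rewrite Cmod_1.
  by move=> s [hs1 hs2]; rewrite !ReImE hs1; have := pos_INR j; lra.
- move=> j; exists Ci; split; first by rewrite Cmod_Ci.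
  by move=> s [hs1 hs2]; rewrite !ReImE hs2; lra.
Qed.

Lemma tame_gamma (sigma T : R) (m0 : C) (b : C -> C) : (sigma < Re (b m0))%R -> (Rabs (Im (b m0)) < T)%R ->
  cont_at b m0 -> tame sigma T m0 (fun m s => Cgamma (b m - s)).
Proof.
move=> hb1 hb2 hc.
have hT : (0 <= T)%R by have := Rabs_pos (Im (b m0)); lra.
(* Half of the margin between [b m0] and the loop, so that [b m] keeps the other half for all [m]
   near [m0]; the cap at 1 serves the bound [Cmod (b m) <= Cmod (b m0) + 1]. *)
pose tau := (Rmin (Rmin (Re (b m0) - sigma) (T - Rabs (Im (b m0)))) 2 / 2)%R.
have [ht t1 t2 t3] : [/\ (0 < tau)%R, (2 * tau <= Re (b m0) - sigma)%R, (2 * tau <= T - Rabs (Im (b m0)))%R & (tau <= 1)%R].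
  have q1 := Rmin_l (Rmin (Re (b m0) - sigma) (T - Rabs (Im (b m0)))) 2.
  have q2 := Rmin_r (Rmin (Re (b m0) - sigma) (T - Rabs (Im (b m0)))) 2.
  have q3 := Rmin_l (Re (b m0) - sigma) (T - Rabs (Im (b m0))).
  have q4 := Rmin_r (Re (b m0) - sigma) (T - Rabs (Im (b m0))).
  have q5 : (0 < Rmin (Rmin (Re (b m0) - sigma) (T - Rabs (Im (b m0)))) 2)%R.
    by apply: Rmin_pos; [apply: Rmin_pos|]; lra.
  by rewrite /tau; split; lra.
have [d [hd hbd]] := hc tau ht.
have hsep m : (Cmod (m - m0) < d)%R -> [/\ (tau <= Re (b m) - sigma)%R, (tau <= T - Rabs (Im (b m)))%R & (Cmod (b m) <= Cmod (b m0) + 1)%R].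
  move=> hm; have h1 := hbd m hm.
  have h2 := Re_bnd (b m - b m0); have h3 := Im_le_Cmod (b m - b m0).
  rewrite ReB in h2; rewrite ImB in h3.
  have h4 := Rabs_triang_inv (Im (b m)) (Im (b m0)).
  have h5 := Cmod_rev (b m) (b m0).
  by split; lra.
pose B := (Cmod (b m0) + 1)%R; have hB : (0 <= B)%R by rewrite /B; have := Cmod_ge_0 (b m0); lra.
have hsig := Rabs_pos sigma; have hsig2 := Rle_abs (- sigma); rewrite Rabs_Ropp in hsig2.
split.
- move=> a ha; have [M [hM0 hM]] := gamma_decay (B + T + Rabs sigma) a tau ha ht.
  exists (M * exp (a * B))%R, d; split => //; first by apply: Rmult_le_pos => //; apply/Rlt_le/exp_pos.
  move=> m s hm hs; have hi := loop_pt_Im _ _ _ hT hs; have [s1 s2 s3] := hsep m hm; rewrite -/B in s3.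
  have h1 := Re_bnd (b m); have h2 := Im_le_Cmod (b m).
  have hs1 : (sigma <= Re s)%R by case: hs.
  apply: Rle_trans (hM (b m - s) _ _ _) _.
  + rewrite ImB; apply: Rle_trans (Rabs_triang _ _) _; rewrite Rabs_Ropp; lra.
  + by rewrite ReB; lra.
  + by move=> j; apply: (loop_dist sigma T).
  rewrite Rmult_assoc -exp_plus; apply: Rmult_le_compat_l => //; apply: exp_le; rewrite ReB; nra.
- move=> U e he.
  pose R1 := (B + (Rabs U + Rabs sigma) + T)%R.
  have [n0 [M [_ hM _]]] := gamma_unif R1 tau ht.
  have hM0 := Rmax_l 0 M; have hM1 := Rmax_r 0 M.
  have hM2 : (0 < (Rmax 0 M + 1) * (Rmax 0 M + 1))%R by nra.
  have [d1 [hd1 h1]] := rgamma_ucont R1 (e / ((Rmax 0 M + 1) * (Rmax 0 M + 1)))%R ltac:(exact: Rdiv_lt_0_compat).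
  have [d2 [hd2 h2]] := hc d1 hd1.
  exists (Rmin d d2); split; first exact: Rmin_pos.
  move=> m s hm hs hU; have hi := loop_pt_Im _ _ _ hT hs.
  have m1 := Rmin_l d d2; have m2 := Rmin_r d d2.
  have hs1 : (sigma <= Re s)%R by case: hs.
  have hss : (Cmod s <= (Rabs U + Rabs sigma) + T)%R.
    apply: Rle_trans (Cmod_le_ReIm _) _.
    have : (Rabs (Re s) <= Rabs U + Rabs sigma)%R by apply/Rabs_le_between; split_Rabs; lra.
    lra.
  have [s1 s2 s3] := hsep m ltac:(lra); have [r1 r2 r3] := hsep m0 (Cmod_diag_lt _ _ hd).
  have hz : (Cmod (b m - s) <= R1)%R by apply: Rle_trans (Cmod_tri_sub _ _) _; rewrite /R1 /B; lra.
  have hz0 : (Cmod (b m0 - s) <= R1)%R by apply: Rle_trans (Cmod_tri_sub _ _) _; rewrite /R1 /B; lra.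
  have g1 := hM (b m - s) hz (fun j => loop_dist sigma T tau (b m) s j s1 s2 hs).
  have g2 := hM (b m0 - s) hz0 (fun j => loop_dist sigma T tau (b m0) s j r1 r2 hs).
  have np z : (forall j : nat, (tau <= Cmod (z + INR j))%R) -> rgamma z <> 0.
    by move=> h; apply: rgamma_neq0 => -[j hj]; have := h j; rewrite hj Cmod_0; lra.
  have n1 := np (b m - s) (fun j => loop_dist sigma T tau (b m) s j s1 s2 hs).
  have n2 := np (b m0 - s) (fun j => loop_dist sigma T tau (b m0) s j r1 r2 hs).
  have g3 := h1 (b m0 - s) (b m - s) hz0 hz.
  have hdd : (Cmod (b m0 - s - (b m - s)) <= d1)%R.
    have -> : b m0 - s - (b m - s) = - (b m - b m0) by ring.
    by rewrite Cmod_opp; apply: h2; lra.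
  have {}g3 := g3 hdd.
  (* The difference is expressed through the reciprocals, whose uniform continuity on discs is
     [rgamma_ucont]. *)
  have -> : Cgamma (b m - s) - Cgamma (b m0 - s) = Cgamma (b m - s) * Cgamma (b m0 - s) * (rgamma (b m0 - s) - rgamma (b m - s)).
    rewrite -!rgamma_inv; move: (rgamma (b m - s)) (rgamma (b m0 - s)) n1 n2 => u v n1 n2.
    by field.
  rewrite !Cmod_mult.
  have t4 : (Cmod (Cgamma (b m - s)) * Cmod (Cgamma (b m0 - s)) <= (Rmax 0 M + 1) * (Rmax 0 M + 1))%R.
    by apply: Rmult_le_compat; try exact: Cmod_ge_0; lra.
  have -> : (e = (Rmax 0 M + 1) * (Rmax 0 M + 1) * (e / ((Rmax 0 M + 1) * (Rmax 0 M + 1))))%R by field; lra.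
  apply: Rmult_le_compat => //; last exact: Cmod_ge_0.
  by apply: Rmult_le_pos; exact: Cmod_ge_0.
exists d; split => // m hm; have [s1 s2 _] := hsep m hm.
by apply: loop_Apx_gamma; lra.
Qed.

Lemma Cexp_strip (sigma T : R) (w s : C) : (sigma <= Re s)%R -> (Rabs (Im s) <= T)%R ->
  (Cmod (Cexp (s * w)) <= exp (Cmod w * (2 * Rabs sigma + T)) * exp (Cmod w * Re s))%R.
Proof.
move=> h1 h2; apply: Rle_trans (Cmod_Cexp_le _) _; rewrite -exp_plus; apply: exp_le.
rewrite Cmod_mult; have hw := Cmod_ge_0 w.
have : (Cmod s <= 2 * Rabs sigma + T + Re s)%R.
  apply: Rle_trans (Cmod_le_ReIm _) _.
  have : (Rabs (Re s) <= 2 * Rabs sigma + Re s)%R by split_Rabs; lra.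
  lra.
nra.
Qed.

(** Decay at every rate, as demanded by [tame], absorbs the exponential: it grows at most like
    [exp (Cmod w * Re s)], so the rate is raised by [Cmod w]. *)
Lemma tame_mult_exp (sigma T : R) (m0 w : C) (f : C -> C -> C) : (0 <= T)%R ->
  tame sigma T m0 f -> tame sigma T m0 (fun m s => f m s * Cexp (s * w)).
Proof.
move=> hT hf; have hw := Cmod_ge_0 w.
set E0 := exp (Cmod w * (2 * Rabs sigma + T)); have hE0 : (0 < E0)%R by apply: exp_pos.
split.
- move=> a ha; have [K [d [hK hd h1]]] := tame_decay _ _ _ _ hf (a + Cmod w)%R ltac:(lra).
  exists (K * E0)%R, d; split => //; first by apply: Rmult_le_pos => //; lra.
  move=> m s hm hs; have hi := loop_pt_Im _ _ _ hT hs; have hs1 : (sigma <= Re s)%R by case: hs.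
  have -> : (K * E0 * exp (- (a * Re s)) = K * exp (- ((a + Cmod w) * Re s)) * (E0 * exp (Cmod w * Re s)))%R.
    have -> : (- (a * Re s) = - ((a + Cmod w) * Re s) + Cmod w * Re s)%R by ring.
    by rewrite exp_plus; ring.
  rewrite Cmod_mult; apply: Rmult_le_compat; try exact: Cmod_ge_0; first exact: h1.
  exact: Cexp_strip.
- move=> U e he; set E1 := (E0 * exp (Cmod w * U))%R.
  have hE1 : (0 < E1)%R by apply: Rmult_lt_0_compat => //; apply: exp_pos.
  have [d [hd h1]] := tame_cont _ _ _ _ hf U (e / E1)%R ltac:(exact: Rdiv_lt_0_compat).
  exists d; split => // m s hm hs hU.
  have hi := loop_pt_Im _ _ _ hT hs; have hs1 : (sigma <= Re s)%R by case: hs.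
  have -> : f m s * Cexp (s * w) - f m0 s * Cexp (s * w) = (f m s - f m0 s) * Cexp (s * w) by ring.
  have -> : (e = e / E1 * E1)%R by field; lra.
  rewrite Cmod_mult; apply: Rmult_le_compat; try exact: Cmod_ge_0; first exact: h1.
  apply: Rle_trans (Cexp_strip sigma T w s hs1 hi) _; apply: Rmult_le_compat_l; first exact/Rlt_le/exp_pos.
  by apply: exp_le; nra.
have [d [hd h1]] := tame_Apx _ _ _ _ hf; exists d; split => // m hm.
apply: loop_Apx_mult; first exact: h1.
apply: loop_Apx_all => S hS; apply: Apx_exp => //.
by apply: Apx_mult => //; [exact: Apx_id|exact: Apx_const].
Qed.

Lemma tame_exists (sigma T : R) (m0 : C) (f : C -> C -> C) : (0 <= T)%R -> tame sigma T m0 f ->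
  exists d, (0 < d)%R /\ forall m, (Cmod (m - m0) < d)%R -> exists v, is_loop_integral (f m) sigma T v.
Proof.
move=> hT hf.
have [K [d1 [hK hd1 h1]]] := tame_decay _ _ _ _ hf 1%R ltac:(lra).
have [d2 [hd2 h2]] := tame_Apx _ _ _ _ hf.
exists (Rmin d1 d2); split; first exact: Rmin_pos.
have m1 := Rmin_l d1 d2; have m2 := Rmin_r d1 d2.
move=> m hm; apply: (loop_exists _ _ _ K) => //; first by apply: h2; lra.
by move=> s hs; have := h1 m s ltac:(lra) hs; rewrite Rmult_1_l.
Qed.

Lemma tame_limit (sigma T : R) (m0 : C) (f : C -> C -> C) (e : R) : (0 <= T)%R -> tame sigma T m0 f -> (0 < e)%R ->
  exists d, (0 < d)%R /\ forall m v v0, (Cmod (m - m0) < d)%R ->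
    is_loop_integral (f m) sigma T v -> is_loop_integral (f m0) sigma T v0 -> (Cmod (v - v0) <= e)%R.
Proof.
move=> hT hf he.
pose L := ((2 + 2 * T) * exp (- sigma))%R.
have hL : (0 < L)%R by apply: Rmult_lt_0_compat; [lra|exact: exp_pos].
pose e1 := (e / L)%R; have he1 : (0 < e1)%R by apply: Rdiv_lt_0_compat.
(* Of the rate 2, one unit makes the integrand small beyond the abscissa [U] and the other keeps it
   integrable there; up to [U] the uniform continuity takes over. *)
have [K [d1 [hK hd1 h1]]] := tame_decay _ _ _ _ hf 2%R ltac:(lra).
have [U hU] := exp_small (2 * K) e1 ltac:(lra) he1.
have [d2 [hd2 h2]] := tame_cont _ _ _ _ hf U (e1 * exp (- U))%R ltac:(apply: Rmult_lt_0_compat => //; exact: exp_pos).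
exists (Rmin d1 d2); split; first exact: Rmin_pos.
have m1 := Rmin_l d1 d2; have m2 := Rmin_r d1 d2.
move=> m v v0 hm hv hv0.
have h := loop_plus _ _ _ _ _ _ hv (loop_scal (- (1)) _ _ _ _ hv0).
have -> : v - v0 = v + - (1) * v0 by ring.
apply: Rle_trans (loop_bound _ _ _ e1 _ hT (Rlt_le _ _ he1) _ h) _; last first.
  by apply: Req_le; rewrite -/L /e1; field; lra.
move=> s hs; have -> : f m s + - (1) * f m0 s = f m s - f m0 s by ring.
case: (Rle_dec (Re s) U) => hsU.
  apply: Rle_trans (h2 m s ltac:(lra) hs hsU) _; apply: Rmult_le_compat_l; first lra.
  by apply: exp_le; lra.
apply: Rle_trans (Cmod_tri_sub _ _) _.
have k1 := h1 m s ltac:(lra) hs; have k2 := h1 m0 s (Cmod_diag_lt _ _ hd1) hs.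
have k3 := hU (Re s) ltac:(lra).
have k4 : (exp (- (2 * Re s)) = exp (- Re s) * exp (- Re s))%R by rewrite -exp_plus; congr exp; ring.
rewrite k4 in k1 k2; have k5 := exp_pos (- Re s).
apply: Rle_trans (_ : (2 * K * exp (- Re s)) * exp (- Re s) <= _)%R; first lra.
by apply: Rmult_le_compat_r; lra.
Qed.

(** * Residues along a row of simple poles *)

Lemma rect_integral_Chasles (f : C -> C) (x1 x2 x3 y1 y2 : R) (v w : C) :
  rect_integral f x1 x2 y1 y2 v -> rect_integral f x2 x3 y1 y2 w -> rect_integral f x1 x3 y1 y2 (v + w).
Proof.
move=> [a [b [c [d [h1 h2 h3 h4 ->]]]]] [a' [b' [c' [d' [k1 k2 k3 k4 ->]]]]].
exists (a + a'), b', (c + c'), d; split => //.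
- exact: (is_RInt_Chasles (V := C_R_NormedModule) _ _ _ _ _ _ h1 k1).
- exact: (is_RInt_Chasles (V := C_R_NormedModule) _ _ _ _ _ _ h3 k3).
by rewrite (CRInt_unique _ _ _ _ _ k4 h2); ring.
Qed.

Lemma rect_integral_exists (f : C -> C) (x1 x2 T : R) : (x1 <= x2)%R -> (0 <= T)%R ->
  Apx (hseg x1 x2 (- T)) f -> Apx (hseg x1 x2 T) f -> Apx (vseg x1 T) f -> Apx (vseg x2 T) f ->
  exists v, rect_integral f x1 x2 (- T) T v.
Proof.
move=> hx hT f1 f2 f3 f4.
have hT' : (- T <= T)%R by lra.
have [a ha] := Apx_CRInt _ _ _ _ _ hx f1 (cpath_h (- T)) (fun t ht => conj ht erefl).
have [b hb] := Apx_CRInt _ _ _ _ _ hT' f4 (cpath_v x2) (fun t ht => conj erefl ht).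
have [c hc] := Apx_CRInt _ _ _ _ _ hx f2 (cpath_h T) (fun t ht => conj ht erefl).
have [d hd] := Apx_CRInt _ _ _ _ _ hT' f3 (cpath_v x1) (fun t ht => conj erefl ht).
by exists (a + Ci * b - c - Ci * d), a, b, c, d.
Qed.

(** Midway between the poles [b + k] and [b + k + 1]: a vertical side placed there has distance at
    least 1/2 from the whole row. *)
Definition row_abscissa (b : C) (k : nat) : R := (Re b + INR k + 1 / 2)%R.

Lemma vseg_dir (b : C) (k j : nat) (T : R) : exists c, Cmod c = 1 /\
  forall s, vseg (row_abscissa b k) T s -> (1 / 2 <= Re (c * (b + INR j - s)))%R.
Proof.
case: (leqP j k) => hjk.
  exists (- (1)); split; first exact: Cmod_m1.
  move=> s [hs _]; rewrite !ReImE hs /row_abscissa.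
  have : (INR j <= INR k)%R by apply: le_INR; lia.
  lra.
exists 1; split; first exact: Cmod_1.
move=> s [hs _]; rewrite !ReImE hs /row_abscissa.
have : (INR k.+1 <= INR j)%R by apply: le_INR; lia.
rewrite S_INR; lra.
Qed.

Lemma Apx_inv_pochhammer (S : C -> Prop) (b : C) (k : nat) (d : R) : Cbounded S -> (0 < d)%R ->
  (forall j, (j < k)%nat -> exists c, Cmod c = 1 /\ forall s, S s -> (d <= Re (c * (b + INR j - s)))%R) ->
  Apx S (fun s => / pochhammer (b - s) k).
Proof.
move=> hS hd; elim: k => [|k IH] h; first by apply: Apx_ext (Apx_const S (/ 1)) => s _.
apply: (Apx_ext _ (fun s => / pochhammer (b - s) k * / (b + INR k - s))) => [s _|].
  by rewrite pochhammer_S Cinv_mul; congr (_ * / _); ring.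
apply: Apx_mult => //; first by apply: IH => j hj; apply: h; lia.
have [c [hc hcs]] := h k (ltnSn k); exact: (Apx_inv_dir _ _ c d).
Qed.

Lemma gamma_shift (z : C) (n : nat) : Cgamma z = / pochhammer z n * Cgamma (z + INR n).
Proof. by rewrite -!rgamma_inv (rgamma_pochhammer z n) Cinv_mul. Qed.

Lemma gamma_1 : Cgamma 1 = 1.
Proof. by rewrite -rgamma_inv rgamma_1 Cinv_1. Qed.

Lemma pochhammer_neg (k : nat) : pochhammer (- INR k) k = (- (1)) ^ k * INR k`!.
Proof.
elim: k => [|k IH]; first by rewrite pochhammer_0 /=; ring.
rewrite pochhammer_Sl.
have -> : - INR k.+1 + 1 = - INR k by rewrite S_INR RtoC_plus; ring.
by rewrite IH INR_factS /=; ring.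
Qed.

Lemma m1_pow_inv (k : nat) : / ((- (1)) ^ k) = (- (1)) ^ k.
Proof.
elim: k => [|k IH]; first exact: Cinv_1.
have -> : (- (1)) ^ k.+1 = - (1) * (- (1)) ^ k by [].
by rewrite Cinv_mul IH; congr (_ * _); field.
Qed.

(** Exactly one pole, [b + k], lies in the rectangle. Shifting by [k + 1] writes [Gamma (b - s)] as
    a function approximable on the rectangle, divided by [- (s - (b + k))], and Cauchy's formula
    applies. The conditional hypothesis lets the first rectangle start anywhere to the left of [b],
    the others at the preceding midline. *)
Lemma row_rect (b : C) (E : C -> C) (x1 T : R) (k : nat) :
  (forall S, Cbounded S -> Apx S E) -> (Rabs (Im b) < T)%R ->
  (if k is k'.+1 then x1 = row_abscissa b k' else (x1 < Re b)%R) ->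
  rect_integral (fun s => Cgamma (b - s) * E s) x1 (row_abscissa b k) (- T) T
    (- (2 * PI * Ci) * ((- (1)) ^ k * / INR k`! * E (b + INR k))).
Proof.
move=> hE hb hx1.
have hT : (0 < T)%R by have := Rabs_pos (Im b); lra.
have hk0 := pos_INR k.
have hx1k : (x1 < Re b + INR k)%R.
  by case: k hx1 hk0 => [|k] hx1 _; [rewrite /=; lra|rewrite hx1 /row_abscissa S_INR; lra].
have hx2 : (Re b + INR k < row_abscissa b k)%R by rewrite /row_abscissa; lra.
have k3 := Rle_abs (Im b); have k4 := Rle_abs (- Im b); rewrite Rabs_Ropp in k4.
have htau : (0 < T - Rabs (Im b))%R by lra.
have hh : (0 < 1 / 2)%R by lra.
have Ah1 : Apx (hseg x1 (row_abscissa b k) (- T)) (fun s => Cgamma (b - s) * E s).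
  have hB := hseg_bounded x1 (row_abscissa b k) (- T); apply: Apx_mult => //; last exact: hE.
  apply: (Apx_gamma_seg _ _ (T - Rabs (Im b))) => // j; exists (- Ci); split; first by rewrite Cmod_opp Cmod_Ci.
  by move=> s [_ hs]; rewrite !ReImE hs; lra.
have Ah2 : Apx (hseg x1 (row_abscissa b k) T) (fun s => Cgamma (b - s) * E s).
  have hB := hseg_bounded x1 (row_abscissa b k) T; apply: Apx_mult => //; last exact: hE.
  apply: (Apx_gamma_seg _ _ (T - Rabs (Im b))) => // j; exists Ci; split; first exact: Cmod_Ci.
  by move=> s [_ hs]; rewrite !ReImE hs; lra.
have Av l : Apx (vseg (row_abscissa b l) T) (fun s => Cgamma (b - s) * E s).
  have hB := vseg_bounded (row_abscissa b l) T; apply: Apx_mult => //; last exact: hE.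
  by apply: (Apx_gamma_seg _ _ (1 / 2)) => // j; exact: vseg_dir.
have Av1 : Apx (vseg x1 T) (fun s => Cgamma (b - s) * E s).
  case: k hx1 {hk0 hx1k hx2 Ah1 Ah2} => [|k] hx1; last by rewrite hx1.
  have hB := vseg_bounded x1 T; apply: Apx_mult => //; last exact: hE.
  apply: (Apx_gamma_seg _ _ (Re b - x1)) => //; first lra.
  move=> j; exists 1; split; first exact: Cmod_1.
  by move=> s [hs _]; rewrite !ReImE hs; have := pos_INR j; lra.
have [v hv] := rect_integral_exists _ x1 (row_abscissa b k) T ltac:(lra) ltac:(lra) Ah1 Ah2 Av1 (Av k).
(* The poles of index below [k] lie at least 1/2 to the left of the rectangle, those of index above
   [k] at least 1/2 to its right, so each inverse factor has a separating line. *)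
pose h s := / pochhammer (b - s) k * Cgamma (b + INR k.+1 - s) * E s.
have hh0 : Apx (closed_rect x1 (row_abscissa b k) (- T) T) h.
  have hB := closed_rect_bounded x1 (row_abscissa b k) (- T) T.
  apply: Apx_mult => //; last exact: hE.
  apply: Apx_mult => //.
    apply: (Apx_inv_pochhammer _ _ _ (1 / 2)) => // j hj.
    exists (- (1)); split; first exact: Cmod_m1.
    move=> s [[hs _] _]; rewrite !ReImE.
    case: k hx1 hj {hk0 hx1k hx2 Ah1 Ah2 hv h hB} hs => [//|k] hx1 hj hs.
    have : (INR j <= INR k)%R by apply: le_INR; lia.
    by rewrite hx1 /row_abscissa in hs; lra.
  apply: (Apx_gamma_seg _ _ (1 / 2)) => // j; exists 1; split; first exact: Cmod_1.
  move=> s [[_ hs] _]; rewrite !ReImE; have hj := pos_INR j.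
  by rewrite /row_abscissa in hs; rewrite S_INR; lra.
have hv2 : rect_integral (fun s => h s / (s - (b + INR k))) x1 (row_abscissa b k) (- T) T (- (1) * v).
  apply: rect_integral_ext (rect_integral_scal (- (1)) _ _ _ _ _ _ hv); try lra.
  move=> s hs; rewrite (gamma_shift (b - s) k.+1) pochhammer_S /h.
  have -> : b - s + INR k.+1 = b + INR k.+1 - s by ring.
  rewrite Cinv_mul.
  have hne : s - (b + INR k) <> 0.
    move=> e; case: hs => [_ hs].
    have e1 : Re s = (Re b + INR k)%R by have := f_equal Re e; rewrite !ReImE; lra.
    have e2 : Im s = Im b by have := f_equal Im e; rewrite !ReImE; lra.
    by case: hs => [h1|[h1|[h1|h1]]]; lra.
  have -> : b - s + INR k = - (s - (b + INR k)) by ring.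
  move: (s - (b + INR k)) hne (/ pochhammer (b - s) k) => u hu p.
  by field.
have := cauchy_formula h (b + INR k) x1 (row_abscissa b k) (- T) T (- (1) * v) _ _ hh0 hv2.
rewrite !ReImE Rplus_0_r => H.
have {}H := H ltac:(lra) ltac:(lra).
have -> // : - (2 * PI * Ci) * ((- (1)) ^ k * / INR k`! * E (b + INR k)) = v.
have -> : v = - (1) * (- (1) * v) by ring.
rewrite H /h.
have -> : b - (b + INR k) = - INR k by ring.
have -> : b + INR k.+1 - (b + INR k) = 1 by rewrite S_INR RtoC_plus; ring.
by rewrite pochhammer_neg gamma_1 Cinv_mul m1_pow_inv; ring.
Qed.

(** Minus the residue of [Cgamma (b - s) * E s] at [b + k]; the sign cancels the clockwise
    orientation of the loop. *)
Definition res_term (b : C) (E : C -> C) (k : nat) : C := (- (1)) ^ k * / INR k`! * E (b + INR k).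

Lemma row_rects (b : C) (E : C -> C) (sigma T : R) (n : nat) :
  (forall S, Cbounded S -> Apx S E) -> (Rabs (Im b) < T)%R -> (sigma < Re b)%R ->
  rect_integral (fun s => Cgamma (b - s) * E s) sigma (row_abscissa b n) (- T) T
    (- (2 * PI * Ci) * sum_n (res_term b E) n).
Proof.
move=> hE hb hs; elim: n => [|n IH]; first by rewrite sum_O; exact: (row_rect b E sigma T 0).
rewrite sum_Sn.
have -> : - (2 * PI * Ci) * plus (sum_n (res_term b E) n) (res_term b E n.+1) =
  - (2 * PI * Ci) * sum_n (res_term b E) n + - (2 * PI * Ci) * res_term b E n.+1 by exact: Cmult_plus_distr_l.
apply: rect_integral_Chasles IH _; exact: (row_rect b E (row_abscissa b n) T n.+1).
Qed.

(** The loop is the limit of the boundaries of growing rectangles, traversed backwards and without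
    their right sides. These stay midway between poles, where Gamma decays faster than [E] grows,
    and contribute nothing in the limit. *)
Lemma row_residues (b : C) (E : C -> C) (sigma T A K : R) (v : C) :
  (forall S, Cbounded S -> Apx S E) -> (Rabs (Im b) < T)%R -> (sigma < Re b)%R ->
  (0 <= A)%R -> (0 <= K)%R ->
  (forall s, (sigma <= Re s)%R -> (Rabs (Im s) <= T)%R -> (Cmod (E s) <= K * exp (A * Re s))%R) ->
  is_loop_integral (fun s => Cgamma (b - s) * E s) sigma T v ->
  Clim (fun n => 2 * PI * Ci * sum_n (res_term b E) n) v.
Proof.
move=> hE hb hs hA hK hEb [lo [le [up [h1 h2 h3 ->]]]].
have hT : (0 < T)%R by have := Rabs_pos (Im b); lra.
have hR n := row_rects b E sigma T n hE hb hs.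
(* The four sides of the [n]-th rectangle are extracted as sequences: [F] lower, [G] right, [H]
   upper, [J] left. *)
have [F hF] := ClassicalEpsilon.choice _ hR.
have [G hG] := ClassicalEpsilon.choice _ hF.
have [H hH] := ClassicalEpsilon.choice _ hG.
have [J hJ] := ClassicalEpsilon.choice _ hH.
have hx n : (row_abscissa b 0 + INR n <= row_abscissa b n)%R by rewrite /row_abscissa /=; lra.
have c1 : Clim F lo by apply: (tail_seq _ _ _ (row_abscissa b) _ h1 hx) => n; case: (hJ n).
have c3 : Clim H up by apply: (tail_seq _ _ _ (row_abscissa b) _ h3 hx) => n; case: (hJ n).
have hJe n : J n = le by case: (hJ n) => _ _ _ k _; exact: CRInt_unique k h2.
have c2 : Clim G 0.
  pose R0 := (Rabs (Im b) + T)%R.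
  (* The rate [A + 1] outweighs the growth of [E] and leaves the factor [exp (- Re s)]. *)
  have [M [hM0 hM]] := gamma_decay R0 (A + 1) (1 / 2) ltac:(lra) ltac:(lra).
  pose W := (2 * T * (M * exp ((A + 1) * Re b) * K))%R.
  have hW : (0 <= W)%R.
    apply: Rmult_le_pos; first lra; apply: Rmult_le_pos => //; apply: Rmult_le_pos => //.
    exact/Rlt_le/exp_pos.
  move=> e he; have [U hU] := exp_small W e hW he.
  have [N [_ hN]] := nat_above (Rmax (U - Re b) (- Re b + sigma)).
  exists N => n hn; have -> : G n - 0 = G n by ring.
  have hNn : (INR N <= INR n)%R by apply: le_INR; lia.
  have m1 := Rmax_l (U - Re b) (- Re b + sigma); have m2 := Rmax_r (U - Re b) (- Re b + sigma).
  have hn0 := pos_INR n.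
  case: (hJ n) => _ hGn _ _ _.
  have hb2 : (Cmod (G n) <= (T - - T) * (M * exp ((A + 1) * Re b) * K * exp (- row_abscissa b n)))%R.
    apply: CRInt_norm _ _ hGn; first lra.
    move=> y hy; set s : C := (row_abscissa b n, y).
    have hy2 : (Rabs y <= T)%R by apply/Rabs_le_between.
    rewrite Cmod_mult.
    have g1 := hM (b - s); have g2 := hEb s; rewrite !ReImE in g1 g2.
    have {}g2 := g2 ltac:(rewrite /row_abscissa; lra) hy2.
    have {}g1 := g1 ltac:(apply: Rle_trans (Rabs_triang _ _) _; rewrite Rabs_Ropp /R0; lra).
    have {}g1 := g1 ltac:(rewrite /row_abscissa /R0; have := Rabs_pos (Im b); lra).
    have hdist j : (1 / 2 <= Cmod (b - s + INR j))%R.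
      have [c [hc hcs]] := vseg_dir b n j T.
      have h5 := hcs s ltac:(by rewrite /vseg !ReImE; split).
      have h6 := Re_bnd (c * (b + INR j - s)); rewrite Cmod_mult hc Rmult_1_l in h6.
      have -> : b - s + INR j = b + INR j - s by ring.
      lra.
    have {}g1 := g1 hdist.
    have -> : (M * exp ((A + 1) * Re b) * K * exp (- row_abscissa b n) =
       (M * exp ((A + 1) * (Re b - row_abscissa b n))) * (K * exp (A * row_abscissa b n)))%R.
      have -> : ((A + 1) * (Re b - row_abscissa b n) = (A + 1) * Re b + - row_abscissa b n + - (A * row_abscissa b n))%R by ring.
      rewrite !exp_plus (exp_Ropp (A * row_abscissa b n)); have := exp_pos (A * row_abscissa b n) => hp.
      by field; lra.
    by apply: Rmult_le_compat => //; exact: Cmod_ge_0.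
  apply: Rle_lt_trans hb2 _.
  have -> : ((T - - T) * (M * exp ((A + 1) * Re b) * K * exp (- row_abscissa b n)) = W * exp (- row_abscissa b n))%R by rewrite /W; ring.
  apply: Rle_lt_trans (_ : W * exp (- (Re b + INR n)) < e)%R.
    by apply: Rmult_le_compat_l => //; apply: exp_le; rewrite /row_abscissa; lra.
  by apply: hU; lra.
have c4 := Clim_minus _ _ _ _ (Clim_minus _ _ _ _ c3 c1) (Clim_minus _ _ _ _ (Clim_mult _ _ _ _ (Clim_const Ci) c2) (Clim_const (Ci * le))).
have -> : - lo + Ci * le + up = up - lo - (Ci * 0 - Ci * le) by ring.
apply: (Clim_ext _ _ _ 0) c4 => n _.
have [_ _ _ _ e] := hJ n.
have -> : 2 * PI * Ci * sum_n (res_term b E) n = - (- (2 * PI * Ci) * sum_n (res_term b E) n) by ring.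
by rewrite e hJe; ring.
Qed.

(** What the residue computation asks of the cofactor of a row: it is entire, in the sense of [Apx],
    and grows at most exponentially to the right in horizontal strips. *)
Definition exp_type (E : C -> C) : Prop :=
  (forall S, Cbounded S -> Apx S E) /\
  forall sigma T : R, (0 <= T)%R -> exists A K, [/\ (0 <= A)%R, (0 <= K)%R &
    forall s, (sigma <= Re s)%R -> (Rabs (Im s) <= T)%R -> (Cmod (E s) <= K * exp (A * Re s))%R].

Lemma exp_type_mult (E F : C -> C) : exp_type E -> exp_type F -> exp_type (fun s => E s * F s).
Proof.
move=> [e1 e2] [f1 f2]; split=> [S hS|sigma T hT].
  by apply: Apx_mult => //; [exact: e1|exact: f1].
have [A [K [hA hK h1]]] := e2 sigma T hT; have [B [L [hB hL h2]]] := f2 sigma T hT.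
exists (A + B)%R, (K * L)%R; split; [lra|exact: Rmult_le_pos|] => s hs hi.
have -> : (K * L * exp ((A + B) * Re s) = (K * exp (A * Re s)) * (L * exp (B * Re s)))%R.
  by rewrite Rmult_plus_distr_r exp_plus; ring.
by rewrite Cmod_mult; apply: Rmult_le_compat; try exact: Cmod_ge_0; [exact: h1|exact: h2].
Qed.

Lemma exp_type_exp (w : C) : exp_type (fun s => Cexp (s * w)).
Proof.
split=> [S hS|sigma T hT].
  by apply: Apx_exp => //; apply: Apx_mult => //; [exact: Apx_id|exact: Apx_const].
exists (Cmod w), (exp (Cmod w * (2 * Rabs sigma + T))); split.
- exact: Cmod_ge_0.
- exact/Rlt_le/exp_pos.
- by move=> s h1 h2; exact: Cexp_strip.
Qed.

Lemma exp_type_rgamma (c : C) : exp_type (fun s => rgamma (c + s)).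
Proof.
split=> [S hS|sigma T hT].
  by apply: Apx_rgamma => //; apply: Apx_plus; [exact: Apx_const|exact: Apx_id].
have hc := Cmod_ge_0 c; have hsig := Rabs_pos sigma.
have hsig2 := Rle_abs (- sigma); rewrite Rabs_Ropp in hsig2.
have [M [hM0 hM]] := rgamma_decay (Cmod c + T + Rabs sigma) 0 (Rle_refl _).
exists 0%R, M; split => //; first lra.
move=> s h1 h2; have h3 := Re_bnd c; have h4 := Im_le_Cmod c.
apply: Rle_trans (hM (c + s) _ _) _.
- by rewrite ImD; apply: Rle_trans (Rabs_triang _ _) _; lra.
- by rewrite ReD; lra.
- by rewrite !Rmult_0_l Ropp_0; lra.
Qed.

Lemma exp_type_const (c : C) : exp_type (fun=> c).
Proof.
split=> [S hS|sigma T hT]; first exact: Apx_const.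
exists 0%R, (Cmod c); split; [lra|exact: Cmod_ge_0|] => s _ _.
by rewrite Rmult_0_l exp_0; lra.
Qed.

Lemma exp_type_rgammas (q : seq C) : exp_type (fun s => Cprod [seq rgamma (c + s) | c <- q]).
Proof.
elim: q => [|c q IH] /=; first exact: exp_type_const.
by apply: exp_type_mult => //; exact: exp_type_rgamma.
Qed.

Lemma row_value (b : C) (E : C -> C) (sigma T : R) : exp_type E -> (sigma < Re b)%R -> (Rabs (Im b) < T)%R ->
  exists v, is_loop_integral (fun s => Cgamma (b - s) * E s) sigma T v /\
    Clim (fun n => 2 * PI * Ci * sum_n (res_term b E) n) v.
Proof.
move=> [e1 e2] hb1 hb2.
have hT : (0 <= T)%R by have := Rabs_pos (Im b); lra.
have [A [K [hA hK hEb]]] := e2 sigma T hT.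
pose tau := Rmin (Re b - sigma) (T - Rabs (Im b)).
have ht : (0 < tau)%R by apply: Rmin_pos; lra.
have ht1 : (tau <= Re b - sigma)%R by apply: Rmin_l.
have ht2 : (tau <= T - Rabs (Im b))%R by apply: Rmin_r.
have hbc := Cmod_ge_0 b; have hsig := Rabs_pos sigma.
have hsig2 := Rle_abs (- sigma); rewrite Rabs_Ropp in hsig2.
have [M [hM0 hM]] := gamma_decay (Cmod b + T + Rabs sigma) (A + 1) tau ltac:(lra) ht.
have hM1 : (0 <= M * exp ((A + 1) * Re b) * K)%R.
  by apply: Rmult_le_pos => //; apply: Rmult_le_pos => //; apply/Rlt_le/exp_pos.
have [v hv] : exists v, is_loop_integral (fun s => Cgamma (b - s) * E s) sigma T v.
  apply: (loop_exists _ _ _ (M * exp ((A + 1) * Re b) * K)%R hT hM1).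
    apply: loop_Apx_mult; first exact: loop_Apx_gamma.
    by apply: loop_Apx_all.
  move=> s hs; have hi := loop_pt_Im _ _ _ hT hs; have hs1 : (sigma <= Re s)%R by case: hs.
  have h3 := Re_bnd b; have h4 := Im_le_Cmod b.
  have -> : (M * exp ((A + 1) * Re b) * K * exp (- Re s) =
       (M * exp ((A + 1) * (Re b - Re s))) * (K * exp (A * Re s)))%R.
    have -> : ((A + 1) * (Re b - Re s) = (A + 1) * Re b + - Re s + - (A * Re s))%R by ring.
    rewrite !exp_plus (exp_Ropp (A * Re s)); have := exp_pos (A * Re s) => hp.
    by field; lra.
  rewrite Cmod_mult; apply: Rmult_le_compat; try exact: Cmod_ge_0; last exact: hEb.
  apply: (hM (b - s)).
  - by rewrite ImB; apply: Rle_trans (Rabs_triang _ _) _; rewrite Rabs_Ropp; lra.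
  - by rewrite ReB; lra.
  - by move=> j; apply: (loop_dist sigma T).
exists v; split => //.
exact: (row_residues b E sigma T A K v e1 hb2 hb1 hA hK hEb hv).
Qed.

(** * Complex logarithm *)

Lemma Carg_bound (z : C) : (- PI <= Carg z <= PI)%R.
Proof.
rewrite /Carg; have [h1 h2] := acos_bound (Re z / Cmod z); have hp := PI_RGT_0.
by case: (Rle_dec 0 (Im z)) => h /=; lra.
Qed.

Lemma Cexp_Clog (z : C) : z <> 0 -> Cexp (Clog z) = z.
Proof.
move=> hz; have hm : (0 < Cmod z)%R by apply/Cmod_gt_0.
have hq : (-1 <= Re z / Cmod z <= 1)%R.
  by have := Re_bnd z => h; split; [apply/Rle_div_r => //; lra|apply/Rle_div_l => //; lra].
have e1 : (Cmod z * Cmod z = Re z ^ 2 + Im z ^ 2)%R by rewrite -Cmod2_alt /= Rmult_1_r.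
have hsin : (Cmod z * sin (acos (Re z / Cmod z)) = Rabs (Im z))%R.
  rewrite sin_acos // -{1}(sqrt_square (Cmod z)); last exact: Cmod_ge_0.
  rewrite -sqrt_mult_alt; last by apply: Rmult_le_pos; lra.
  have -> : (Cmod z * Cmod z * (1 - (Re z / Cmod z)²) = (Im z)²)%R.
    have -> : (Cmod z * Cmod z * (1 - (Re z / Cmod z)²) = Cmod z * Cmod z - Re z ^ 2)%R by rewrite /Rsqr; field; lra.
    by rewrite e1 /Rsqr; ring.
  exact: sqrt_Rsqr_abs.
apply: C_eq; rewrite /Cexp /Clog !ReImE exp_ln // /Carg.
  by case: Rle_dec => h /=; rewrite ?cos_neg cos_acos //; field; lra.
case: Rle_dec => h /=; rewrite ?sin_neg.
  by rewrite hsin Rabs_pos_eq.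
by rewrite Ropp_mult_distr_r_reverse hsin Rabs_left; lra.
Qed.

Lemma Clog_Cexp (u : C) : (- PI < Im u <= PI)%R -> Clog (Cexp u) = u.
Proof.
move=> [h1 h2]; rewrite /Clog Cmod_Cexp ln_exp.
apply: C_eq; rewrite !ReImE // /Carg Cmod_Cexp /Cexp !ReImE.
have he := exp_pos (Re u).
have -> : (exp (Re u) * cos (Im u) / exp (Re u) = cos (Im u))%R by field; lra.
case: (Rle_dec 0 (Im u)) => h3.
  have hs : (0 <= sin (Im u))%R by apply: sin_ge_0; lra.
  case: Rle_dec => h4 /=; first by rewrite acos_cos; lra.
  by exfalso; apply: h4; apply: Rmult_le_pos; lra.
have hs : (sin (Im u) < 0)%R by have := sin_gt_0 (- Im u) ltac:(lra) ltac:(lra); rewrite sin_neg; lra.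
case: Rle_dec => h4 /=; first by exfalso; nra.
by rewrite -(cos_neg (Im u)) acos_cos; lra.
Qed.

(** Halving the argument keeps it inside the principal range, so no multiple of [2 i PI] appears. *)
Lemma Clog_Csqrt (z : C) : z <> 0 -> Clog (Csqrt z) = / 2 * Clog z.
Proof.
move=> hz; rewrite /Csqrt /Cpower.
have h2 := C2_neq0; have -> : 1 / 2 * Clog z = / 2 * Clog z by field.
apply: Clog_Cexp; have := Carg_bound z; have := PI_RGT_0.
have -> : / RtoC 2 = RtoC (/ 2) by rewrite RtoC_inv; [|lra].
by rewrite /Clog !ReImE; lra.
Qed.

Lemma Clog_div4 (z : C) : z <> 0 -> Clog (z / 4) = Clog z - ln 4.
Proof.
move=> hz; have hm : (0 < Cmod z)%R by apply/Cmod_gt_0.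
have h4 : RtoC 4 <> 0 by move/RtoC_inj; lra.
have e : z / 4 = RtoC (/ 4) * z by rewrite RtoC_inv; [rewrite /Cdiv Cmult_comm|lra].
have hc : Cmod (z / 4) = (/ 4 * Cmod z)%R by rewrite e Cmod_mult Cmod_R Rabs_pos_eq; lra.
rewrite /Clog hc; apply: C_eq; rewrite !ReImE.
  by rewrite ln_mult; [rewrite ln_Rinv; lra|lra|lra].
rewrite /Carg hc e !ReImE !Rmult_0_l Rminus_0_r Rplus_0_r Rminus_0_r.
have -> : (/ 4 * Re z / (/ 4 * Cmod z) = Re z / Cmod z)%R by field; lra.
by case: Rle_dec => h1 /=; case: Rle_dec => h2 //=; lra.
Qed.

(** * Punctured limits in the parameter *)

Definition clim_at (g : C -> C) (m0 V : C) : Prop :=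
  forall e, (0 < e)%R -> exists d, (0 < d)%R /\
    forall m, m <> m0 -> (Cmod (m - m0) < d)%R -> (Cmod (g m - V) <= e)%R.

Lemma clim_at_filterlim (g : C -> C) (m0 V : C) : clim_at g m0 V -> filterlim g (locally' (m0 : C_UniformSpace)) (locally (V : C_UniformSpace)).
Proof.
move=> hg; apply/filterlim_locally => e.
have [d [hd h]] := hg (e / 2)%R ltac:(have := cond_pos e; lra).
have hd2 : (0 < d / 2)%R by lra.
exists (mkposreal _ hd2) => m hm hne.
apply: (C_NormedModule_mixin_compat1 V (g m) e).
have := C_NormedModule_mixin_compat2 m0 m (mkposreal _ hd2) hm; rewrite /= => h1.
have h2 : (sqrt 2 * (d / 2) <= d)%R.
  suff : (sqrt 2 <= 2)%R by nra.
  by rewrite -{2}(sqrt_square 2); [apply: sqrt_le_1_alt; lra|lra].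
have h3 : (Cmod (m - m0) < d)%R by apply: Rlt_le_trans h2.
have := h m hne h3; have := cond_pos e.
have -> : minus (g m) V = g m - V by [].
lra.
Qed.

Lemma punctured_point (m0 : C) (d : R) : (0 < d)%R -> m0 + (d / 2)%R <> m0 /\ (Cmod (m0 + (d / 2)%R - m0) < d)%R.
Proof.
move=> hd; have e : m0 + (d / 2)%R - m0 = (d / 2)%R by ring.
split; last by rewrite e Cmod_R Rabs_pos_eq; lra.
by move=> h; move: e; rewrite h /Cminus Cplus_opp_r => /RtoC_inj; lra.
Qed.

Lemma Proper_Clocally' (m0 : C) : ProperFilter' (locally' (m0 : C_UniformSpace)).
Proof.
split; last exact: locally'_filter.
move=> [e he].
have he2 : (0 < e / 2)%R by have := cond_pos e; lra.
have [h1 h2] := punctured_point m0 e (cond_pos e).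
apply: (he (m0 + (e / 2)%R)) => //.
exact: (C_NormedModule_mixin_compat1 m0 (m0 + (e / 2)%R) e h2).
Qed.

Lemma Climit_at (g : C -> C) (m0 V : C) : clim_at g m0 V -> Climit (locally' (m0 : C_UniformSpace)) g = V.
Proof.
move=> /clim_at_filterlim h; rewrite /Climit.
exact: (@iota_filterlim_locally R_AbsRing C_R_CompleteNormedModule _ _ (Proper_Clocally' m0) g V h).
Qed.

Lemma clim_at_unique (g : C -> C) (m0 V W : C) : clim_at g m0 V -> clim_at g m0 W -> V = W.
Proof. by move=> /Climit_at <- /Climit_at <-. Qed.

Lemma clim_at_ext (f g : C -> C) (m0 V : C) (d : R) : (0 < d)%R ->
  (forall m, m <> m0 -> (Cmod (m - m0) < d)%R -> f m = g m) -> clim_at f m0 V -> clim_at g m0 V.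
Proof.
move=> hd h hf e he; have [d' [hd' h']] := hf e he.
exists (Rmin d d'); split; first exact: Rmin_pos.
move=> m hne hm; have m1 := Rmin_l d d'; have m2 := Rmin_r d d'.
by rewrite -h //; [apply: h' => //|]; lra.
Qed.

Lemma clim_at_const (c m0 : C) : clim_at (fun=> c) m0 c.
Proof. by move=> e he; exists 1%R; split; [lra|move=> m _ _; rewrite /Cminus Cplus_opp_r Cmod_0; lra]. Qed.

Lemma clim_at_plus (f g : C -> C) (m0 V W : C) : clim_at f m0 V -> clim_at g m0 W -> clim_at (fun m => f m + g m) m0 (V + W).
Proof.
move=> hf hg e he.
have [d1 [hd1 h1]] := hf (e / 2)%R ltac:(lra); have [d2 [hd2 h2]] := hg (e / 2)%R ltac:(lra).
exists (Rmin d1 d2); split; first exact: Rmin_pos.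
move=> m hne hm; have m1 := Rmin_l d1 d2; have m2 := Rmin_r d1 d2.
have -> : f m + g m - (V + W) = (f m - V) + (g m - W) by ring.
have := h1 m hne ltac:(lra); have := h2 m hne ltac:(lra); have := Cmod_triangle (f m - V) (g m - W); lra.
Qed.

Lemma clim_at_mult (f g : C -> C) (m0 V W : C) : clim_at f m0 V -> clim_at g m0 W -> clim_at (fun m => f m * g m) m0 (V * W).
Proof.
move=> hf hg e he.
have hV := Cmod_ge_0 V; have hW := Cmod_ge_0 W.
have [d0 [hd0 h0]] := hf 1%R Rlt_0_1.
have [d1 [hd1 h1]] := hf (e / (2 * (Cmod W + 1)))%R ltac:(apply: Rdiv_lt_0_compat; lra).
have [d2 [hd2 h2]] := hg (e / (2 * (Cmod V + 1)))%R ltac:(apply: Rdiv_lt_0_compat; lra).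
exists (Rmin d0 (Rmin d1 d2)); split; first by apply: Rmin_pos => //; exact: Rmin_pos.
move=> m hne hm; have m1 := Rmin_l d1 d2; have m2 := Rmin_r d1 d2.
have m3 := Rmin_l d0 (Rmin d1 d2); have m4 := Rmin_r d0 (Rmin d1 d2).
have k0 := h0 m hne ltac:(lra); have k1 := h1 m hne ltac:(lra); have k2 := h2 m hne ltac:(lra).
have -> : f m * g m - V * W = f m * (g m - W) + (f m - V) * W by ring.
apply: Rle_trans (Cmod_triangle _ _) _; rewrite !Cmod_mult.
have k3 := Cmod_rev (f m) V.
have t1 : (Cmod (f m) * Cmod (g m - W) <= (Cmod V + 1) * (e / (2 * (Cmod V + 1))))%R.
  by apply: Rmult_le_compat; try exact: Cmod_ge_0; lra.
have t2 : (Cmod (f m - V) * Cmod W <= (e / (2 * (Cmod W + 1))) * (Cmod W + 1))%R.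
  by apply: Rmult_le_compat; try exact: Cmod_ge_0; lra.
have e1 : ((Cmod V + 1) * (e / (2 * (Cmod V + 1))) = e / 2)%R by field; lra.
have e2 : ((e / (2 * (Cmod W + 1))) * (Cmod W + 1) = e / 2)%R by field; lra.
lra.
Qed.

Lemma clim_at_Cexp (c m0 : C) : clim_at (fun m => Cexp (c * m)) m0 (Cexp (c * m0)).
Proof.
move=> e he; set E0 := Cmod (Cexp (c * m0)).
have hE0 : (0 <= E0)%R := Cmod_ge_0 _; have hc := Cmod_ge_0 c.
pose d := Rmin (/ (2 * (Cmod c + 1))) (e / (5 * (E0 + 1) * (Cmod c + 1))).
have hd1 : (0 < / (2 * (Cmod c + 1)))%R by apply: Rinv_0_lt_compat; lra.
have hd2 : (0 < e / (5 * (E0 + 1) * (Cmod c + 1)))%R by apply: Rdiv_lt_0_compat => //; apply: Rmult_lt_0_compat; lra.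
exists d; split; first exact: Rmin_pos.
move=> m _ hm; set u := c * (m - m0).
have m1 : (d <= / (2 * (Cmod c + 1)))%R := Rmin_l _ _.
have m2 : (d <= e / (5 * (E0 + 1) * (Cmod c + 1)))%R := Rmin_r _ _.
have hu : (Cmod u <= (Cmod c + 1) * d)%R.
  by rewrite /u Cmod_mult; apply: Rmult_le_compat; try exact: Cmod_ge_0; lra.
have hu1 : (Cmod u <= 1 / 2)%R.
  apply: Rle_trans hu _; apply: Rle_trans (Rmult_le_compat_l (Cmod c + 1) _ _ ltac:(lra) m1) _.
  by apply: Req_le; field; lra.
have hu2 : (5 * (E0 + 1) * Cmod u <= e)%R.
  have := Rmult_le_compat_l (Cmod c + 1) _ _ ltac:(lra) m2 => h.
  apply: Rle_trans (_ : 5 * (E0 + 1) * ((Cmod c + 1) * (e / (5 * (E0 + 1) * (Cmod c + 1)))) <= _)%R.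
    by apply: Rmult_le_compat_l; lra.
  by apply: Req_le; field; lra.
have -> : Cexp (c * m) - Cexp (c * m0) = Cexp (c * m0) * ((Cexp u - 1 - u) + u).
  have -> : c * m = c * m0 + u by rewrite /u; ring.
  by rewrite Cexp_plus; ring.
rewrite Cmod_mult -/E0.
have hq := Cexp_quadratic u hu1; have h3 := Cmod_triangle (Cexp u - 1 - u) u.
have h4 := Cmod_ge_0 u.
have h5 : (Cmod (Cexp u - 1 - u + u) <= 5 * Cmod u)%R by nra.
apply: Rle_trans (Rmult_le_compat_l _ _ _ hE0 h5) _; nra.
Qed.

Lemma cont_at_affine (a b m0 : C) : cont_at (fun m => a * m + b) m0.
Proof.
move=> e he; have ha := Cmod_ge_0 a.
exists (e / (Cmod a + 1))%R; split; first by apply: Rdiv_lt_0_compat; lra.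
move=> m hm; have -> : a * m + b - (a * m0 + b) = a * (m - m0) by ring.
rewrite Cmod_mult.
have : (Cmod a * Cmod (m - m0) <= (Cmod a + 1) * (e / (Cmod a + 1)))%R.
  by apply: Rmult_le_compat; try exact: Cmod_ge_0; lra.
have -> : ((Cmod a + 1) * (e / (Cmod a + 1)) = e)%R by field; lra.
by [].
Qed.

Lemma cont_at_ext (f g : C -> C) (m0 : C) : (forall m, f m = g m) -> cont_at f m0 -> cont_at g m0.
Proof. by move=> h hf e he; have [d [hd h1]] := hf e he; exists d; split => // m hm; rewrite -!h; exact: h1. Qed.

(** A total value function, chosen once, lets loop integrals be passed to limits in the parameter
    without carrying existence proofs along. *)
Lemma loop_fun (f : C -> C -> C) (sigma T : R) : exists V : C -> C,
  forall m, (exists v, is_loop_integral (f m) sigma T v) -> is_loop_integral (f m) sigma T (V m).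
Proof.
have H m : exists v, (exists v, is_loop_integral (f m) sigma T v) -> is_loop_integral (f m) sigma T v.
  case: (ClassicalEpsilon.excluded_middle_informative (exists v, is_loop_integral (f m) sigma T v)) => [[v hv]|h].
    by exists v.
  by exists 0.
by have [V hV] := ClassicalEpsilon.choice _ H; exists V.
Qed.

Lemma tame_clim (sigma T : R) (m0 v0 : C) (f : C -> C -> C) (V : C -> C) : (0 <= T)%R -> tame sigma T m0 f ->
  (forall m, (exists v, is_loop_integral (f m) sigma T v) -> is_loop_integral (f m) sigma T (V m)) ->
  is_loop_integral (f m0) sigma T v0 -> clim_at V m0 v0.
Proof.
move=> hT hf hV hv0 e he.
have [d1 [hd1 h1]] := tame_exists _ _ _ _ hT hf.
have [d2 [hd2 h2]] := tame_limit _ _ _ _ e hT hf he.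
exists (Rmin d1 d2); split; first exact: Rmin_pos.
move=> m _ hm; have m1 := Rmin_l d1 d2; have m2 := Rmin_r d1 d2.
apply: (h2 m) => //; first lra.
by apply: hV; apply: h1; lra.
Qed.

(** By the reflection formula a zero of the sine is a zero of [rgamma z] or of [rgamma (1 - z)], and
    these vanish only at poles of Gamma, which are integers. *)
Lemma Csin_eq0 (z : C) : Csin (PI * z) = 0 -> is_Cint z.
Proof.
move=> h; have hP : RtoC PI <> 0 by move/RtoC_inj; have := PI_RGT_0; lra.
have := rgamma_reflection z; rewrite h /Cdiv Cmult_0_l => e.
case: (pole_dec z) => [[j hj]|hz].
  exists (- Z.of_nat j)%Z; rewrite opp_IZR -INR_IZR_INZ RtoC_opp.
  by rewrite -(Cplus_0_r (- INR j)) -hj; ring.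
case: (pole_dec (1 - z)) => [[j hj]|hz1].
  exists (Z.of_nat j.+1); rewrite -INR_IZR_INZ S_INR RtoC_plus.
  by rewrite -(Cplus_0_r z) -hj; ring.
by exfalso; apply: (rgamma_neq0 _ hz1); apply: (Cmult_integral_l (rgamma z)) => //; apply: rgamma_neq0.
Qed.

(** Used with [c = 1] for the orders of Bessel functions and with [c = 2] for [nu], whence the range
    of [Cmod c]. *)
Lemma Cint_isolated (c m0 : C) : (1 <= Cmod c <= 2)%R -> is_Cint (c * m0) ->
  forall m, m <> m0 -> (Cmod (m - m0) < 1 / 2)%R -> ~ is_Cint (c * m).
Proof.
move=> hc [n hn] m hne hm [k hk].
have e : c * (m - m0) = IZR (k - n) by rewrite minus_IZR RtoC_minus -hk -hn; ring.
have h1 : (Cmod (c * (m - m0)) < 1)%R by rewrite Cmod_mult; have := Cmod_ge_0 (m - m0); nra.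
have hkn : (k - n = 0)%Z.
  move: h1; rewrite e Cmod_R -abs_IZR => /lt_IZR; lia.
apply: hne; move: e; rewrite hkn => e.
have hc0 : c <> 0 by apply/Cmod_gt_0; lra.
have h2 := Cmult_integral_l c (m - m0) hc0 e.
by rewrite -(Cplus_0_l m0) -h2; ring.
Qed.

Lemma extend_eq (f : C -> C) (mu V : C) : (~ is_Cint mu -> f mu = V) -> (is_Cint mu -> clim_at f mu V) ->
  extend_at_integers f mu = V.
Proof.
move=> h1 h2; rewrite /extend_at_integers.
case: ClassicalEpsilon.excluded_middle_informative => h; last exact: h1.
exact: Climit_at (h2 h).
Qed.

(** * Bessel functions as loop integrals *)

Lemma sum_n_Cmult (c : C) (a : nat -> C) (n : nat) : sum_n (fun k => c * a k) n = c * sum_n a n.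
Proof.
elim: n => [|n IH]; first by rewrite !sum_O.
by rewrite !sum_Sn IH; exact: (esym (Cmult_plus_distr_l c _ _)).
Qed.

Lemma Clim_sum_scal (c : C) (a b : nat -> C) (l : C) : (forall k, b k = c * a k) ->
  Clim (fun n => sum_n a n) l -> Clim (fun n => sum_n b n) (c * l).
Proof.
move=> h hl; apply: (Clim_ext _ _ _ 0) (Clim_mult _ _ _ _ (Clim_const c) hl) => n _.
by rewrite -sum_n_Cmult; apply: sum_n_ext => k; rewrite h.
Qed.

Lemma Clim_sum_unscal (c : C) (a b : nat -> C) (l : C) : c <> 0 -> (forall k, b k = c * a k) ->
  Clim (fun n => sum_n b n) l -> Clim (fun n => sum_n a n) (/ c * l).
Proof.
move=> hc h hl; apply: Clim_sum_scal hl => k; rewrite h; field; exact: hc.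
Qed.

(** The [k]-th term of the series of the modified function I of order [mu], with [w] for
    [2 log (z / 2)]. Being a function of the logarithm, it can be rotated by [i PI], which turns it,
    up to a constant factor, into a term of J. *)
Definition bessel_term (mu w : C) (k : nat) : C :=
  / INR k`! * rgamma (1 + mu + INR k) * Cexp ((mu / 2 + INR k) * w).

Lemma Clog_pow (z mu : C) (k : nat) : z <> 0 ->
  Cpower z mu * z ^ (2 * k) = Cexp ((mu / 2 + INR k) * (2 * Clog z)).
Proof.
move=> hz; have h2 := C2_neq0.
have -> : z ^ (2 * k) = Cexp (INR (2 * k) * Clog z) by rewrite Cexp_nat Cexp_Clog.
rewrite /Cpower -Cexp_plus; congr Cexp.
have -> : INR (2 * k) = (2 * INR k)%R by rewrite mult_INR.
by rewrite RtoC_mult; field.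
Qed.

Lemma besselI_eq (mu z A : C) : z / 2 <> 0 ->
  Clim (fun n => sum_n (bessel_term mu (2 * Clog (z / 2))) n) A -> besselI mu z = A.
Proof.
move=> hz hA; rewrite /besselI /Cseries.
have hp : Cpower (z / 2) mu <> 0 by apply: Cexp_neq0.
rewrite (Climit_eventually _ (/ Cpower (z / 2) mu * A)); first by field.
apply: (Clim_sum_unscal _ _ _ _ hp) hA => k.
rewrite /bessel_term -Clog_pow // /rgamma.
have -> : 1 + mu + INR k = mu + INR k + 1 by ring.
by rewrite /Cdiv Cinv_mul Cmult_1_l; ring.
Qed.

Lemma besselJ_eq (mu z A : C) : z / 2 <> 0 ->
  Clim (fun n => sum_n (fun k => (- (1)) ^ k * bessel_term mu (2 * Clog (z / 2)) k) n) A -> besselJ mu z = A.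
Proof.
move=> hz hA; rewrite /besselJ /Cseries.
have hp : Cpower (z / 2) mu <> 0 by apply: Cexp_neq0.
rewrite (Climit_eventually _ (/ Cpower (z / 2) mu * A)); first by field.
apply: (Clim_sum_unscal _ _ _ _ hp) hA => k.
rewrite /bessel_term -Clog_pow // /rgamma.
have -> : 1 + mu + INR k = mu + INR k + 1 by ring.
by rewrite /Cdiv Cinv_mul; ring.
Qed.

Lemma Cexp_kpi (k : nat) : Cexp (INR k * (Ci * PI)) = (- (1)) ^ k.
Proof. by rewrite Cexp_nat Cexp_iPI. Qed.

Lemma bessel_term_plus (mu w : C) (k : nat) :
  (- (1)) ^ k * bessel_term mu (w + Ci * PI) k = Cexp (Ci * (PI * (mu / 2))) * bessel_term mu w k.
Proof.
rewrite /bessel_term.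
have -> : (mu / 2 + INR k) * (w + Ci * PI) = Ci * (PI * (mu / 2)) + (INR k * (Ci * PI) + (mu / 2 + INR k) * w) by ring.
rewrite !Cexp_plus Cexp_kpi.
have e : (- (1)) ^ k * (- (1)) ^ k = 1.
  by rewrite -{1}m1_pow_inv; apply: Cinv_l; apply: Cpow_nz => h; have := f_equal Re h; rewrite !ReImE; lra.
set a := _ ^ k in e *; set X := / _ * _; set Y := Cexp _; set Z := Cexp _.
have -> : a * (X * (Y * (a * Z))) = (a * a) * (X * (Y * Z)) by ring.
by rewrite e; ring.
Qed.

Lemma bessel_term_minus (mu w : C) (k : nat) :
  (- (1)) ^ k * bessel_term mu w k = Cexp (Ci * (PI * (mu / 2))) * bessel_term mu (w - Ci * PI) k.
Proof.
rewrite -bessel_term_plus; congr (_ * bessel_term _ _ _); ring.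
Qed.

Lemma loop_rgamma_neq0 (sigma T : R) (b s : C) : (sigma < Re b)%R -> (Rabs (Im b) < T)%R -> loop_pt sigma T s -> rgamma (b - s) <> 0.
Proof.
move=> h1 h2 hs; apply: rgamma_neq0 => -[j hj].
pose tau := Rmin (Re b - sigma) (T - Rabs (Im b)).
have ht : (0 < tau)%R by apply: Rmin_pos; lra.
have := loop_dist sigma T tau b s j (Rmin_l _ _) (Rmin_r _ _) hs.
by rewrite hj Cmod_0; lra.
Qed.

(* With [w = 2 log (z / 2)], the functions K, Y and J of order [mu] at [z] are
   combinations of the loop integrals of [Lint mu] at [w] and [w +- i PI]; this
   also covers the integral orders, where K and Y are defined as limits. *)
Definition Lint (mu w s : C) : C := Cgamma (mu / 2 - s) * Cgamma (- (mu / 2) - s) * Cexp (s * w).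

Definition loop_around (mu : C) (sigma T : R) : Prop :=
  [/\ (sigma < Re (mu / 2))%R, (sigma < Re (- (mu / 2)))%R & (Rabs (Im (mu / 2)) < T)%R].

Lemma loop_around_opp (mu : C) (sigma T : R) : loop_around mu sigma T -> loop_around (- mu) sigma T.
Proof.
move=> [h1 h2 h3].
have e : - mu / 2 = - (mu / 2) by rewrite /Cdiv; ring.
by split; rewrite e // ?ImN ?Rabs_Ropp //; have -> : - - (mu / 2) = mu / 2 by ring.
Qed.

Lemma loop_around_pos (mu : C) (sigma T : R) : loop_around mu sigma T -> (0 <= T)%R.
Proof. by move=> [_ _ h]; have := Rabs_pos (Im (mu / 2)); lra. Qed.

Lemma loop_around_near (mu : C) (sigma T : R) : loop_around mu sigma T ->
  exists d, (0 < d)%R /\ forall m, (Cmod (m - mu) < d)%R -> loop_around m sigma T.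
Proof.
move=> [h1 h2 h3].
pose d := Rmin (Rmin (Re (mu / 2) - sigma) (Re (- (mu / 2)) - sigma)) (T - Rabs (Im (mu / 2))).
have d1 : (d <= Re (mu / 2) - sigma)%R by apply: Rle_trans (Rmin_l _ _) (Rmin_l _ _).
have d2 : (d <= Re (- (mu / 2)) - sigma)%R by apply: Rle_trans (Rmin_l _ _) (Rmin_r _ _).
have d3 : (d <= T - Rabs (Im (mu / 2)))%R by apply: Rmin_r.
have hd : (0 < d)%R by apply: Rmin_pos; [apply: Rmin_pos|]; lra.
exists d; split => // m hm; have c2 := C2_neq0.
have hx : m / 2 = mu / 2 + (m - mu) / 2 by field.
have hb : (Cmod ((m - mu) / 2) < d)%R.
  rewrite Cmod_div // Cmod_R Rabs_pos_eq; last lra.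
  by have := Cmod_ge_0 (m - mu); lra.
have k1 := Re_bnd ((m - mu) / 2); have k2 := Im_le_Cmod ((m - mu) / 2).
rewrite ReN in d2 h2; split; rewrite hx.
- by rewrite ReD; lra.
- by rewrite ReN ReD; lra.
- by rewrite ImD; apply: Rle_lt_trans (Rabs_triang _ _) _; lra.
Qed.

Lemma Lint_tame (mu w : C) (sigma T : R) : loop_around mu sigma T -> tame sigma T mu (fun m => Lint m w).
Proof.
move=> h; have hT := loop_around_pos _ _ _ h; case: h => [h1 h2 h3].
have c2 := C2_neq0.
apply: tame_mult_exp => //; apply: tame_mult.
  apply: (tame_gamma sigma T mu (fun m => m / 2)) => //.
  by apply: (cont_at_ext (fun m => / 2 * m + 0)) => [m|]; [field|exact: cont_at_affine].
apply: (tame_gamma sigma T mu (fun m => - (m / 2))) => //; first by rewrite ImN Rabs_Ropp.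
by apply: (cont_at_ext (fun m => - / 2 * m + 0)) => [m|]; [field|exact: cont_at_affine].
Qed.

Lemma Lint_exists (mu w : C) (sigma T : R) : loop_around mu sigma T -> exists v, is_loop_integral (Lint mu w) sigma T v.
Proof.
move=> h; have [d [hd H]] := tame_exists _ _ _ _ (loop_around_pos _ _ _ h) (Lint_tame mu w sigma T h).
exact: (H mu (Cmod_diag_lt mu d hd)).
Qed.

(** An integrand with a single row of poles, whose residue series is that of J of order [mu]. *)
Definition bessel_row (mu w s : C) : C := Cgamma (mu / 2 - s) * (rgamma (1 + mu / 2 + s) * Cexp (s * w)).

Lemma bessel_row_value (mu w : C) (sigma T : R) : (sigma < Re (mu / 2))%R -> (Rabs (Im (mu / 2)) < T)%R ->
  exists v, is_loop_integral (bessel_row mu w) sigma T v /\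
    Clim (fun n => 2 * PI * Ci * sum_n (fun k => (- (1)) ^ k * bessel_term mu w k) n) v.
Proof.
move=> h1 h2.
have he : exp_type (fun s => rgamma (1 + mu / 2 + s) * Cexp (s * w)).
  by apply: exp_type_mult; [exact: exp_type_rgamma|exact: exp_type_exp].
have [v [hv hl]] := row_value _ _ sigma T he h1 h2.
exists v; split => //; apply: (Clim_ext _ _ _ 0) hl => n _; congr (_ * _).
apply: sum_n_ext => k; change (res_term (mu / 2) (fun s => rgamma (1 + mu / 2 + s) * Cexp (s * w)) k = (- (1)) ^ k * bessel_term mu w k).
rewrite /res_term /bessel_term; have c2 := C2_neq0.
have -> : 1 + mu / 2 + (mu / 2 + INR k) = 1 + mu + INR k by field.
ring.
Qed.

Lemma twoPiI_neq0 : 2 * PI * Ci <> 0.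
Proof.
apply: Cmult_neq_0; last exact: Ci_neq0.
apply: Cmult_neq_0; first exact: C2_neq0.
by move/RtoC_inj; have := PI_RGT_0; lra.
Qed.

Lemma PIc_neq0 : RtoC PI <> 0.
Proof. by move/RtoC_inj; have := PI_RGT_0; lra. Qed.

Lemma bessel_row_sum (mu w v : C) (sigma T : R) : (sigma < Re (mu / 2))%R -> (Rabs (Im (mu / 2)) < T)%R ->
  is_loop_integral (bessel_row mu w) sigma T v ->
  Clim (fun n => sum_n (fun k => (- (1)) ^ k * bessel_term mu w k) n) (v / (2 * PI * Ci)).
Proof.
move=> h1 h2 hv; have [v' [hv' hl]] := bessel_row_value mu w sigma T h1 h2.
rewrite (loop_unique _ _ _ _ _ hv hv') /Cdiv Cmult_comm.
have hp := twoPiI_neq0.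
apply: (Clim_ext _ _ _ 0) (Clim_mult _ _ _ _ (Clim_const (/ (2 * PI * Ci))) hl) => n _.
rewrite Cmult_assoc Cinv_l // Cmult_1_l //.
Qed.

Lemma sin_diff_exp (x y : C) : Csin (x - y) = Csin x * Cexp (- (Ci * y)) - Csin y * Cexp (- (Ci * x)).
Proof.
have e u : Cexp (- (Ci * u)) = Ccos u - Ci * Csin u.
  have -> : - (Ci * u) = Ci * (- u) by ring.
  by rewrite Cexpi_trig Csin_opp Ccos_opp; ring.
by rewrite !e Csin_minus; ring.
Qed.

Lemma rgamma_reflection_sub (b s : C) : rgamma (b - s) * rgamma (1 - b + s) = Csin (PI * (b - s)) / PI.
Proof. by rewrite -rgamma_reflection; congr (_ * rgamma _); ring. Qed.

(** [PI * mu] is the difference of the angles [PI (mu / 2 - s)] and [PI (- mu / 2 - s)]. By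
    [sin_diff_exp] its sine is a sum of two terms, each with the sine of one of these angles, which
    reflects one Gamma factor away; the remaining [exp (i PI s)] moves [w] to [w + i PI]. *)
Lemma Lint_split (mu w s : C) : rgamma (mu / 2 - s) <> 0 -> rgamma (- (mu / 2) - s) <> 0 ->
  Csin (PI * mu) * Lint mu w s =
  PI * Cexp (Ci * (PI * (mu / 2))) * bessel_row (- mu) (w + Ci * PI) s +
  - (PI * Cexp (- (Ci * (PI * (mu / 2))))) * bessel_row mu (w + Ci * PI) s.
Proof.
move=> h1 h2; have hP := PIc_neq0; have c2 := C2_neq0.
have r1 := rgamma_reflection_sub (mu / 2) s; have r2 := rgamma_reflection_sub (- (mu / 2)) s.
have e0 : PI * mu = PI * (mu / 2 - s) - PI * (- (mu / 2) - s) by field.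
have e1 : Cexp (- (Ci * (PI * (- (mu / 2) - s)))) = Cexp (Ci * (PI * (mu / 2))) * Cexp (s * (Ci * PI)).
  by rewrite -Cexp_plus; congr Cexp; ring.
have e2 : Cexp (- (Ci * (PI * (mu / 2 - s)))) = Cexp (- (Ci * (PI * (mu / 2)))) * Cexp (s * (Ci * PI)).
  by rewrite -Cexp_plus; congr Cexp; ring.
have e3 : Cexp (s * (w + Ci * PI)) = Cexp (s * w) * Cexp (s * (Ci * PI)).
  by rewrite -Cexp_plus; congr Cexp; ring.
rewrite {1}e0 sin_diff_exp e1 e2 /bessel_row /Lint e3 -!rgamma_inv.
have -> : - mu / 2 = - (mu / 2) by rewrite /Cdiv; ring.
have s1 : Csin (PI * (mu / 2 - s)) = PI * (rgamma (mu / 2 - s) * rgamma (1 - mu / 2 + s)) by rewrite r1; field.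
have s2 : Csin (PI * (- (mu / 2) - s)) = PI * (rgamma (- (mu / 2) - s) * rgamma (1 - - (mu / 2) + s)) by rewrite r2; field.
rewrite s1 s2.
have -> : 1 - - (mu / 2) + s = 1 + mu / 2 + s by ring.
have -> : 1 + - (mu / 2) + s = 1 - mu / 2 + s by ring.
move: (rgamma (mu / 2 - s)) (rgamma (- (mu / 2) - s)) h1 h2 => g1 g2 h1 h2.
move: (rgamma _) (rgamma _) (Cexp _) (Cexp (s * (Ci * PI))) (Cexp _) (Cexp _) => q1 q2 q3 q4 q5 q6.
by field.
Qed.

(** The shift by [i PI] in [Lint_split] cancels the alternating signs of the residues, so both rows
    sum to series of I, and [B - A] is the numerator in the definition of K. *)
Lemma Lint_value (mu w v : C) (sigma T : R) : loop_around mu sigma T -> is_loop_integral (Lint mu w) sigma T v ->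
  exists A B, [/\ Clim (fun n => sum_n (bessel_term mu w) n) A,
     Clim (fun n => sum_n (bessel_term (- mu) w) n) B &
     Csin (PI * mu) * v = 2 * PI * Ci * PI * (B - A)].
Proof.
move=> h hv; have hT := loop_around_pos _ _ _ h.
have [k1 k2 k3] := loop_around_opp _ _ _ h; have [h1 h2 h3] := h.
have [va [hva la]] := bessel_row_value mu (w + Ci * PI) sigma T h1 h3.
have [vb [hvb lb]] := bessel_row_value (- mu) (w + Ci * PI) sigma T k1 k3.
have la' := bessel_row_sum _ _ _ _ _ h1 h3 hva; have lb' := bessel_row_sum _ _ _ _ _ k1 k3 hvb.
have hp := twoPiI_neq0; have hE := Cexp_neq0 (Ci * (PI * (mu / 2))).
have e1 := Cexp_opp (Ci * (PI * (mu / 2))).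
have e2 : Cexp (Ci * (PI * (- mu / 2))) = / Cexp (Ci * (PI * (mu / 2))).
  by rewrite -Cexp_opp; congr Cexp; rewrite /Cdiv; ring.
exists (/ Cexp (Ci * (PI * (mu / 2))) * (va / (2 * PI * Ci))), (Cexp (Ci * (PI * (mu / 2))) * (vb / (2 * PI * Ci))); split.
- apply: Clim_sum_unscal la' => // k; exact: bessel_term_plus.
- apply: Clim_sum_scal lb' => k; rewrite bessel_term_plus e2.
  by field.
have hl := loop_plus _ _ _ _ _ _ (loop_scal (PI * Cexp (Ci * (PI * (mu / 2)))) _ _ _ _ hvb)
   (loop_scal (- (PI * Cexp (- (Ci * (PI * (mu / 2)))))) _ _ _ _ hva).
have hl2 := loop_ext _ _ _ _ _ hT _ (loop_scal (Csin (PI * mu)) _ _ _ _ hv).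
rewrite (loop_unique _ _ _ _ _ (hl2 _ _) hl) => [|s hs]; last first.
  apply: Lint_split; first exact: (loop_rgamma_neq0 sigma T).
  by apply: (loop_rgamma_neq0 sigma T) => //; rewrite ImN Rabs_Ropp.
have hPc := PIc_neq0; have hCi := Ci_neq0; have c2 := C2_neq0.
by rewrite e1; field.
Qed.

(** The converse of [Lint_split]: the reciprocal Gamma factor is a second Gamma factor times a sine,
    whose two exponentials move [w] by plus and minus [i PI]. There is no division by
    [Csin (PI * mu)], so J is covered at all orders. *)
Lemma bessel_row_Lint (mu w s : C) : rgamma (mu / 2 - s) <> 0 -> rgamma (- (mu / 2) - s) <> 0 ->
  bessel_row mu w s = / (2 * PI * Ci) * Cexp (- (Ci * (PI * (mu / 2)))) * Lint mu (w - Ci * PI) s +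
    - (/ (2 * PI * Ci) * Cexp (Ci * (PI * (mu / 2)))) * Lint mu (w + Ci * PI) s.
Proof.
move=> h1 h2; have hP := PIc_neq0; have c2 := C2_neq0; have hCi := Ci_neq0.
have r2 := rgamma_reflection_sub (- (mu / 2)) s.
rewrite /bessel_row /Lint.
have -> : 1 + mu / 2 + s = 1 - - (mu / 2) + s by ring.
have -> : Cexp (s * (w - Ci * PI)) = Cexp (s * w) * / Cexp (Ci * (PI * s)).
  by rewrite -Cexp_opp -Cexp_plus; congr Cexp; ring.
have -> : Cexp (s * (w + Ci * PI)) = Cexp (s * w) * Cexp (Ci * (PI * s)).
  by rewrite -Cexp_plus; congr Cexp; ring.
have e : rgamma (1 - - (mu / 2) + s) = / (2 * PI * Ci) *
    (Cexp (- (Ci * (PI * (mu / 2)))) * / Cexp (Ci * (PI * s)) - Cexp (Ci * (PI * (mu / 2))) * Cexp (Ci * (PI * s))) * / rgamma (- (mu / 2) - s).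
  have -> : rgamma (1 - - (mu / 2) + s) = rgamma (- (mu / 2) - s) * rgamma (1 - - (mu / 2) + s) * / rgamma (- (mu / 2) - s).
    by move: (rgamma (- (mu / 2) - s)) h2 => g hg; field.
  rewrite r2; congr (_ * _); rewrite /Csin.
  have -> : Cexp (Ci * (PI * (- (mu / 2) - s))) = Cexp (- (Ci * (PI * (mu / 2)))) * / Cexp (Ci * (PI * s)).
    by rewrite -Cexp_opp -Cexp_plus; congr Cexp; ring.
  have -> : Cexp (- (Ci * (PI * (- (mu / 2) - s)))) = Cexp (Ci * (PI * (mu / 2))) * Cexp (Ci * (PI * s)).
    by rewrite -Cexp_plus; congr Cexp; ring.
  by have hE := Cexp_neq0 (Ci * (PI * s)); field.
rewrite e -!rgamma_inv.
ring.
Qed.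

Lemma besselJ_loop (mu z vp vm : C) (sigma T : R) : z / 2 <> 0 -> loop_around mu sigma T ->
  is_loop_integral (Lint mu (2 * Clog (z / 2) + Ci * PI)) sigma T vp ->
  is_loop_integral (Lint mu (2 * Clog (z / 2) - Ci * PI)) sigma T vm ->
  besselJ mu z = / (2 * PI * Ci) * (/ (2 * PI * Ci) *
    (Cexp (- (Ci * (PI * (mu / 2)))) * vm - Cexp (Ci * (PI * (mu / 2))) * vp)).
Proof.
move=> hz h hp hm; have hT := loop_around_pos _ _ _ h; have [h1 h2 h3] := h.
set w := 2 * Clog (z / 2) in hp hm.
have [v [hv _]] := bessel_row_value mu w sigma T h1 h3.
have hs := bessel_row_sum _ _ _ _ _ h1 h3 hv.
have ev : v / (2 * PI * Ci) = / (2 * PI * Ci) * v by rewrite /Cdiv Cmult_comm.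
rewrite (besselJ_eq mu z _ hz hs) ev; congr (_ * _).
have hl := loop_plus _ _ _ _ _ _
  (loop_scal (/ (2 * PI * Ci) * Cexp (- (Ci * (PI * (mu / 2))))) _ _ _ _ hm)
  (loop_scal (- (/ (2 * PI * Ci) * Cexp (Ci * (PI * (mu / 2))))) _ _ _ _ hp).
have hl2 := loop_ext _ _ _ _ _ hT _ hv.
rewrite (loop_unique _ _ _ _ _ (hl2 _ _) hl) => [|s hsp]; last first.
  apply: bessel_row_Lint; first exact: (loop_rgamma_neq0 sigma T).
  by apply: (loop_rgamma_neq0 sigma T) => //; rewrite ImN Rabs_Ropp.
ring.
Qed.

Lemma besselK_nonint (mu z v : C) (sigma T : R) : z / 2 <> 0 -> loop_around mu sigma T -> Csin (PI * mu) <> 0 ->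
  is_loop_integral (Lint mu (2 * Clog (z / 2))) sigma T v ->
  PI / 2 * (besselI (- mu) z - besselI mu z) / Csin (mu * PI) = / (4 * PI * Ci) * v.
Proof.
move=> hz h hs hv; have [A [B [hA hB e]]] := Lint_value _ _ _ _ _ h hv.
rewrite (besselI_eq _ _ _ hz hA) (besselI_eq _ _ _ hz hB) (Cmult_comm mu).
have hP := PIc_neq0; have hCi := Ci_neq0; have c2 := C2_neq0.
have c4 : RtoC 4 <> 0 by move/RtoC_inj; lra.
have -> : v = / Csin (PI * mu) * (Csin (PI * mu) * v) by field.
have e4 : RtoC 4 = 2 * 2 by rewrite -RtoC_mult; congr RtoC; ring.
by rewrite e e4; field.
Qed.

(** At an integral order K is a limit over nearby orders; these are not integral, so the formula
    holds for them, and the continuity of the loop integral in [mu] carries it over. *)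
Lemma besselK_loop (mu z v : C) (sigma T : R) : z / 2 <> 0 -> loop_around mu sigma T ->
  is_loop_integral (Lint mu (2 * Clog (z / 2))) sigma T v -> besselK mu z = / (4 * PI * Ci) * v.
Proof.
move=> hz h hv; apply: extend_eq => hmu.
  by apply: (besselK_nonint _ _ _ sigma T) => // /Csin_eq0.
have [V hV] := loop_fun (fun m => Lint m (2 * Clog (z / 2))) sigma T.
have hc := tame_clim _ _ _ _ _ _ (loop_around_pos _ _ _ h) (Lint_tame mu (2 * Clog (z / 2)) sigma T h) hV hv.
have [d [hd hadm]] := loop_around_near _ _ _ h.
have hmin : (0 < Rmin d (1 / 2))%R by apply: Rmin_pos; lra.
apply: (clim_at_ext _ _ _ _ _ hmin) (clim_at_mult _ _ _ _ _ (clim_at_const (/ (4 * PI * Ci)) mu) hc).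
move=> m hne hm; have m1 := Rmin_l d (1 / 2); have m2 := Rmin_r d (1 / 2).
have hm' : loop_around m sigma T by apply: hadm; lra.
rewrite -(besselK_nonint m z (V m) sigma T) //; last by apply: hV; exact: Lint_exists.
move=> /Csin_eq0; rewrite -(Cmult_1_l m); apply: (Cint_isolated 1 mu) => //; try lra.
  by rewrite Cmod_1; lra.
by rewrite Cmult_1_l.
Qed.

Lemma besselY_nonint (mu z vp vm : C) (sigma T : R) : z / 2 <> 0 -> loop_around mu sigma T -> Csin (PI * mu) <> 0 ->
  is_loop_integral (Lint mu (2 * Clog (z / 2) + Ci * PI)) sigma T vp ->
  is_loop_integral (Lint mu (2 * Clog (z / 2) - Ci * PI)) sigma T vm ->
  (besselJ mu z * Ccos (mu * PI) - besselJ (- mu) z) / Csin (mu * PI) =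
  - / (4 * PI * PI * Ci) * (Cexp (Ci * PI / 2 * mu) * vp + Cexp (- Ci * PI / 2 * mu) * vm).
Proof.
move=> hz h hs hp hm.
set w := 2 * Clog (z / 2) in hp hm.
have c2 := C2_neq0; have hP := PIc_neq0; have hCi := Ci_neq0.
have [A [B [hA hB e]]] := Lint_value _ _ _ _ _ h hp.
have [A' [B' [hA' hB' e']]] := Lint_value _ _ _ _ _ h hm.
set q := Cexp (Ci * (PI * (mu / 2))).
have hq : q <> 0 by apply: Cexp_neq0.
have q1 : Cexp (Ci * PI / 2 * mu) = q by rewrite /q; congr Cexp; field.
have q2 : Cexp (- Ci * PI / 2 * mu) = / q by rewrite /q -Cexp_opp; congr Cexp; field.
have q3 : Cexp (Ci * (PI * (- mu / 2))) = / q by rewrite /q -Cexp_opp; congr Cexp; field.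
have q4 : Cexp (Ci * (PI * mu)) = q * q by rewrite /q -Cexp_plus; congr Cexp; field.
have m2 k : (- (1)) ^ k * (- (1)) ^ k = 1.
  by rewrite -{1}m1_pow_inv; apply: Cinv_l; apply: Cpow_nz => h0; have := f_equal Re h0; rewrite !ReImE; lra.
have btp nu k : (- (1)) ^ k * bessel_term nu w k = / Cexp (Ci * (PI * (nu / 2))) * bessel_term nu (w + Ci * PI) k.
  have hE := Cexp_neq0 (Ci * (PI * (nu / 2))).
  have := bessel_term_plus nu w k => h5.
  have -> : bessel_term nu (w + Ci * PI) k = (- (1)) ^ k * ((- (1)) ^ k * bessel_term nu (w + Ci * PI) k).
    by rewrite Cmult_assoc m2 Cmult_1_l.
  by rewrite h5; field.
(* The integrals at [w + i PI] and at [w - i PI] both lead to series of J, with opposite phases.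
   Obtaining each Bessel function from both expresses the two integrals by the same pair of
   functions. *)
have J1 : besselJ mu z = / q * A by apply: besselJ_eq => //; apply: Clim_sum_scal hA => k; rewrite btp.
have J2 : besselJ (- mu) z = q * B.
  by apply: besselJ_eq => //; apply: Clim_sum_scal hB => k; rewrite btp q3 Cinv_inv.
have J1' : besselJ mu z = q * A' by apply: besselJ_eq => //; apply: Clim_sum_scal hA' => k; rewrite bessel_term_minus.
have J2' : besselJ (- mu) z = / q * B'.
  by apply: besselJ_eq => //; apply: Clim_sum_scal hB' => k; rewrite bessel_term_minus q3.
have eA : A = q * besselJ mu z by rewrite J1; field.
have eB : B = / q * besselJ (- mu) z by rewrite J2; field.
have eA' : A' = / q * besselJ mu z by rewrite J1'; field.
have eB' : B' = q * besselJ (- mu) z by rewrite J2'; field.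
rewrite eA eB in e; rewrite eA' eB' in e'.
rewrite (Cmult_comm mu) q1 q2.
move: (besselJ mu z) (besselJ (- mu) z) e e' => x y e e'.
have -> : vp = / Csin (PI * mu) * (Csin (PI * mu) * vp) by field.
have -> : vm = / Csin (PI * mu) * (Csin (PI * mu) * vm) by field.
rewrite e e' Ccos_expand q4.
have e4 : RtoC 4 = 2 * 2 by rewrite -RtoC_mult; congr RtoC; ring.
rewrite e4; move: (Csin (PI * mu)) hs => s hs.
by field.
Qed.

Lemma besselY_loop (mu z vp vm : C) (sigma T : R) : z / 2 <> 0 -> loop_around mu sigma T ->
  is_loop_integral (Lint mu (2 * Clog (z / 2) + Ci * PI)) sigma T vp ->
  is_loop_integral (Lint mu (2 * Clog (z / 2) - Ci * PI)) sigma T vm ->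
  besselY mu z = - / (4 * PI * PI * Ci) * (Cexp (Ci * PI / 2 * mu) * vp + Cexp (- Ci * PI / 2 * mu) * vm).
Proof.
move=> hz h hp hm; apply: extend_eq => hmu.
  by apply: (besselY_nonint _ _ _ _ sigma T) => // /Csin_eq0.
set w := 2 * Clog (z / 2) in hp hm.
have [V hV] := loop_fun (fun m => Lint m (w + Ci * PI)) sigma T.
have [W hW] := loop_fun (fun m => Lint m (w - Ci * PI)) sigma T.
have hc := tame_clim _ _ _ _ _ _ (loop_around_pos _ _ _ h) (Lint_tame mu (w + Ci * PI) sigma T h) hV hp.
have hc' := tame_clim _ _ _ _ _ _ (loop_around_pos _ _ _ h) (Lint_tame mu (w - Ci * PI) sigma T h) hW hm.
have [d [hd hadm]] := loop_around_near _ _ _ h.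
have hmin : (0 < Rmin d (1 / 2))%R by apply: Rmin_pos; lra.
apply: (clim_at_ext _ _ _ _ _ hmin) (clim_at_mult _ _ _ _ _ (clim_at_const (- / (4 * PI * PI * Ci)) mu)
  (clim_at_plus _ _ _ _ _ (clim_at_mult _ _ _ _ _ (clim_at_Cexp (Ci * PI / 2) mu) hc)
    (clim_at_mult _ _ _ _ _ (clim_at_Cexp (- Ci * PI / 2) mu) hc'))).
move=> m hne hm1; have m1 := Rmin_l d (1 / 2); have m2 := Rmin_r d (1 / 2).
have hm' : loop_around m sigma T by apply: hadm; lra.
rewrite -(besselY_nonint m z (V m) (W m) sigma T) //.
- move=> /Csin_eq0; rewrite -(Cmult_1_l m); apply: (Cint_isolated 1 mu) => //; try lra.
    by rewrite Cmod_1; lra.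
  by rewrite Cmult_1_l.
- by apply: hV; exact: Lint_exists.
- by apply: hW; exact: Lint_exists.
Qed.

(** * Dilation of the loop *)

Lemma CRInt_scale (g : R -> C) (a b : R) (l : C) : CRInt g (2 * a)%R (2 * b)%R l ->
  CRInt (fun u => 2 * g (2 * u)%R) a b l.
Proof.
move=> h.
have := is_RInt_comp_lin (V := C_R_NormedModule) g 2 0 a b l; rewrite !Rplus_0_r => H.
apply: (CRInt_ext _ _ _ _ _ _ (H h)) => t _; rewrite Rplus_0_r.
by apply: C_eq; rewrite !ReImE /scal /= /mult /=; rewrite /Re /Im; ring.
Qed.

Lemma tail_scale (g : R -> C) (a : R) (l : C) : tail_int g (2 * a)%R l -> tail_int (fun u => 2 * g (2 * u)%R) a l.
Proof.
move=> /tail_spec h; apply/tail_spec => e he; have [M hM] := h e he.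
exists (M / 2)%R => b hb; have [y [h1 h2]] := hM (2 * b)%R ltac:(lra).
by exists y; split => //; exact: CRInt_scale.
Qed.

(** The substitution [s' = 2 s] that goes with the duplication formula; the factor 2 is its
    Jacobian. *)
Lemma loop_scale (f : C -> C) (sigma T : R) (v : C) : is_loop_integral f (2 * sigma)%R (2 * T)%R v ->
  is_loop_integral (fun s => 2 * f (2 * s)) sigma T v.
Proof.
have e (x y : R) : RtoC 2 * ((x, y) : C) = ((2 * x)%R, (2 * y)%R) by apply: C_eq; rewrite !ReImE; ring.
move=> [a [b [c [h1 h2 h3 ->]]]]; exists a, b, c; split => //.
- apply: tail_ext (tail_scale _ _ _ h1) => u _; rewrite e; congr (_ * f (_, _)); ring.
- have h2' : CRInt (fun y => f ((2 * sigma)%R, y)) (2 * - T) (2 * T) b.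
    by have -> : (2 * - T = - (2 * T))%R by ring.
  by apply: CRInt_ext (CRInt_scale _ _ _ _ h2') => t _; rewrite e.
- by apply: tail_ext (tail_scale _ _ _ h3) => u _; rewrite e.
Qed.

(** * Signatures of the two kinds of fields *)

Lemma nf_degree_rat : nf_degree (rat^o : fieldExtType rat) = 1%nat.
Proof. by rewrite /nf_degree dimvf. Qed.

Lemma real_embeddings_rat :
  real_embeddings (rat^o : fieldExtType rat) = classical_sets.set1 (ratr : rat -> R).
Proof.
apply: boolp.funext => f; apply: boolp.propext; split.
  move=> [g ->]; apply: boolp.funext => x; exact: (fmorph_eq_rat (g : {rmorphism rat -> R}) x).
by move=> ->; exists (ratr : {rmorphism rat -> R}).
Qed.

Lemma nf_r1_rat : nf_r1 (rat^o : fieldExtType rat) = 1%nat.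
Proof. by rewrite /nf_r1 real_embeddings_rat cardinality.fset_set1 finmap.cardfs1. Qed.

Lemma nf_r2_rat : nf_r2 (rat^o : fieldExtType rat) = 0%nat.
Proof. by rewrite /nf_r2 nf_degree_rat nf_r1_rat. Qed.

Lemma imaginary_quadratic_signature (K : fieldExtType rat) : imaginary_quadratic K ->
  [/\ nf_degree K = 2%nat, nf_r1 K = 0%nat & nf_r2 K = 1%nat].
Proof.
move=> [hd hr].
have h1 : nf_r1 K = 0%nat by rewrite /nf_r1 hr cardinality.fset_set0 finmap.cardfs0.
by split => //; rewrite /nf_r2 hd h1.
Qed.

(** * The Meijer G-functions *)

Lemma Cprod_inv (l : seq C) : / Cprod l = Cprod [seq / x | x <- l].
Proof. by elim: l => [|x l IH] /=; [exact: Cinv_1|rewrite Cinv_mul IH]. Qed.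

Lemma meijer_integrand_nil (m : nat) (b : seq C) (logz s : C) :
  meijer_integrand m 0 [::] b logz s =
  Cprod [seq Cgamma (bj - s) | bj <- take m b] * Cprod [seq rgamma (1 - bj + s) | bj <- drop m b] * Cexp (s * logz).
Proof.
have e (x y z : C) : x * 1 / (y * 1) * z = x * / y * z by rewrite !Cmult_1_r.
by rewrite /meijer_integrand e Cprod_inv -map_comp.
Qed.

Lemma separating_exists (l : seq C) : exists sigma T : R, (0 < T)%R /\
  forall b : C, List.In b l -> (sigma < Re b)%R /\ (Rabs (Im b) < T)%R.
Proof.
elim: l => [|a l [sigma [T [hT h]]]]; first by exists 0%R, 1%R; split; [lra|].
exists (Rmin sigma (Re a - 1)), (T + Rabs (Im a) + 1)%R; split; first by have := Rabs_pos (Im a); lra.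
have m1 := Rmin_l sigma (Re a - 1); have m2 := Rmin_r sigma (Re a - 1); have ha := Rabs_pos (Im a).
by move=> b /= [<-|/h [h1 h2]]; lra.
Qed.

(** The description operator needs uniqueness. It holds because a separating loop exists, and on it
    two candidates are values of the same integral. *)
Lemma meijerG_eq (m : nat) (b : seq C) (logz g : C) :
  (forall sigma T : R, (0 < T)%R ->
     (forall bj : C, List.In bj (take m b) -> (sigma < Re bj)%R /\ (Rabs (Im bj) < T)%R) ->
     is_loop_integral (fun s => / (2 * PI * Ci) * meijer_integrand m 0 [::] b logz s) sigma T g) ->
  meijerG m 0 [::] b logz = g.
Proof.
move=> h; rewrite /meijerG; apply: iota_unique => [y hy|sigma T [hT hs _]]; last exact: h.
have [sigma [T [hT hs]]] := separating_exists (take m b).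
apply: (loop_unique _ _ _ _ _ (hy sigma T _) (h sigma T hT hs)).
by split.
Qed.

(** Reflection rewrites the reciprocal factor as [Gamma (z + 1/2)] times a cosine, and duplication
    merges this Gamma factor with [Gamma z]. *)
Lemma gamma_half (z : C) : rgamma (2 * z) <> 0 ->
  Cgamma z * rgamma (/ 2 - z) = Cpower 2 (1 - 2 * z) * Ccos (PI * z) / sqrt PI * Cgamma (2 * z).
Proof.
move=> h; have c2 := C2_neq0; have hP := PIc_neq0.
have hsP : RtoC (sqrt PI) * sqrt PI = PI by rewrite -RtoC_mult sqrt_sqrt //; have := PI_RGT_0; lra.
have hs : RtoC (sqrt PI) <> 0 by move=> e; apply: hP; rewrite -hsP e Cmult_0_l.
have d := rgamma_dup z.
have hw : Cpower 2 (2 * z) <> 0 by apply: Cexp_neq0.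
have hz : rgamma z <> 0.
  move=> e; move: d; rewrite e Cmult_0_l => /esym d; apply: h.
  have -> : rgamma (2 * z) = (2 * sqrt PI) / Cpower 2 (2 * z) * (Cpower 2 (2 * z) * rgamma (2 * z) / (2 * sqrt PI)).
    by move: (rgamma (2 * z)) => g; field.
  by rewrite d Cmult_0_r.
have hz2 : rgamma (z + / 2) <> 0.
  move=> e; move: d; rewrite e Cmult_0_r => /esym d; apply: h.
  have -> : rgamma (2 * z) = (2 * sqrt PI) / Cpower 2 (2 * z) * (Cpower 2 (2 * z) * rgamma (2 * z) / (2 * sqrt PI)).
    by move: (rgamma (2 * z)) => g; field.
  by rewrite d Cmult_0_r.
have r := rgamma_reflection (z + / 2).
have e1 : 1 - (z + / 2) = / 2 - z by field.
have e2 : Csin (PI * (z + / 2)) = Ccos (PI * z).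
  have -> : PI * (z + / 2) = PI * z + RtoC (PI / 2) by rewrite RtoC_div; [field|lra].
  by rewrite Csin_plus Csin_R Ccos_R sin_PI2 cos_PI2; ring.
rewrite e1 e2 in r.
have e3 : Cpower 2 (1 - 2 * z) = 2 / Cpower 2 (2 * z).
  rewrite !Cpower_pos; try lra.
  have -> : (1 - 2 * z) * ln 2 = ln 2 + - (2 * z * ln 2) by ring.
  by rewrite Cexp_plus Cexp_opp Cexp_R exp_ln; [|lra].
rewrite e3 -!rgamma_inv.
have -> : rgamma (/ 2 - z) = Ccos (PI * z) / PI * / rgamma (z + / 2).
  by rewrite -r; move: (rgamma (z + / 2)) hz2 => u hu; field.
have -> : rgamma (2 * z) = (2 * sqrt PI) / Cpower 2 (2 * z) * (rgamma z * rgamma (z + / 2)).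
  by rewrite d; move: (rgamma (2 * z)) => g; field.
rewrite -hsP.
move: (rgamma z) (rgamma (z + / 2)) hz hz2 => u v hu hv.
by field.
Qed.

Lemma Cpower2_plus (a b : C) : Cpower 2 (a + b) = Cpower 2 a * Cpower 2 b.
Proof. by rewrite /Cpower -Cexp_plus; congr Cexp; ring. Qed.

(** Each Gamma factor is matched with one reciprocal factor through [gamma_half]. Two cosines
    remain, whose product is a constant plus a cosine in [s]: the constant gives [Lint] at [w], the
    cosine its shifts by plus and minus [i PI]. The outer factor 2 is the Jacobian expected by
    [loop_scale]. *)
Lemma meijer_rat_integrand (nu w s : C) : rgamma (2 * (- nu / 2 - s)) <> 0 -> rgamma (2 * (nu / 2 - s)) <> 0 ->
  meijer_integrand 2 0 [::] [:: - nu / 2; nu / 2; (1 - nu) / 2; (1 + nu) / 2] (2 * (w - ln 4)) s =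
  2 * (/ PI * (Ccos (PI * nu) * Lint (2 * nu) w (2 * s) +
       / 2 * Lint (2 * nu) (w + Ci * PI) (2 * s) + / 2 * Lint (2 * nu) (w - Ci * PI) (2 * s))).
Proof.
move=> h1 h2; have c2 := C2_neq0; have hP := PIc_neq0.
have hsP : RtoC (sqrt PI) * sqrt PI = PI by rewrite -RtoC_mult sqrt_sqrt //; have := PI_RGT_0; lra.
have hs : RtoC (sqrt PI) <> 0 by move=> e; apply: hP; rewrite -hsP e Cmult_0_l.
have g1 := gamma_half _ h1; have g2 := gamma_half _ h2.
have -> : meijer_integrand 2 0 [::] [:: - nu / 2; nu / 2; (1 - nu) / 2; (1 + nu) / 2] (2 * (w - ln 4)) s =
  (Cgamma (- nu / 2 - s) * rgamma (/ 2 - (- nu / 2 - s))) * (Cgamma (nu / 2 - s) * rgamma (/ 2 - (nu / 2 - s))) * Cexp (s * (2 * (w - ln 4))).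
  rewrite meijer_integrand_nil /=.
  have -> : 1 - (1 - nu) / 2 + s = / 2 - (- nu / 2 - s) by field.
  have -> : 1 - (1 + nu) / 2 + s = / 2 - (nu / 2 - s) by field.
  ring.
rewrite g1 g2.
set z1 := - nu / 2 - s; set z2 := nu / 2 - s.
have ec : Ccos (PI * z1) * Ccos (PI * z2) = / 2 * (Ccos (PI * (2 * s)) + Ccos (PI * nu)).
  have -> : Ccos (PI * (2 * s)) = Ccos (PI * z1 + PI * z2).
    have -> : PI * z1 + PI * z2 = - (PI * (2 * s)) by rewrite /z1 /z2; field.
    by rewrite Ccos_opp.
  have -> : PI * nu = PI * z2 - PI * z1 by rewrite /z1 /z2; field.
  by rewrite Ccos_plus Ccos_minus; field.
(* The powers of 2 from the two duplications cancel [4^(- 2 s)], which stems from the 16 in the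
   argument [x^2 / 16]. *)
have ep : Cpower 2 (1 - 2 * z1) * Cpower 2 (1 - 2 * z2) * Cexp (s * (2 * (w - ln 4))) = 4 * Cexp (2 * s * w).
  have -> : RtoC 4 = Cexp (2 * ln 2).
    have -> : 2 * RtoC (ln 2) = ln 2 + ln 2 by ring.
    by rewrite Cexp_plus !Cexp_R exp_ln; [rewrite -RtoC_mult; congr RtoC; ring|lra].
  have -> : ln 4 = (ln 2 + ln 2)%R by rewrite -ln_mult; [congr ln; ring|lra|lra].
  rewrite !Cpower_pos; try lra.
  by rewrite RtoC_plus -!Cexp_plus; congr Cexp; rewrite /z1 /z2; field.
have l0 : Cgamma (2 * z1) * Cgamma (2 * z2) * Cexp (2 * s * w) = Lint (2 * nu) w (2 * s).
  rewrite /Lint (Cmult_comm (Cgamma (2 * z1))); congr (Cgamma _ * Cgamma _ * _); rewrite /z1 /z2; field.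
have lp : Lint (2 * nu) (w + Ci * PI) (2 * s) = Lint (2 * nu) w (2 * s) * Cexp (Ci * (PI * (2 * s))).
  have e : Cexp (2 * s * (w + Ci * PI)) = Cexp (2 * s * w) * Cexp (Ci * (PI * (2 * s))).
    by rewrite -Cexp_plus; congr Cexp; ring.
  by rewrite /Lint e; ring.
have lm : Lint (2 * nu) (w - Ci * PI) (2 * s) = Lint (2 * nu) w (2 * s) * / Cexp (Ci * (PI * (2 * s))).
  have e : Cexp (2 * s * (w - Ci * PI)) = Cexp (2 * s * w) * / Cexp (Ci * (PI * (2 * s))).
    by rewrite -Cexp_opp -Cexp_plus; congr Cexp; ring.
  by rewrite /Lint e; ring.
rewrite lp lm -l0.
transitivity ((Cpower 2 (1 - 2 * z1) * Cpower 2 (1 - 2 * z2) * Cexp (s * (2 * (w - ln 4)))) * (Ccos (PI * z1) * Ccos (PI * z2)) / (RtoC (sqrt PI) * sqrt PI) * (Cgamma (2 * z1) * Cgamma (2 * z2))).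
  by field.
rewrite ep ec hsP (Ccos_expand (PI * (2 * s))).
have e4 : RtoC 4 = 2 * 2 by rewrite -RtoC_mult; congr RtoC; ring.
have hE := Cexp_neq0 (Ci * (PI * (2 * s))).
rewrite e4; by field.
Qed.

Lemma GK_rat (nu W : C) : W <> 0 ->
  GK (rat^o : fieldExtType rat) nu W =
    Ccos (PI * nu) * (2 / PI * besselK (2 * nu) (2 * Csqrt W) - besselY (2 * nu) (2 * Csqrt W))
    - Csin (PI * nu) * besselJ (2 * nu) (2 * Csqrt W).
Proof.
move=> hW; have c2 := C2_neq0; have hP := PIc_neq0; have hCi := Ci_neq0.
rewrite /GK nf_degree_rat nf_r1_rat nf_r2_rat /= Clog_div4 //.
apply: meijerG_eq => sigma T hT hsep.
have [a1 a2] := hsep (- nu / 2) (or_introl erefl).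
have [b1 b2] := hsep (nu / 2) (or_intror (or_introl erefl)).
have hz : 2 * Csqrt W / 2 = Csqrt W by field.
have hzn : 2 * Csqrt W / 2 <> 0 by rewrite hz; apply: Cexp_neq0.
have hw : 2 * Clog (2 * Csqrt W / 2) = Clog W by rewrite hz Clog_Csqrt //; field.
(* In the variable [2 s] the rows start at [nu] and [- nu], twice the parameters of the G-function,
   so the dilated loop goes around both. *)
have hadm : loop_around (2 * nu) (2 * sigma) (2 * T).
  have e : 2 * nu / 2 = nu by field.
  have ea : Re (- nu / 2) = (- Re nu / 2)%R.
    by have -> : - nu / 2 = RtoC (- / 2) * nu by [rewrite RtoC_opp RtoC_inv; [field|lra]]; rewrite !ReImE; field.
  have eb : Re (nu / 2) = (Re nu / 2)%R.
    by have -> : nu / 2 = RtoC (/ 2) * nu by [rewrite RtoC_inv; [field|lra]]; rewrite !ReImE; field.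
  have ei : Im (nu / 2) = (Im nu / 2)%R.
    by have -> : nu / 2 = RtoC (/ 2) * nu by [rewrite RtoC_inv; [field|lra]]; rewrite !ReImE; field.
  rewrite ea in a1; rewrite eb in b1; rewrite ei in b2.
  split; rewrite e ?ReN; try lra.
  by rewrite Rabs_div in b2; [rewrite (Rabs_pos_eq 2) in b2; lra|lra].
set w := Clog W in hw *.
have [v0 hv0] := Lint_exists (2 * nu) w _ _ hadm.
have [vp hvp] := Lint_exists (2 * nu) (w + Ci * PI) _ _ hadm.
have [vm hvm] := Lint_exists (2 * nu) (w - Ci * PI) _ _ hadm.
have hK := besselK_loop (2 * nu) (2 * Csqrt W) v0 _ _ hzn hadm; rewrite hw in hK.
have hY := besselY_loop (2 * nu) (2 * Csqrt W) vp vm _ _ hzn hadm; rewrite hw in hY.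
have hJ := besselJ_loop (2 * nu) (2 * Csqrt W) vp vm _ _ hzn hadm; rewrite hw in hJ.
rewrite (hK hv0) (hY hvp hvm) (hJ hvp hvm).
have hl := loop_scal (/ (2 * PI * Ci)) _ _ _ _ (loop_scale _ _ _ _ (loop_scal (/ PI) _ _ _ _ (loop_plus _ _ _ _ _ _ (loop_plus _ _ _ _ _ _
  (loop_scal (Ccos (PI * nu)) _ _ _ _ hv0) (loop_scal (/ 2) _ _ _ _ hvp)) (loop_scal (/ 2) _ _ _ _ hvm)))).
set V := (X in is_loop_integral _ _ _ X) in hl.
set V' := (X in is_loop_integral _ _ _ X).
(* In terms of [E = exp (i PI nu)] both sides are rational, and [field] compares the coefficients of
   [v0], [vp] and [vm]. *)
have -> : V' = V.
  rewrite /V /V'.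
  have -> : Ci * PI / 2 * (2 * nu) = Ci * (PI * nu) by field.
  have -> : - Ci * PI / 2 * (2 * nu) = - (Ci * (PI * nu)) by field.
  have -> : Ci * (PI * (2 * nu / 2)) = Ci * (PI * nu) by field.
  rewrite Ccos_expand Csin_expand Cexp_opp.
  have e4 : RtoC 4 = 2 * 2 by rewrite -RtoC_mult; congr RtoC; ring.
  have hE := Cexp_neq0 (Ci * (PI * nu)).
  have hi2 : forall x, - Ci * x = - (1) * (Ci * x) by move=> x; ring.
  rewrite e4; move: (Cexp _) hE => E hE.
  by field.
apply: loop_ext hl; first lra.
move=> s hs; congr (_ * _); rewrite meijer_rat_integrand //.
- have -> : 2 * (- nu / 2 - s) = - (2 * nu / 2) - 2 * s by field.
  have [k1 k2 k3] := hadm; apply: (loop_rgamma_neq0 (2 * sigma) (2 * T)) => //; first by rewrite ImN Rabs_Ropp.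
  by case: hs => h1 h2; split; rewrite !ReImE; [lra|case: h2 => [->|[->|[-> h2]]]; [left|right; left|right; right]; lra].
- have -> : 2 * (nu / 2 - s) = 2 * nu / 2 - 2 * s by field.
  have [k1 k2 k3] := hadm; apply: (loop_rgamma_neq0 (2 * sigma) (2 * T)) => //.
  by case: hs => h1 h2; split; rewrite !ReImE; [lra|case: h2 => [->|[->|[-> h2]]]; [left|right; left|right; right]; lra].
Qed.

(** * Imaginary quadratic fields *)

Lemma pos_not_pole (z : C) : (0 < Re z)%R -> ~ is_pole z.
Proof. by move=> h [j hj]; have := f_equal Re hj; rewrite !ReImE; have := pos_INR j; lra. Qed.

(** Meant for [x = 2 nu]: the lower parameters that depend on [nu] have the form [a / 2 + nu] or
    [a / 2 - nu], and the boolean selects the sign. *)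
Lemma Cint_not_pole (z x : C) (a : Z) (e : bool) : ~ is_Cint x ->
  2 * z = IZR a + (if e then x else - x) -> ~ is_pole z.
Proof.
move=> hx hz [j hj]; apply: hx.
have h2 : 2 * z = IZR (- (2 * Z.of_nat j)).
  have -> : z = - INR j by rewrite -(Cplus_0_r (- INR j)) -hj; ring.
  by rewrite opp_IZR mult_IZR -INR_IZR_INZ RtoC_opp RtoC_mult; ring.
rewrite h2 in hz; case: e hz => hz.
  exists (- (2 * Z.of_nat j) - a)%Z; rewrite minus_IZR RtoC_minus hz; ring.
exists (a - - (2 * Z.of_nat j))%Z; rewrite minus_IZR RtoC_minus hz; ring.
Qed.

(** Residue series come in regularised form, with [1 / Gamma (c + k)] in place of [1 / (c)_k]; the
    two differ by the constant factor [1 / Gamma c]. *)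
Lemma hyper_lim (q : seq C) (x A : C) : (forall c, List.In c q -> ~ is_pole c) ->
  Clim (fun n => sum_n (fun k => / INR k`! * Cprod [seq rgamma (c + INR k) | c <- q] * x ^ k) n) A ->
  Cprod [seq rgamma c | c <- q] * hypergeometric [::] q x = A.
Proof.
move=> hq hA.
have hne : Cprod [seq rgamma c | c <- q] <> 0.
  elim: q hq {hA} => [|c q IH] hq /=; first exact: C1_nz.
  apply: Cmult_neq_0; first by apply: rgamma_neq0; apply: hq; left.
  by apply: IH => d hd; apply: hq; right.
have hP k : Cprod [seq rgamma (c + INR k) | c <- q] = Cprod [seq rgamma c | c <- q] * / Cprod [seq pochhammer c k | c <- q].
  elim: q hq {hA hne} => [|c q IH] hq /=; first by rewrite Cinv_1 Cmult_1_l.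
  rewrite IH; last by move=> d hd; apply: hq; right.
  have hp : pochhammer c k <> 0.
    by apply: pochhammer_neq0 => j _; apply: not_pole; apply: hq; left.
  rewrite Cinv_mul (rgamma_pochhammer c k).
  have -> : forall u v y z : C, u * (v * y) = (pochhammer c k * u * v) * (/ pochhammer c k * y) by move=> u v y _; field.
    by [].
  exact: 0.
rewrite /hypergeometric /Cseries.
rewrite (Climit_eventually _ (/ Cprod [seq rgamma c | c <- q] * A)); first by field.
apply: (Clim_sum_unscal _ _ _ _ hne) hA => k; rewrite hP /Cdiv /=; ring.
Qed.

(** The signs [(-1)^k] of the residues and the powers of [Cexp w] make up the argument [- Cexp w];
    each parameter [c] of the cofactor becomes the lower parameter [c + b]. *)
Lemma row_hyper (b w : C) (cs : seq C) (sigma T : R) : (sigma < Re b)%R -> (Rabs (Im b) < T)%R ->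
  (forall c, List.In c [seq c + b | c <- cs] -> ~ is_pole c) ->
  is_loop_integral (fun s => Cgamma (b - s) * (Cprod [seq rgamma (c + s) | c <- cs] * Cexp (s * w))) sigma T
    (2 * PI * Ci * (Cexp (b * w) * (Cprod [seq rgamma c | c <- [seq c + b | c <- cs]] *
       hypergeometric [::] [seq c + b | c <- cs] (- Cexp w)))).
Proof.
move=> h1 h2 hcs; have hp := twoPiI_neq0; have hE := Cexp_neq0 (b * w).
have [v [hv hl]] := row_value b _ sigma T (exp_type_mult _ _ (exp_type_rgammas cs) (exp_type_exp w)) h1 h2.
have hl2 := Clim_mult _ _ _ _ (Clim_const (/ (2 * PI * Ci))) hl.
have hl3 : Clim (fun n => sum_n (res_term b (fun s => Cprod [seq rgamma (c + s) | c <- cs] * Cexp (s * w))) n) (/ (2 * PI * Ci) * v).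
  by apply: (Clim_ext _ _ _ 0) hl2 => n _; rewrite Cmult_assoc Cinv_l // Cmult_1_l.
have hterm k : res_term b (fun s => Cprod [seq rgamma (c + s) | c <- cs] * Cexp (s * w)) k =
   Cexp (b * w) * (/ INR k`! * Cprod [seq rgamma (c + INR k) | c <- [seq c + b | c <- cs]] * (- Cexp w) ^ k).
  rewrite /res_term.
  have -> : [seq rgamma (c + (b + INR k)) | c <- cs] = [seq rgamma (c + INR k) | c <- [seq c + b | c <- cs]].
    by rewrite -map_comp; apply: eq_map => c /=; congr rgamma; ring.
  have -> : Cexp ((b + INR k) * w) = Cexp (b * w) * Cexp w ^ k.
    by rewrite Cmult_plus_distr_r Cexp_plus Cexp_nat.
  have -> : (- Cexp w) ^ k = (- (1)) ^ k * Cexp w ^ k.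
    rewrite -Cpow_mult_l; congr (_ ^ _); ring.
  ring.
have hA := Clim_sum_unscal _ _ _ _ hE hterm hl3.
rewrite (hyper_lim _ _ _ hcs hA).
have -> // : 2 * PI * Ci * (Cexp (b * w) * (/ Cexp (b * w) * (/ (2 * PI * Ci) * v))) = v.
by move: (2 * PI * Ci) hp => z hp; field.
Qed.

(** With [A_i = exp (2 i x_i)] the summands are [A_i] times the Lagrange basis polynomials for the
    nodes [A_1, A_2, A_3], evaluated at 1. The sum interpolates the polynomial [t], hence equals
    1. *)
Lemma csc3 (x1 x2 x3 : C) : Csin (x1 - x2) <> 0 -> Csin (x1 - x3) <> 0 -> Csin (x2 - x3) <> 0 ->
  Csin x2 * Csin x3 / (Csin (x2 - x1) * Csin (x3 - x1)) + Csin x1 * Csin x3 / (Csin (x1 - x2) * Csin (x3 - x2)) +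
  Csin x1 * Csin x2 / (Csin (x1 - x3) * Csin (x2 - x3)) = 1.
Proof.
move=> h12 h13 h23; have hCi := Ci_neq0; have c2 := C2_neq0.
have e1 := Cexp_neq0 (Ci * x1); have e2 := Cexp_neq0 (Ci * x2); have e3 := Cexp_neq0 (Ci * x3).
have es x y : Csin (x - y) = - Ci / 2 * ((Cexp (Ci * x) * Cexp (Ci * x) - Cexp (Ci * y) * Cexp (Ci * y)) / (Cexp (Ci * x) * Cexp (Ci * y))).
  have hx := Cexp_neq0 (Ci * x); have hy := Cexp_neq0 (Ci * y).
  by rewrite Csin_expand /Cminus CexpiD CexpiN; field.
have en x y : Csin (x - y) <> 0 -> Cexp (Ci * x) * Cexp (Ci * x) - Cexp (Ci * y) * Cexp (Ci * y) <> 0.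
  by move=> h h0; apply: h; rewrite es h0 /Cdiv Cmult_0_l Cmult_0_r.
have n12 := en _ _ h12; have n13 := en _ _ h13; have n23 := en _ _ h23.
rewrite !es !Csin_expand.
move: (Cexp (Ci * x1)) (Cexp (Ci * x2)) (Cexp (Ci * x3)) e1 e2 e3 n12 n13 n23 => a b c ha hb hc nab nac nbc.
have nba : b * b - a * a <> 0 by move=> h; apply: nab; have -> : a * a - b * b = - (b * b - a * a) by [ring]; rewrite h; ring.
have nca : c * c - a * a <> 0 by move=> h; apply: nac; have -> : a * a - c * c = - (c * c - a * a) by [ring]; rewrite h; ring.
have ncb : c * c - b * b <> 0 by move=> h; apply: nbc; have -> : b * b - c * c = - (c * c - b * b) by [ring]; rewrite h; ring.
by field.
Qed.

(** The product is multiplied by the identity [csc3] at the angles [PI (b_i - s)]. In each summand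
    two sines cancel two Gamma factors by reflection, and the denominators depend only on
    differences of the parameters. *)
Lemma gamma3_split (b1 b2 b3 s : C) : rgamma (b1 - s) <> 0 -> rgamma (b2 - s) <> 0 -> rgamma (b3 - s) <> 0 ->
  Csin (PI * (b1 - b2)) <> 0 -> Csin (PI * (b1 - b3)) <> 0 -> Csin (PI * (b2 - b3)) <> 0 ->
  Cgamma (b1 - s) * Cgamma (b2 - s) * Cgamma (b3 - s) =
   PI * PI / (Csin (PI * (b2 - b1)) * Csin (PI * (b3 - b1))) * (Cgamma (b1 - s) * (rgamma (1 - b2 + s) * rgamma (1 - b3 + s))) +
   PI * PI / (Csin (PI * (b1 - b2)) * Csin (PI * (b3 - b2))) * (Cgamma (b2 - s) * (rgamma (1 - b1 + s) * rgamma (1 - b3 + s))) +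
   PI * PI / (Csin (PI * (b1 - b3)) * Csin (PI * (b2 - b3))) * (Cgamma (b3 - s) * (rgamma (1 - b1 + s) * rgamma (1 - b2 + s))).
Proof.
move=> g1 g2 g3 d12 d13 d23; have hP := PIc_neq0.
have hd x y : Csin (PI * (x - y)) = Csin (PI * (x - s) - PI * (y - s)) by congr Csin; ring.
have hr b : rgamma (b - s) <> 0 -> rgamma (1 - b + s) = Csin (PI * (b - s)) / PI / rgamma (b - s).
  by move=> hb; rewrite -rgamma_reflection_sub; move: (rgamma (b - s)) (rgamma _) hb => u v hb; field.
rewrite (hr b1 g1) (hr b2 g2) (hr b3 g3) -!rgamma_inv.
have nn x y : Csin (PI * (x - y)) <> 0 -> Csin (PI * (y - x)) <> 0.
  move=> h h0; apply: h; have -> : PI * (x - y) = - (PI * (y - x)) by ring.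
  by rewrite Csin_opp h0; ring.
have d21 := nn _ _ d12; have d31 := nn _ _ d13; have d32 := nn _ _ d23.
have key := csc3 (PI * (b1 - s)) (PI * (b2 - s)) (PI * (b3 - s)); rewrite -!hd in key.
have {}key := key d12 d13 d23.
rewrite -(Cmult_1_r (/ rgamma (b1 - s) * / rgamma (b2 - s) * / rgamma (b3 - s))) -key.
move: (rgamma (b1 - s)) (rgamma (b2 - s)) (rgamma (b3 - s)) g1 g2 g3 => u1 u2 u3 g1 g2 g3.
move: (Csin (PI * (b1 - b2))) (Csin (PI * (b2 - b1))) (Csin (PI * (b1 - b3))) (Csin (PI * (b3 - b1))) (Csin (PI * (b2 - b3))) (Csin (PI * (b3 - b2))) d12 d21 d13 d31 d23 d32 => D12 D21 D13 D31 D23 D32 d12 d21 d13 d31 d23 d32.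
by field.
Qed.

(** [W] stands for [x t]. The argument [X] is kept apart because the residues produce it as
    [- exp (2 log (W / 4))]. *)
Definition hyper_rhs (mu W X : C) : C :=
  RtoC (sqrt PI) / Csin (2 * PI * mu) *
      ( Cpower 2 (1 - 4 * mu) / Cgamma (1 - 2 * mu) ^ 2
          * Cpower (W / 4) (- mu)
          * hypergeometric [::]
              [:: 1 - mu; 1 - mu; 1 / 2 - mu; 1 / 2 - mu; 1 / 2] X
      - Cpower 2 (1 + 2 * mu) * Ccos (PI * mu) / Cgamma (1 + 2 * mu)
          * Cpower (W / 4) mu
          * hypergeometric [::]
              [:: 1 + mu; 1 / 2 + mu; 1 / 2; 1 / 2; RtoC 1] X
      + Cpower 2 (4 + 2 * mu) * Csin (PI * mu) / Cgamma (2 + 2 * mu)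
          * Cpower (W / 4) (1 + mu)
          * hypergeometric [::]
              [:: 3 / 2 + mu; 1 + mu; 3 / 2; 3 / 2; RtoC 1] X).

(** The lower parameters for [d = 2], [r1 = 0], [r2 = 1]; the first three carry the poles. *)
Definition quad_params (nu : C) : seq C :=
  [:: - nu / 2; nu / 2; (1 + nu) / 2; (1 - nu) / 2; nu / 2; (1 + nu) / 2].

Lemma rgamma_3half : rgamma (3 / 2) = 2 / sqrt PI.
Proof.
have c2 := C2_neq0; have := rgamma_S (/ 2); rewrite rgamma_half.
have -> : / 2 + 1 = 3 / 2.
  have -> : RtoC 3 = 2 + 1 by rewrite -RtoC_plus; congr RtoC; ring.
  by field.
have hs : RtoC (sqrt PI) <> 0 by move/RtoC_inj; have := sqrt_lt_R0 PI PI_RGT_0; lra.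
move=> e; have -> : rgamma (3 / 2) = 2 * (/ 2 * rgamma (3 / 2)) by move: (rgamma _) => u; field.
by rewrite -e.
Qed.

Lemma Cpower2_nat (n : nat) (x : C) : Cpower 2 (INR n + x) = 2 ^ n * Cpower 2 x.
Proof.
rewrite Cpower2_plus; congr (_ * _).
rewrite Cpower_pos; last lra.
by rewrite Cexp_nat Cexp_R exp_ln //; lra.
Qed.

Lemma Re_half (x : C) : Re (x / 2) = (Re x / 2)%R.
Proof.
have -> : x / 2 = RtoC (/ 2) * x by rewrite RtoC_inv; [rewrite /Cdiv Cmult_comm|lra].
by rewrite !ReImE; field.
Qed.

Lemma quad_generic (nu W : C) (sigma T : R) : W <> 0 -> ~ is_Cint (2 * nu) ->
  (forall b : C, List.In b (take 3 (quad_params nu)) -> (sigma < Re b)%R /\ (Rabs (Im b) < T)%R) ->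
  is_loop_integral (fun s => / (2 * PI * Ci) * meijer_integrand 3 0 [::] (quad_params nu) (2 * Clog (W / 4)) s) sigma T
    (hyper_rhs nu W (- Cexp (2 * Clog (W / 4)))).
Proof.
move=> hW hnu hsep; have c2 := C2_neq0; have hP := PIc_neq0; have hp := twoPiI_neq0.
set l := Clog (W / 4).
have [s1 t1] := hsep (- nu / 2) (or_introl erefl).
have [s2 t2] := hsep (nu / 2) (or_intror (or_introl erefl)).
have [s3 t3] := hsep ((1 + nu) / 2) (or_intror (or_intror (or_introl erefl))).
have hT : (0 <= T)%R by have := Rabs_pos (Im (nu / 2)); lra.
have r2 : RtoC 2 = 1 + 1 by rewrite -RtoC_plus; congr RtoC; ring.
have r3 : RtoC 3 = 2 + 1 by rewrite -RtoC_plus; congr RtoC; ring.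
have r4 : RtoC 4 = 2 * 2 by rewrite -RtoC_mult; congr RtoC; ring.
have p1 : ~ is_pole (1 - nu) by apply: (Cint_not_pole _ (2 * nu) 2 false) => //; ring.
have p2 : ~ is_pole (1 / 2 - nu) by apply: (Cint_not_pole _ (2 * nu) 1 false) => //; field.
have p3 : ~ is_pole (1 / 2) by apply: pos_not_pole; rewrite Re_half ReR; lra.
have p4 : ~ is_pole (1 + nu) by apply: (Cint_not_pole _ (2 * nu) 2 true) => //; ring.
have p5 : ~ is_pole (1 / 2 + nu) by apply: (Cint_not_pole _ (2 * nu) 1 true) => //; field.
have p6 : ~ is_pole 1 by apply: pos_not_pole; rewrite ReR; lra.
have p7 : ~ is_pole (3 / 2 + nu) by apply: (Cint_not_pole _ (2 * nu) 3 true) => //; field.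
have p8 : ~ is_pole (3 / 2) by apply: pos_not_pole; rewrite Re_half ReR; lra.
(* The cofactor of each row consists of two reflected factors and the three reciprocal factors of
   the integrand; adding the first pole [b] of the row yields the five lower parameters of the
   series. *)
have q1 : [seq c + - nu / 2 | c <- [:: 1 - nu / 2; 1 - nu / 2; / 2 - nu / 2; / 2 - nu / 2; / 2 + nu / 2]] =
   [:: 1 - nu; 1 - nu; 1 / 2 - nu; 1 / 2 - nu; 1 / 2].
  by rewrite /=; do ?congr (_ :: _); field.
have q2 : [seq c + nu / 2 | c <- [:: 1 + nu / 2; / 2 + nu / 2; / 2 - nu / 2; / 2 - nu / 2; 1 - nu / 2]] =
   [:: 1 + nu; 1 / 2 + nu; 1 / 2; 1 / 2; RtoC 1].
  by rewrite /=; do ?congr (_ :: _); field.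
have q3 : [seq c + (1 + nu) / 2 | c <- [:: 1 + nu / 2; / 2 + nu / 2; 1 - nu / 2; 1 - nu / 2; / 2 - nu / 2]] =
   [:: 3 / 2 + nu; 1 + nu; 3 / 2; 3 / 2; RtoC 1].
  by rewrite /= r3; do ?congr (_ :: _); field.
have L1 := row_hyper (- nu / 2) (2 * l) [:: 1 - nu / 2; 1 - nu / 2; / 2 - nu / 2; / 2 - nu / 2; / 2 + nu / 2] sigma T s1 t1.
rewrite q1 in L1.
have {}L1 := L1 ltac:(by move=> c /= [<-|[<-|[<-|[<-|[<-|[]]]]]]).
have L2 := row_hyper (nu / 2) (2 * l) [:: 1 + nu / 2; / 2 + nu / 2; / 2 - nu / 2; / 2 - nu / 2; 1 - nu / 2] sigma T s2 t2.
rewrite q2 in L2.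
have {}L2 := L2 ltac:(by move=> c /= [<-|[<-|[<-|[<-|[<-|[]]]]]]).
have L3 := row_hyper ((1 + nu) / 2) (2 * l) [:: 1 + nu / 2; / 2 + nu / 2; 1 - nu / 2; 1 - nu / 2; / 2 - nu / 2] sigma T s3 t3.
rewrite q3 in L3.
have {}L3 := L3 ltac:(by move=> c /= [<-|[<-|[<-|[<-|[<-|[]]]]]]).
have hs2 : Csin (PI * (2 * nu)) <> 0 by move/Csin_eq0.
have es2 : Csin (PI * (2 * nu)) = 2 * Csin (PI * nu) * Ccos (PI * nu).
  by rewrite -Csin_dbl; congr Csin; ring.
have hsn : Csin (PI * nu) <> 0 by move=> e; apply: hs2; rewrite es2 e; ring.
have hcn : Ccos (PI * nu) <> 0 by move=> e; apply: hs2; rewrite es2 e; ring.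
have sh x : Csin (x + PI / 2) = Ccos x.
  have -> : PI / 2 = RtoC (PI / 2) by rewrite RtoC_div; [|lra].
  by rewrite Csin_plus Csin_R Ccos_R sin_PI2 cos_PI2; ring.
(* The parameters differ by [nu], [nu + 1/2] and [1/2], so the sines are [sin (PI nu)],
   [cos (PI nu)] and 1 up to sign, nonzero because [2 nu] is not an integer. *)
have d21 : Csin (PI * (nu / 2 - - nu / 2)) = Csin (PI * nu) by congr Csin; field.
have d12 : Csin (PI * (- nu / 2 - nu / 2)) = - Csin (PI * nu) by rewrite -Csin_opp; congr Csin; field.
have d31 : Csin (PI * ((1 + nu) / 2 - - nu / 2)) = Ccos (PI * nu) by rewrite -sh; congr Csin; field.
have d13 : Csin (PI * (- nu / 2 - (1 + nu) / 2)) = - Ccos (PI * nu) by rewrite -sh -Csin_opp; congr Csin; field.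
have sP : Csin (PI / 2) = 1 by rewrite -(Cplus_0_l (PI / 2)) sh Ccos_0.
have d32 : Csin (PI * ((1 + nu) / 2 - nu / 2)) = 1.
  by have -> : PI * ((1 + nu) / 2 - nu / 2) = PI / 2 by field.
have d23 : Csin (PI * (nu / 2 - (1 + nu) / 2)) = - (1).
  by have -> : PI * (nu / 2 - (1 + nu) / 2) = - (PI / 2) by [field]; rewrite Csin_opp sP.
(* The denominators are products of two sines each; their signs give plus, minus and plus, the last
   as a product of two minus signs. *)
have hl := loop_scal (/ (2 * PI * Ci)) _ _ _ _ (loop_plus _ _ _ _ _ _ (loop_plus _ _ _ _ _ _
  (loop_scal (PI * PI / (Csin (PI * nu) * Ccos (PI * nu))) _ _ _ _ L1)
  (loop_scal (PI * PI / (- Csin (PI * nu) * 1)) _ _ _ _ L2))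
  (loop_scal (PI * PI / (- Ccos (PI * nu) * - (1))) _ _ _ _ L3)).
set V := (X in is_loop_integral _ _ _ X) in hl.
have -> : hyper_rhs nu W (- Cexp (2 * l)) = V.
  rewrite /V /hyper_rhs /=.
  have hq : RtoC (sqrt PI) * sqrt PI = PI by rewrite -RtoC_mult sqrt_sqrt //; have := PI_RGT_0; lra.
  have hq0 : RtoC (sqrt PI) <> 0 by move=> e; apply: hP; rewrite -hq e Cmult_0_l.
  (* Duplication merges lower parameters in pairs: this produces [Gamma (1 - 2 nu)], squared because
     both parameters of the pair are double, then [Gamma (1 + 2 nu)] and [Gamma (2 + 2 nu)]. *)
  have D1 : rgamma (1 / 2 - nu) * rgamma (1 - nu) = Cpower 2 (1 + - (2 * nu)) * rgamma (1 - 2 * nu) / (2 * sqrt PI).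
    have := rgamma_dup (1 / 2 - nu).
    have -> : 1 / 2 - nu + / 2 = 1 - nu by field.
    by have -> : 2 * (1 / 2 - nu) = 1 + - (2 * nu) by field.
  have D2 : rgamma (1 / 2 + nu) * rgamma (1 + nu) = Cpower 2 (1 + 2 * nu) * rgamma (1 + 2 * nu) / (2 * sqrt PI).
    have := rgamma_dup (1 / 2 + nu).
    have -> : 1 / 2 + nu + / 2 = 1 + nu by field.
    by have -> : 2 * (1 / 2 + nu) = 1 + 2 * nu by field.
  have D3 : rgamma (1 + nu) * rgamma (3 / 2 + nu) = Cpower 2 (2 + 2 * nu) * rgamma (2 + 2 * nu) / (2 * sqrt PI).
    have := rgamma_dup (1 + nu).
    have -> : 1 + nu + / 2 = 3 / 2 + nu by rewrite r3; field.
    by have -> : 2 * (1 + nu) = 2 + 2 * nu by ring.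
  have P0 : Cpower 2 (2 * nu) <> 0 by apply: Cexp_neq0.
  have Pn : Cpower 2 (- (2 * nu)) = / Cpower 2 (2 * nu).
    by rewrite /Cpower -Cexp_opp; congr Cexp; ring.
  have P1 x : Cpower 2 (1 + x) = 2 * Cpower 2 x.
    by have := Cpower2_nat 1 x; rewrite /= Cmult_1_r.
  have P2 : Cpower 2 (2 + 2 * nu) = 2 * (2 * Cpower 2 (2 * nu)).
    by rewrite -!P1; congr Cpower; rewrite r2; ring.
  have P4 : Cpower 2 (4 + 2 * nu) = 2 * (2 * (2 * (2 * Cpower 2 (2 * nu)))).
    by rewrite -!P1; congr Cpower; rewrite r4 r2; ring.
  have PM : Cpower 2 (1 - 4 * nu) = 2 * (/ Cpower 2 (2 * nu) * / Cpower 2 (2 * nu)).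
    by rewrite -Pn -Cpower2_plus -P1; congr Cpower; rewrite r4; ring.
  rewrite P1 Pn in D1; rewrite P1 in D2; rewrite P2 in D3.
  have E1 : Cexp (- nu / 2 * (2 * l)) = Cpower (W / 4) (- nu) by rewrite /Cpower -/l; congr Cexp; field.
  have E2 : Cexp (nu / 2 * (2 * l)) = Cpower (W / 4) nu by rewrite /Cpower -/l; congr Cexp; field.
  have E3 : Cexp ((1 + nu) / 2 * (2 * l)) = Cpower (W / 4) (1 + nu) by rewrite /Cpower -/l; congr Cexp; field.
  have eh : RtoC 1 / 2 = / 2 by rewrite /Cdiv Cmult_1_l.
  have h12 : rgamma (1 / 2) = / sqrt PI by rewrite eh rgamma_half.
  have W1 u : rgamma (1 - nu) * (rgamma (1 - nu) * (rgamma (1 / 2 - nu) * (rgamma (1 / 2 - nu) * (rgamma (1 / 2) * u)))) =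
    (rgamma (1 / 2 - nu) * rgamma (1 - nu)) * (rgamma (1 / 2 - nu) * rgamma (1 - nu)) * rgamma (1 / 2) * u by ring.
  have W2 u : rgamma (1 + nu) * (rgamma (1 / 2 + nu) * (rgamma (1 / 2) * (rgamma (1 / 2) * (rgamma 1 * u)))) =
    (rgamma (1 / 2 + nu) * rgamma (1 + nu)) * rgamma (1 / 2) * rgamma (1 / 2) * rgamma 1 * u by ring.
  have W3 u : rgamma (3 / 2 + nu) * (rgamma (1 + nu) * (rgamma (3 / 2) * (rgamma (3 / 2) * (rgamma 1 * u)))) =
    (rgamma (1 + nu) * rgamma (3 / 2 + nu)) * rgamma (3 / 2) * rgamma (3 / 2) * rgamma 1 * u by ring.
  rewrite E1 E2 E3 W1 W2 W3 D1 D2 D3 h12 rgamma_1 rgamma_3half PM P4 P1.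
  have -> : 2 * PI * nu = PI * (2 * nu) by ring.
  rewrite es2 -!rgamma_inv.
  move: (hypergeometric _ _ _) (hypergeometric _ _ _) (hypergeometric _ _ _) => H1 H2 H3.
  have hCi := Ci_neq0.
  move: (Csin (PI * nu)) (Ccos (PI * nu)) (rgamma (1 - 2 * nu)) (rgamma (1 + 2 * nu)) (rgamma (2 + 2 * nu)) hsn hcn => S1 C1 R1 R2 R3 hS1 hC1.
  move: (Cpower (W / 4) _) (Cpower (W / 4) _) (Cpower (W / 4) _) => Z1 Z2 Z3.
  rewrite -hq /Cdiv /= !Cinv_mul !Cinv_inv Cinv_1.
  by field.
apply: loop_ext hl => // s hs; congr (_ * _).
rewrite meijer_integrand_nil /=.
have n1 := loop_rgamma_neq0 _ _ _ _ s1 t1 hs; have n2 := loop_rgamma_neq0 _ _ _ _ s2 t2 hs.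
have n3 := loop_rgamma_neq0 _ _ _ _ s3 t3 hs.
have ns : - Csin (PI * nu) <> 0 by move=> e; apply: hsn; have -> : Csin (PI * nu) = - - Csin (PI * nu) by [ring]; rewrite e; ring.
have nc : - Ccos (PI * nu) <> 0 by move=> e; apply: hcn; have -> : Ccos (PI * nu) = - - Ccos (PI * nu) by [ring]; rewrite e; ring.
have n11 : - (1) <> 0 :> C by move/(f_equal Re); rewrite !ReImE; lra.
have G := gamma3_split (- nu / 2) (nu / 2) ((1 + nu) / 2) s n1 n2 n3.
rewrite d12 d13 d23 d21 d31 d32 in G; have {}G := G ns nc n11.
have a1 : 1 - - nu / 2 + s = 1 + nu / 2 + s by field.
have a3 : 1 - (1 + nu) / 2 + s = / 2 - nu / 2 + s by field.
have a4 : 1 - (1 - nu) / 2 + s = / 2 + nu / 2 + s by field.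
rewrite a1 a3 in G; rewrite a3 a4.
transitivity (Cgamma (- nu / 2 - s) * Cgamma (nu / 2 - s) * Cgamma ((1 + nu) / 2 - s) *
  (rgamma (/ 2 + nu / 2 + s) * (rgamma (1 - nu / 2 + s) * rgamma (/ 2 - nu / 2 + s)) * Cexp (s * (2 * l)))); last by ring.
rewrite G; ring.
Qed.

Lemma tame_scal (sigma T : R) (m0 c : C) (f : C -> C -> C) :
  tame sigma T m0 f -> tame sigma T m0 (fun m s => c * f m s).
Proof.
move=> hf; have hc := Cmod_ge_0 c; split.
- move=> a ha; have [K [d [hK hd h]]] := tame_decay _ _ _ _ hf a ha.
  exists (Cmod c * K)%R, d; split => //; first exact: Rmult_le_pos.
  by move=> m s hm hs; rewrite Cmod_mult Rmult_assoc; apply: Rmult_le_compat_l => //; exact: h.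
- move=> U e he; have [d [hd h]] := tame_cont _ _ _ _ hf U (e / (Cmod c + 1))%R ltac:(apply: Rdiv_lt_0_compat; lra).
  exists d; split => // m s hm hs hU.
  have -> : c * f m s - c * f m0 s = c * (f m s - f m0 s) by ring.
  have -> : (e = (Cmod c + 1) * (e / (Cmod c + 1)))%R by field; lra.
  rewrite Cmod_mult; apply: Rmult_le_compat; try exact: Cmod_ge_0; first lra.
  exact: h.
have [d [hd h]] := tame_Apx _ _ _ _ hf; exists d; split => // m hm.
by apply: (loop_Apx_mult _ _ (fun=> c)); [apply: loop_Apx_all => S _; exact: Apx_const|exact: h].
Qed.

(** Valid for every [nu], also where rows of poles overlap: the loop stays away from all of them,
    and colliding poles inside it do not disturb the integrand on it. *)
Lemma quad_tame (nu l : C) (sigma T : R) : (0 <= T)%R ->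
  (forall b : C, List.In b (take 3 (quad_params nu)) -> (sigma < Re b)%R /\ (Rabs (Im b) < T)%R) ->
  tame sigma T nu (fun m s => / (2 * PI * Ci) * meijer_integrand 3 0 [::] (quad_params m) l s).
Proof.
move=> hT hsep; have c2 := C2_neq0.
have [s1 t1] := hsep (- nu / 2) (or_introl erefl).
have [s2 t2] := hsep (nu / 2) (or_intror (or_introl erefl)).
have [s3 t3] := hsep ((1 + nu) / 2) (or_intror (or_intror (or_introl erefl))).
have -> : (fun m s => / (2 * PI * Ci) * meijer_integrand 3 0 [::] (quad_params m) l s) =
  (fun m s => / (2 * PI * Ci) * (Cgamma (- m / 2 - s) * Cgamma (m / 2 - s) * Cgamma ((1 + m) / 2 - s) *
    (rgamma (1 - (1 - m) / 2 + s) * rgamma (1 - m / 2 + s) * rgamma (1 - (1 + m) / 2 + s)) * Cexp (s * l))).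
  apply: boolp.funext => m; apply: boolp.funext => s; rewrite meijer_integrand_nil /=; ring.
apply: tame_scal; apply: tame_mult_exp => //; apply: tame_mult.
  apply: tame_mult; last first.
    apply: (tame_gamma sigma T nu (fun m => (1 + m) / 2)) => //.
    by apply: (cont_at_ext (fun m => / 2 * m + / 2)) => [m|]; [field|exact: cont_at_affine].
  apply: tame_mult.
    apply: (tame_gamma sigma T nu (fun m => - m / 2)) => //.
    by apply: (cont_at_ext (fun m => - / 2 * m + 0)) => [m|]; [field|exact: cont_at_affine].
  apply: (tame_gamma sigma T nu (fun m => m / 2)) => //.
  by apply: (cont_at_ext (fun m => / 2 * m + 0)) => [m|]; [field|exact: cont_at_affine].
apply: tame_mult; last first.
  apply: (tame_rgamma sigma T nu (fun m => 1 - (1 + m) / 2)) => //.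
  by apply: (cont_at_ext (fun m => - / 2 * m + / 2)) => [m|]; [field|exact: cont_at_affine].
apply: tame_mult.
  apply: (tame_rgamma sigma T nu (fun m => 1 - (1 - m) / 2)) => //.
  by apply: (cont_at_ext (fun m => / 2 * m + / 2)) => [m|]; [field|exact: cont_at_affine].
apply: (tame_rgamma sigma T nu (fun m => 1 - m / 2)) => //.
by apply: (cont_at_ext (fun m => - / 2 * m + 1)) => [m|]; [field|exact: cont_at_affine].
Qed.

(** One loop serves a whole neighbourhood of [nu], as the passage to the limit in [quad_limit]
    requires. *)
Lemma sep_near (nu : C) (sigma T : R) :
  (forall b : C, List.In b (take 3 (quad_params nu)) -> (sigma < Re b)%R /\ (Rabs (Im b) < T)%R) ->
  exists d, (0 < d)%R /\ forall m, (Cmod (m - nu) < d)%R ->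
  forall b : C, List.In b (take 3 (quad_params m)) -> (sigma < Re b)%R /\ (Rabs (Im b) < T)%R.
Proof.
move=> hsep; have c2 := C2_neq0.
have one (b0 : C) (b : C -> C) : (sigma < Re b0)%R /\ (Rabs (Im b0) < T)%R ->
    (forall m, (Cmod (b m - b0) <= Cmod (m - nu))%R) ->
    exists d, (0 < d)%R /\ forall m, (Cmod (m - nu) < d)%R -> (sigma < Re (b m))%R /\ (Rabs (Im (b m)) < T)%R.
  move=> [h1 h2] hb; exists (Rmin (Re b0 - sigma) (T - Rabs (Im b0))); split; first by apply: Rmin_pos; lra.
  move=> m hm; have m1 := Rmin_l (Re b0 - sigma) (T - Rabs (Im b0)); have m2 := Rmin_r (Re b0 - sigma) (T - Rabs (Im b0)).
  have h := hb m; have k1 := Re_bnd (b m - b0); have k2 := Im_le_Cmod (b m - b0).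
  rewrite ReB in k1; rewrite ImB in k2; have k3 := Rabs_triang_inv (Im (b m)) (Im b0).
  by split; lra.
have half (x y : C) m : x - y = RtoC (/ 2) * (m - nu) \/ x - y = RtoC (- / 2) * (m - nu) -> (Cmod (x - y) <= Cmod (m - nu))%R.
  have h0 := Cmod_ge_0 (m - nu).
  by case=> ->; rewrite Cmod_mult Cmod_R; [rewrite Rabs_pos_eq|rewrite Rabs_left]; lra.
have i2 : RtoC (/ 2) = / 2 by rewrite RtoC_inv; [|lra].
have f1 m : (Cmod (- m / 2 - - nu / 2) <= Cmod (m - nu))%R.
  by apply: half; right; rewrite RtoC_opp i2; field.
have f2 m : (Cmod (m / 2 - nu / 2) <= Cmod (m - nu))%R.
  by apply: half; left; rewrite i2; field.
have f3 m : (Cmod ((1 + m) / 2 - (1 + nu) / 2) <= Cmod (m - nu))%R.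
  by apply: half; left; rewrite i2; field.
have [d1 [hd1 h1]] := one _ (fun m => - m / 2) (hsep (- nu / 2) (or_introl erefl)) f1.
have [d2 [hd2 h2]] := one _ (fun m => m / 2) (hsep (nu / 2) (or_intror (or_introl erefl))) f2.
have [d3 [hd3 h3]] := one _ (fun m => (1 + m) / 2) (hsep ((1 + nu) / 2) (or_intror (or_intror (or_introl erefl)))) f3.
exists (Rmin d1 (Rmin d2 d3)); split; first by apply: Rmin_pos => //; exact: Rmin_pos.
have m1 := Rmin_l d1 (Rmin d2 d3); have m2 := Rmin_r d1 (Rmin d2 d3).
have m3 := Rmin_l d2 d3; have m4 := Rmin_r d2 d3.
move=> m hm b /= [<-|[<-|[<-|[]]]]; [apply: h1|apply: h2|apply: h3]; lra.
Qed.

Lemma GK_quad (K : fieldExtType rat) (nu W : C) : imaginary_quadratic K ->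
  GK K nu W = meijerG 3 0 [::] (quad_params nu) (2 * Clog (W / 4)).
Proof.
by move=> /imaginary_quadratic_signature [h1 h2 h3]; rewrite /GK h1 h2 h3.
Qed.

(** The integral over a fixed loop is continuous at [nu]. For nearby [m] other than [nu] the number
    [2 m] is not an integer, so [quad_generic] evaluates the integral there. *)
Lemma quad_limit (nu W : C) (sigma T : R) : W <> 0 -> is_Cint (2 * nu) -> (0 <= T)%R ->
  (forall b : C, List.In b (take 3 (quad_params nu)) -> (sigma < Re b)%R /\ (Rabs (Im b) < T)%R) ->
  exists v, is_loop_integral (fun s => / (2 * PI * Ci) * meijer_integrand 3 0 [::] (quad_params nu) (2 * Clog (W / 4)) s) sigma T v /\
    clim_at (fun m => hyper_rhs m W (- Cexp (2 * Clog (W / 4)))) nu v.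
Proof.
move=> hW hnu hT hsep.
have ht := quad_tame nu (2 * Clog (W / 4)) sigma T hT hsep.
have [d [hd hex]] := tame_exists _ _ _ _ hT ht.
have [v hv] := hex nu (Cmod_diag_lt nu d hd); exists v; split => //.
have [V hV] := loop_fun (fun m s => / (2 * PI * Ci) * meijer_integrand 3 0 [::] (quad_params m) (2 * Clog (W / 4)) s) sigma T.
have hc := tame_clim _ _ _ _ _ _ hT ht hV hv.
have [d' [hd' hnear]] := sep_near _ _ _ hsep.
have hmin : (0 < Rmin d' (1 / 2))%R by apply: Rmin_pos; lra.
apply: (clim_at_ext _ _ _ _ _ hmin) hc => m hne hm.
have m1 := Rmin_l d' (1 / 2); have m2 := Rmin_r d' (1 / 2).
have hg : ~ is_Cint (2 * m).
  apply: (Cint_isolated 2 nu) => //; last lra.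
  by rewrite Cmod_R Rabs_pos_eq; lra.
have hq := quad_generic m W sigma T hW hg (hnear m ltac:(lra)).
exact: (loop_unique _ _ _ _ _ (hV m (ex_intro _ _ hq)) hq).
Qed.

(* The last of the three 0F5 terms has a minus sign in the source, which is
   wrong: the residues at s = (1 + nu) / 2 + k contribute it with a plus sign,
   as the cancellation of the poles at nu = 1 / 2 also requires. *)
Theorem theorem1p2 (x t nu : C) (hx : x <> 0) (ht : t <> 0) :
  GK (rat^o : fieldExtType rat) nu (x * t) =
    Ccos (PI * nu) * (2 / PI * besselK (2 * nu) (2 * Csqrt (x * t))
                      - besselY (2 * nu) (2 * Csqrt (x * t)))
    - Csin (PI * nu) * besselJ (2 * nu) (2 * Csqrt (x * t))
  /\
  forall K : fieldExtType rat, imaginary_quadratic K ->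
    let rhs := fun mu : C =>
      RtoC (sqrt PI) / Csin (2 * PI * mu) *
      ( Cpower 2 (1 - 4 * mu) / Cgamma (1 - 2 * mu) ^ 2
          * Cpower (x * t / 4) (- mu)
          * hypergeometric [::]
              [:: 1 - mu; 1 - mu; 1 / 2 - mu; 1 / 2 - mu; 1 / 2]
              (- (x ^ 2 * t ^ 2 / 16))
      - Cpower 2 (1 + 2 * mu) * Ccos (PI * mu) / Cgamma (1 + 2 * mu)
          * Cpower (x * t / 4) mu
          * hypergeometric [::]
              [:: 1 + mu; 1 / 2 + mu; 1 / 2; 1 / 2; RtoC 1]
              (- (x ^ 2 * t ^ 2 / 16))
      + Cpower 2 (4 + 2 * mu) * Csin (PI * mu) / Cgamma (2 + 2 * mu)
          * Cpower (x * t / 4) (1 + mu)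
          * hypergeometric [::]
              [:: 3 / 2 + mu; 1 + mu; 3 / 2; 3 / 2; RtoC 1]
              (- (x ^ 2 * t ^ 2 / 16))) in
    (~ is_Cint (2 * nu) -> GK K nu (x * t) = rhs nu) /\
    (is_Cint (2 * nu) ->
       filterlim rhs (locally' nu) (locally (GK K nu (x * t)))).
Proof.
have hW : x * t <> 0 by apply: Cmult_neq_0.
split; first exact: GK_rat.
move=> K hK rhs.
have h4 : RtoC 4 <> 0 by move/RtoC_inj; lra.
(* The argument is minus the square of [x t / 4]; written with the chosen logarithm it matches the
   residue sums. *)
have hX : - (x ^ 2 * t ^ 2 / 16) = - Cexp (2 * Clog (x * t / 4)).
  have -> : 2 * Clog (x * t / 4) = Clog (x * t / 4) + Clog (x * t / 4) by ring.
  have h0 : x * t / 4 <> 0 by apply: Cmult_neq_0 => //; apply: Cinv_neq0.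
  rewrite Cexp_plus Cexp_Clog //.
  have -> : RtoC 16 = 4 * 4 by rewrite -RtoC_mult; congr RtoC; ring.
  by field.
have hr mu : rhs mu = hyper_rhs mu (x * t) (- Cexp (2 * Clog (x * t / 4))) by rewrite -hX.
rewrite GK_quad //; split=> hnu.
  rewrite hr; apply: meijerG_eq => sigma T hT hsep; exact: quad_generic.
have [sigma [T [hT hsep]]] := separating_exists (take 3 (quad_params nu)).
have [v [hv hc]] := quad_limit nu (x * t) sigma T hW hnu ltac:(lra) hsep.
(* The integral over any other loop is a limit of the same closed form at the same point, so
   [clim_at_unique] shows that all separating loops give [v]. *)
have -> : meijerG 3 0 [::] (quad_params nu) (2 * Clog (x * t / 4)) = v.
  apply: meijerG_eq => sigma' T' hT' hsep'.
  have [v' [hv' hc']] := quad_limit nu (x * t) sigma' T' hW hnu ltac:(lra) hsep'.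
  by rewrite (clim_at_unique _ _ _ _ hc hc').
apply: clim_at_filterlim; apply: (clim_at_ext _ _ _ _ 1 Rlt_0_1) hc => m _ _.
by rewrite hr.
Qed.
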